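(* Let $1\le p\le\infty$. Suppose that $f,g:\mathbb{R}\to\mathbb{R}$ are locally Lipschitz, that there are nonnegative constants $k_1,k_2,c_1,c_2$ with $|g(x)|\le k_1|x|+k_2$ and $|f(x)|\le c_1|x|+c_2$ for all $x\in\mathbb{R}$, that $k_1\beta c_1<1$, and that $g\in C^1(\mathbb{R})$ with $|g'(x)|\le k_3|x|+k_4$ for all $x\in\mathbb{R}$ and some nonnegative constants $k_3,k_4$. Let $\rho>0$ and assume that $|g(x)|<\rho$ for all $x\in\mathbb{R}$, that $g^{-1}$ is continuous in $]-\rho,\rho[$, that the function $$\theta(m)=-\tfrac12 f(m)^2-hf(m)-\beta^{-1}i(m),\qquad i(m)=-\int_0^{f(m)}g^{-1}(f^{-1}(s))\,ds,\qquad m\in[-\rho,\rho],$$ has a global minimum in $]-\rho,\rho[$, and that $f$ has positive derivative. Then the flow $T(t)$ generated by $\partial_t u=-u+F(u)$, restricted to the set $\{u\in L^p(\Omega):\|u\|_\infty\le\rho\}$ with the topology of $L^p(\Omega)$, is gradient.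
   Context: $\Omega\subset\mathbb{R}^N$ ($N\ge1$) is a bounded smooth domain; $h\ge 0$ and $\beta>0$ are constants. $J:\mathbb{R}^N\times\mathbb{R}^N\to\mathbb{R}$ is a nonnegative symmetric function of class $C^1$ with $\int_{\mathbb{R}^N}J(x,y)\,dy=\int_{\mathbb{R}^N}J(x,y)\,dx=1$, and $Kv(x)=\int_{\mathbb{R}^N}J(x,y)v(y)\,dy$. The phase space is $X=\{u\in L^p(\mathbb{R}^N): u(x)=0 \text{ for } x\in\mathbb{R}^N\setminus\Omega\}$ with the $L^p$ norm, identified with $L^p(\Omega)$. $F(u)(x)=g(\beta K(f\circ u)(x)+\beta h)$ for $x\in\Omega$ and $F(u)(x)=0$ for $x\in\mathbb{R}^N\setminus\Omega$. $T(t)u_0=u(\cdot,t)$, $t\ge0$, where $u$ is the global solution of $\partial_t u=-u+F(u)$, $u(\cdot,0)=u_0$. It is implicit in the definition of $\theta$ that the inverse functions $f^{-1}$, $g^{-1}$ occurring there exist and that $\theta$ is a well-defined real-valued function on $[-\rho,\rho]$ (the integral defining $i(\pm\rho)$ being possibly improper but convergent). A semigroup $T(t)$ is gradient (in the sense of Hale) if each bounded positive orbit is precompact and there is a Lyapunov functional for $T(t)$, i.e. a continuous real-valued function $V$ on the phase space, bounded below, with $V(u)\to\infty$ as $\|u\|\to\infty$ (void on a bounded phase space), such that $t\mapsto V(T(t)u)$ is nonincreasing for each $u$, and such that if $T(t)u$ is defined for all $t\in\mathbb{R}$ and $V(T(t)u)=V(u)$ for all $t\in\mathbb{R}$ then $u$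 is an equilibrium. *)

(* Defs.v *)
From HB Require Import structures.
From mathcomp Require Import all_boot all_order all_algebra.
From mathcomp Require Import all_classical all_reals all_analysis.
From mathcomp Require Import measurable_realfun.

Set Implicit Arguments.
Unset Strict Implicit.
Unset Printing Implicit Defensive.

Import Order.TTheory GRing.Theory Num.Theory.
Import numFieldNormedType.Exports.

Local Open Scope classical_set_scope.
Local Open Scope ring_scope.

Definition rV_display : measure_display. Proof. exact: default_measure_display. Qed.

Section rV_measurable.
Context {R : realType} {n : nat}.

Definition rV_cylinders : set (set 'rV[R]_n) :=
  [set A | exists i (B : set (measurableTypeR R)),
     measurable B /\ A = (fun x : 'rV[R]_n => x ord0 i) @^-1` B].

Let rV_set0 : <<s rV_cylinders >> set0.
Proof. exact: sigma_algebra0. Qed.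

Let rV_setC A : <<s rV_cylinders >> A -> <<s rV_cylinders >> (~` A).
Proof. exact: sigma_algebraC. Qed.

Let rV_bigcup (F : (set 'rV[R]_n)^nat) :
  (forall i, <<s rV_cylinders >> (F i)) -> <<s rV_cylinders >> (\bigcup_i F i).
Proof. exact: sigma_algebra_bigcup. Qed.

HB.instance Definition _ := @isMeasurable.Build rV_display
  'rV[R]_n <<s rV_cylinders >> rV_set0 rV_setC rV_bigcup.

Lemma measurable_coord i :
  measurable_fun [set: 'rV[R]_n]
    ((fun x => x ord0 i) : 'rV[R]_n -> measurableTypeR R).
Proof.
move=> _ B mB; rewrite setTI; apply: sub_sigma_algebra.
by exists i, B.
Qed.

Lemma measurable_fun_rV d (T : measurableType d) (f : T -> 'rV[R]_n) :
  (forall i, measurable_fun [set: T]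
     ((fun t => f t ord0 i) : T -> measurableTypeR R)) ->
  measurable_fun [set: T] f.
Proof.
move=> mf; apply: (@measurability _ _ _ _ _ _ rV_cylinders) => //.
by move=> _ [_ [i [B [mB ->]]] <-]; exact: mf.
Qed.

End rV_measurable.

Section rV_cons.
Context {R : realType} {n : nat}.

Definition rV_cons (z : measurableTypeR R * 'rV[R]_n) : 'rV[R]_n.+1 :=
  \row_i (if unlift ord0 i is Some j then z.2 ord0 j else z.1).

Definition rV_uncons (x : 'rV[R]_n.+1) : measurableTypeR R * 'rV[R]_n :=
  (x ord0 ord0, \row_j x ord0 (lift ord0 j)).

Lemma rV_consK : cancel rV_cons rV_uncons.
Proof.
move=> [a y]; congr pair; first by rewrite mxE unlift_none.
by apply/rowP => j; rewrite !mxE liftK.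
Qed.

Lemma rV_unconsK : cancel rV_uncons rV_cons.
Proof.
by move=> x; apply/rowP => i; rewrite mxE; case: unliftP => [j|] ->;
  rewrite ?mxE.
Qed.

Lemma measurable_rV_cons : measurable_fun setT rV_cons.
Proof.
apply: measurable_fun_rV => i; case: (unliftP ord0 i) => [j|] ->.
  under eq_fun do rewrite mxE liftK.
  exact: (measurableT_comp (measurable_coord j) measurable_snd).
under eq_fun do rewrite mxE unlift_none.
exact: measurable_fst.
Qed.

Lemma measurable_rV_uncons : measurable_fun setT rV_uncons.
Proof.
apply/measurable_fun_pairP; split; first exact: measurable_coord.
apply: measurable_fun_rV => j; rewrite /comp/=.
under eq_fun do rewrite mxE.
exact: measurable_coord.
Qed.

End rV_cons.

Section lebesgue_rV_step.
Local Open Scope ereal_scope.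
Context {R : realType} {n : nat}.
Variable mu : {sigma_finite_measure set 'rV[R]_n -> \bar R}.

Definition lebesgue_rV_step : set 'rV[R]_n.+1 -> \bar R :=
  pushforward (@lebesgue_measure R \x mu) rV_cons.

Let step0 : lebesgue_rV_step set0 = 0.
Proof. by rewrite /lebesgue_rV_step /pushforward preimage_set0 measure0. Qed.

Let step_ge0 A : 0 <= lebesgue_rV_step A.
Proof. by rewrite /lebesgue_rV_step /pushforward measure_ge0. Qed.

Let step_sigma_additive : semi_sigma_additive lebesgue_rV_step.
Proof.
move=> F mF tF mUF; rewrite /lebesgue_rV_step /pushforward preimage_bigcup.
apply: measure_semi_sigma_additive.
- by move=> k; rewrite -[X in measurable X]setTI; exact: measurable_rV_cons.
- apply/trivIsetP => /= i j _ _ ij; rewrite -preimage_setI.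
  by move/trivIsetP : tF => /(_ _ _ _ _ ij) ->//; rewrite preimage_set0.
- rewrite -preimage_bigcup -[X in measurable X]setTI.
  exact: measurable_rV_cons.
Qed.

HB.instance Definition _ := isMeasure.Build _ _ _
  lebesgue_rV_step step0 step_ge0 step_sigma_additive.

Let step_sigma_finite : sigma_finite setT lebesgue_rV_step.
Proof.
have /sigma_finiteP[F [TF ndF Foo]] := sigma_finiteT (@lebesgue_measure R).
have /sigma_finiteP[G [TG ndG Goo]] := sigma_finiteT mu.
exists (fun k => @rV_uncons R n @^-1` (F k `*` G k)).
  rewrite -preimage_bigcup (_ : \bigcup_k _ = setT) ?preimage_setT//.
  apply/seteqP; split=> // -[x y] _.
  have [k _ Fkx] : (\bigcup_k F k) x by rewrite -TF.
  have [l _ Gly] : (\bigcup_k G k) y by rewrite -TG.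
  exists (maxn k l) => //; split.
    by move: x Fkx; exact/subsetPset/ndF/leq_maxl.
  by move: y Gly; exact/subsetPset/ndG/leq_maxr.
move=> k; have [mFk Fk] := Foo k; have [mGk Gk] := Goo k; split.
  rewrite -[X in measurable X]setTI; apply: measurable_rV_uncons => //.
  exact: measurableX.
rewrite /lebesgue_rV_step /pushforward -comp_preimage.
rewrite (_ : _ \o _ = id); last by apply/funext; exact: rV_consK.
by rewrite preimage_id product_measure1E// lte_mul_pinfty// ge0_fin_numE.
Qed.

HB.instance Definition _ := Measure_isSigmaFinite.Build _ _ _
  lebesgue_rV_step step_sigma_finite.

End lebesgue_rV_step.

(** Iterated product of the one-dimensional Lebesgue measure; its values on
    boxes are given by [lebesgue_rV_box]. *)
Fixpoint lebesgue_rV {R : realType} (n : nat) :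
    {sigma_finite_measure set 'rV[R]_n -> \bar R} :=
  match n with
  | 0 => [the {sigma_finite_measure set 'rV[R]_0 -> \bar R} of
           @dirac _ 'rV[R]_0 0 R]
  | m.+1 => [the {sigma_finite_measure set 'rV[R]_m.+1 -> \bar R} of
           lebesgue_rV_step (lebesgue_rV m)]
  end.

Lemma lebesgue_rV_box {R : realType} n (B : 'I_n -> set (measurableTypeR R)) :
  (forall i, measurable (B i)) ->
  lebesgue_rV n [set x | forall i, B i (x ord0 i)] =
  (\prod_i lebesgue_measure (B i))%E.
Proof.
elim: n B => [|n IH] B mB.
  by rewrite big_ord0 /= diracE mem_set// => -[].
rewrite /= /lebesgue_rV_step /pushforward.
rewrite (_ : _ @^-1` _ = B ord0 `*`
  [set x : 'rV[R]_n | forall i, B (lift ord0 i) (x ord0 i)]); last first.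
  apply/seteqP; split=> -[a y] /= H.
    split; first by have := H ord0; rewrite mxE unlift_none.
    by move=> i; have := H (lift ord0 i); rewrite mxE liftK.
  by move=> i; rewrite mxE; case: unliftP => [j|] ->; [exact: H.2|exact: H.1].
rewrite product_measure1E//; last first.
  rewrite (_ : mkset _ = \bigcap_(i in [set: 'I_n])
      ((fun x : 'rV[R]_n => x ord0 i) @^-1` B (lift ord0 i))); last first.
    by apply/seteqP; split=> x /= H => [i _|i]; exact: H.
  apply: fin_bigcap_measurable => // i _.
  by rewrite -[X in measurable X]setTI; exact: measurable_coord.
rewrite big_ord_recl; congr (_ * _)%E.
exact: (IH (fun i => B (lift ord0 i))).
Qed.


Section Lp_metric.
Context d (T : measurableType d) (R : realType).
Variables (mu : {measure set T -> \bar R}) (p : \bar R) (p1 : (1 <= p)%E).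

HB.instance Definition _ := gen_eqMixin (LspaceType mu p1).
HB.instance Definition _ := gen_choiceMixin (LspaceType mu p1).

Implicit Types u v w : LspaceType mu p1.

Lemma measurable_Lspace u : measurable_fun setT (u : T -> measurableTypeR R).
Proof. exact: measurable_funPT. Qed.

Lemma Lspace_inj u v : (u : T -> R) = v %[ae mu] -> u = v.
Proof.
case: u v => [u [[Pu]]] [v [[Pv]]]/= uv.
have E : u = v by rewrite -[u]reprK -[v]reprK; exact/eqP/ae_eqP.
rewrite -E in Pv *; congr LebesgueSpace.Pack; congr LebesgueSpace.Class.
by congr isFinLebesgue.Axioms_; exact: Prop_irrelevance.
Qed.

Definition Lp_dist u v : R := fine 'N[mu]_p[EFin \o (u \- v)%R].

Let LnormB (f g : T -> R) : measurable_fun setT f -> measurable_fun setT g ->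
  ('N[mu]_p[EFin \o (f \- g)%R] <=
   'N[mu]_p[EFin \o f] + 'N[mu]_p[EFin \o g])%E.
Proof.
move=> mf mg; have mgN : measurable_fun setT (\- g) by exact: measurable_funN.
apply: le_trans (eminkowski mu mf mgN p1) _.
by rewrite leeD2l// -[leRHS]oppe_Lnorm.
Qed.

Lemma Lp_dist_fin u v : (Lp_dist u v)%:E = 'N[mu]_p[EFin \o (u \- v)%R]%E.
Proof.
rewrite fineK// ge0_fin_numE ?Lnorm_ge0//.
apply: le_lt_trans (LnormB (measurable_Lspace u) (measurable_Lspace v)) _.
by rewrite lte_add_pinfty//; exact: Lebesgue_finite.
Qed.

Let Lp_distxx u : Lp_dist u u = 0.
Proof.
rewrite /Lp_dist (_ : _ \o _ = cst 0%E) ?Lnorm0//.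
  by rewrite gt_eqF// (lt_le_trans _ p1).
by apply/funext => x /=; rewrite subrr.
Qed.

Let Lp_dist_eq0 u v : Lp_dist u v = 0 -> u = v.
Proof.
move=> /(congr1 (@EFin R)); rewrite Lp_dist_fin => uv0.
apply: Lspace_inj.
have muv : measurable_fun setT (EFin \o (u \- v)%R).
  apply/measurable_EFinP; apply: measurable_funB; exact: measurable_Lspace.
have := Lnorm_eq0_eq0 muv (lt_le_trans lte01 p1) uv0.
by apply: filterS => x /(_ I) [] /subr0_eq.
Qed.

Let Lp_dist_sym u v : Lp_dist u v = Lp_dist v u.
Proof.
rewrite /Lp_dist -[in LHS]oppe_Lnorm; congr (fine 'N[mu]_p[_]).
by apply/funext => x /=; rewrite opprB.
Qed.

Let Lp_dist_triangle v u w : Lp_dist u w <= Lp_dist u v + Lp_dist v w.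
Proof.
rewrite -lee_fin EFinD !Lp_dist_fin.
rewrite (_ : (u \- w)%R = ((u \- v) \- (w \- v))%R :> (T -> R)); last first.
  by apply/funext => x /=; rewrite opprB addrA subrK.
rewrite -(Lp_dist_fin v w) Lp_dist_sym Lp_dist_fin.
by apply: LnormB; apply: measurable_funB; exact: measurable_Lspace.
Qed.

HB.instance Definition _ := @isMetric.Build R (LspaceType mu p1)
  Lp_dist Lp_distxx Lp_dist_eq0 Lp_dist_sym Lp_dist_triangle.

End Lp_metric.

Definition Lp_norm d (T : measurableType d) (R : realType)
    (mu : {measure set T -> \bar R}) (p : \bar R) (p1 : (1 <= p)%E)
    (u : LspaceType mu p1) : R := fine 'N[mu]_p[EFin \o (u : T -> R)].

Arguments Lp_norm {d T R} mu {p} p1 u.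

(** On a finite-dimensional [V]: all iterated directional derivatives of order
    at most [k] exist and are continuous. *)
Fixpoint class_C {R : realType} {V : normedModType R} (k : nat) (phi : V -> R)
    : Prop :=
  if k is k'.+1 then
    (forall x v, derivable phi x v) /\
    (forall v, class_C k' (fun x => 'D_v phi x))
  else continuous phi.

(** Domain: nonempty connected open set. Its boundary is smooth if, near each
    of its points, the domain is the sublevel set [phi < 0] of a C^oo function
    whose differential does not vanish at that point. *)
Definition smooth_domain {R : realType} {N : nat} (Omega : set 'rV[R]_N) :=
  [/\ Omega !=set0, open Omega, connected Omega &
      forall x0, (closure Omega `\` Omega) x0 ->
      exists phi : 'rV[R]_N -> R,
        [/\ forall k, class_C k phi,
            exists v, 'D_v phi x0 != 0 &
            \forall x \near x0, Omega x <-> phi x < 0]].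

(** A semigroup is given by a family [T t] on a metric space [M], considered
    for [0 <= t] on a subset [D] of [M] carrying the induced topology. *)
Section gradient_semigroup.
Context {R : realType} {M : metricType R}.
Variables (D : set M) (T : R -> M -> M).

Definition semigroup_on :=
  [/\ forall t u, 0 <= t -> D u -> D (T t u),
      forall u, D u -> T 0 u = u,
      forall s t u, 0 <= s -> 0 <= t -> D u -> T (s + t) u = T s (T t u) &
      {within [set z : R * M | 0 <= z.1 /\ D z.2],
        continuous (fun z => T z.1 z.2)}].

Definition positive_orbit (u : M) : set M :=
  [set v | exists2 t, 0 <= t & v = T t u].

Definition equilibrium (u : M) := forall t, 0 <= t -> T t u = u.

(** [phi t] plays the role of [T t u] for all real [t], where [u = phi 0]. *)
Definition complete_orbit (phi : R -> M) :=
  (forall t, D (phi t)) /\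
  (forall s t, 0 <= t -> T t (phi s) = phi (t + s)).

Variable nrm : M -> R.

Definition lyapunov_functional (V : M -> R) :=
  [/\ {within D, continuous V},
      exists m, forall u, D u -> m <= V u,
      forall A, exists r, forall u, D u -> r <= nrm u -> A <= V u,
      forall u s t, D u -> 0 <= s -> s <= t -> V (T t u) <= V (T s u) &
      forall phi, complete_orbit phi ->
        (forall t, V (phi t) = V (phi 0)) -> equilibrium (phi 0)].

Definition gradient_on :=
  [/\ semigroup_on,
      forall u, D u -> (exists r, forall t, 0 <= t -> nrm (T t u) <= r) ->
        compact (D `&` closure (positive_orbit u)) &
      exists V, lyapunov_functional V].

End gradient_semigroup.

Section neural_field.
Context {R : realType} {N : nat}.
Variables (Omega : set 'rV[R]_N) (J : 'rV[R]_N -> 'rV[R]_N -> R).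
Variables (f g : R -> R) (beta h : R).

Definition Kop (v : 'rV[R]_N -> R) (x : 'rV[R]_N) : R :=
  \int[lebesgue_rV N]_y (J x y * v y).

Definition Fop (u : 'rV[R]_N -> R) (x : 'rV[R]_N) : R :=
  if x \in Omega then g (beta * Kop (f \o u) x + beta * h) else 0.

Variables (p : \bar R) (p1 : (1 <= p)%E).
Local Notation Lp := (LspaceType (@lebesgue_rV R N) p1).

(** L^p functions on R^N vanishing outside [Omega]. Here and below, [u x] is
    the value at [x] of a representative of the class [u]; every notion used is
    invariant under modification on a null set. *)
Definition phase_space : set Lp :=
  [set u | \forall x \ae lebesgue_rV N, ~ Omega x -> u x = 0].

(** The difference quotients of [u] at [t], taken within [0, +oo[, converge in
    L^p to [- u t + F (u t)]. *)
Definition global_solution (u0 : Lp) (u : R -> Lp) :=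
  [/\ u 0 = u0,
      forall t, 0 <= t -> phase_space (u t) &
      forall t, 0 <= t ->
        (fun s => 'N[lebesgue_rV N]_p[EFin \o (fun x =>
           (s - t)^-1 * (u s x - u t x) - (- u t x + Fop (u t) x))%R])%E
        @ within [set s | 0 <= s] t^' --> 0%E].

(** [T t u0] is only constrained for [0 <= t] and [u0] in the phase space. *)
Definition generates_flow (T : R -> Lp -> Lp) :=
  forall u0, phase_space u0 -> global_solution u0 (T ^~ u0).

Definition phase_ball (rho : R) : set Lp :=
  [set u | phase_space u /\
    ('N[lebesgue_rV N]_(+oo)[EFin \o (u : 'rV[R]_N -> R)] <= rho%:E)%E].

End neural_field.

Arguments phase_ball {R N} Omega {p} p1 rho.

Section theta.
Context {R : realType}.

Definition oriented_integral (phi : R -> R) (a b : R) : R :=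
  if a <= b then \int[@lebesgue_measure R]_(s in `[a, b]) phi s
  else - \int[@lebesgue_measure R]_(s in `[b, a]) phi s.

(** [finv] and [ginv] are the inverse functions of [f] and [g]. *)
Variables (f finv ginv : R -> R) (beta h : R).

Definition i_fun (m : R) : R :=
  - oriented_integral (fun s => ginv (finv s)) 0 (f m).

Definition theta (m : R) : R :=
  - (1 / 2) * f m ^+ 2 - h * f m - beta^-1 * i_fun m.

(** Strictly between [0] and [f m], the integrand is evaluated only where the
    inverse functions are defined, and it is integrable; it may be unbounded
    near the endpoints, where it has constant sign, so that integrability is
    the convergence of the improper integral. *)
Definition theta_well_defined (rho : R) :=
  forall m, m \in `[- rho, rho] ->
    (forall s, Num.min 0 (f m) < s < Num.max 0 (f m) ->
       exists2 w, w \in `]- rho, rho[ & f w = s) /\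
    (@lebesgue_measure R).-integrable `[Num.min 0 (f m), Num.max 0 (f m)]
      (EFin \o (fun s => ginv (finv s))).

End theta.

(* Main.v *)
Require Import Defs.
From HB Require Import structures.
From mathcomp Require Import all_boot all_order all_algebra.
From mathcomp Require Import all_classical all_reals all_analysis.
From mathcomp Require Import measurable_realfun ess_sup_inf ring lra.

(** The flow is gradient for the following reasons.

    A solution of [u' = - u + F(u)] is a relaxation [w' = G - w] with forcing
    [G t = F (u t)]. The domain has finite measure, so an [L^p] solution is also an
    [L^1] solution on the domain, and [relaxation_enclosure] is a comparison
    principle for such relaxations: if [G] stays within [b] of a fixed function [c],
    then [w t] stays within [(1 - exp (- t)) b] of [exp (- t) w(0) + (1 - exp (- t)) c].
    Its instances give the invariance of the ball of radius [rho]; the entry, after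
    any positive time, into a ball of radius less than [rho] (the argument of [g]
    stays in a compact interval, on which [`|g|] has a maximum less than [rho]); the
    expansion of a solution to second order in time; and, applied to the
    difference of two solutions together with Gronwall's lemma, a pointwise
    stability estimate from which uniqueness, the semigroup law and
    joint continuity follow.

    Orbits are precompact because the kernel regularizes. Iterating the expansion
    over small steps ([orbit_approximation]) shows that [u t] is uniformly close
    to [a u(0) + w] with [a] in [[0, 1]] and [w] in a class of functions with a common
    bound and a common modulus of continuity inherited from [J]. That class is
    compact for pointwise convergence by Tychonoff's theorem, and on it
    pointwise convergence is uniform over the bounded domain.

    The Lyapunov functional is the free energy
    [V(u) = sg * integral of (- 1/2 v K v - (f 0 + h) v + beta^-1 P(u))] over the
    domain, where [v = f(u) - f 0] and [P] is a primitive of [ginv \o finv] composed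
    with [f]. The continuous injective function [ginv] is monotone, and the sign [sg]
    makes [sg * ginv] nondecreasing. As a function of [f m], [sg * P] is then convex,
    and comparing [u] at two nearby times gives, with [F] the field at the first
    time and [b] the relaxation of [u] towards [F] during a time [s], an
    increment at most
    [beta^-1 * integral of sg * (ginv b - ginv F) * (f b - f u)] plus [o(s)].
    The integrand is nonpositive, since [b] lies between [u] and [F], and it is at most
    [- c s] with [c > 0] wherever [u] differs from [F], since [f' > 0]. Thus
    [V] decreases along solutions, and if it is constant then Fatou's lemma forces
    [u = F(u)] almost everywhere. These estimates need [ginv] on a compact part of
    [] - rho, rho [] only, which the entry into a smaller ball provides. *)

Import Order.TTheory GRing.Theory Num.Theory.
Import numFieldNormedType.Exports.

Local Open Scope classical_set_scope.
Local Open Scope ring_scope.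

Set Implicit Arguments.
Unset Strict Implicit.
Unset Printing Implicit Defensive.

(** * Real functions *)

Section real_line.
Context {R : realType}.
Implicit Types (phi : R -> R) (t e : R).

(** Comparing [phi] with the line of slope [e] and letting [e] go to zero shows
    that a function whose upper right increments are at most [e * s] cannot
    increase. The condition on the left, half of left continuity, lets the
    supremum of the times where the comparison holds be attained. *)
Lemma dini_nonincreasing phi (b : R) : 0 <= b ->
  (forall t e, 0 <= t -> t < b -> 0 < e -> exists2 d, 0 < d &
     forall s, 0 < s -> s < d -> t + s <= b -> phi (t + s) <= phi t + e * s) ->
  (forall t e, 0 < t -> t <= b -> 0 < e -> exists2 d, 0 < d &
     forall s, 0 < s -> s < d -> s <= t -> phi t <= phi (t - s) + e) ->
  phi b <= phi 0.
Proof.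
move=> b0 Hr Hl; apply/ler_addgt0Pr => e' e'0.
(* [b + 1] rather than [b], which may be zero *)
pose e := e' / (b + 1); have b10 : 0 < b + 1 by lra.
have e0 : 0 < e by rewrite /e divr_gt0.
suff : phi b <= phi 0 + e * b.
  move=> h; apply: le_trans h _; rewrite lerD2l /e mulrAC ler_pdivrMr// ler_wpM2l; lra.
pose psi t := phi t - phi 0 - e * t.
suff : psi b <= 0 by rewrite /psi; lra.
pose A := [set t | [/\ 0 <= t, t <= b & psi t <= 0]].
have A0 : A 0 by split => //; rewrite /psi; lra.
have supA : has_sup A by split; [exists 0|exists b => t []].
pose s := sup A.
have s0 : 0 <= s by apply: ub_le_sup => //; case: supA.
have sb : s <= b by apply: ge_sup => //; [exists 0|move=> t []].
have As : psi s <= 0.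
  apply/ler_addgt0Pr => d d0; rewrite add0r.
  have [-> //|sN0] := eqVneq s 0; first by rewrite /psi; lra.
  have sgt0 : 0 < s by rewrite lt_neqAle eq_sym sN0.
  have [r r0 Hr'] := Hl s d sgt0 sb d0.
  have [t [t0 tb pt] tr] := sup_adherent r0 supA; rewrite -/s in tr.
  have ts : t <= s by apply: ub_le_sup => //; case: supA.
  move: ts; rewrite le_eqVlt => /predU1P[<-|ts]; first by rewrite ltW// (le_lt_trans pt).
  have := Hr' (s - t); rewrite subr_gt0 ts ltrBlDl -ltrBlDr tr.
  rewrite lerBlDr lerDl t0 opprB (addrC s) subrK => /(_ isT isT isT).
  have : e * t <= e * s by rewrite ler_wpM2l// ltW.
  by move: pt; rewrite /psi; lra.
have [<-//|sNb] := eqVneq s b.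
have slt : s < b by rewrite lt_neqAle sNb.
have [d d0 Hd] := Hr s e s0 slt e0.
pose r := Num.min (d / 2) (b - s).
have r0 : 0 < r by rewrite lt_min divr_gt0//= subr_gt0.
have rd : r < d by rewrite /r gt_min; apply/orP; left; lra.
have rb : s + r <= b by rewrite -lerBrDl /r ge_min lexx orbT.
have := Hd r r0 rd rb => h.
have : A (s + r).
  split; [lra|exact: rb|]; move: As h; rewrite /psi; lra.
by move=> /(ub_le_sup (proj2 supA)); rewrite -/s; lra.
Qed.

Lemma expRN_bounds (s : R) : 0 <= s -> s <= 1 -> 1 - s <= expR (- s) <= 1 - s + s ^+ 2.
Proof.
move=> s0 s1; rewrite expR_ge1Dx/=.
have h : 1 + s <= expR s by exact: expR_ge1Dx.
rewrite expRN -(@ler_pM2r _ (expR s)) ?expR_gt0// mulVf ?gt_eqF ?expR_gt0//.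
apply: (@le_trans _ _ ((1 - s + s ^+ 2) * (1 + s))).
  have : 0 <= s ^+ 3 by rewrite exprn_ge0.
  by rewrite !exprSr expr0; nra.
by rewrite ler_wpM2l//; nra.
Qed.

Lemma one_sub_expRN_itv (s : R) : 0 <= s -> 0 <= 1 - expR (- s) <= 1.
Proof.
by move=> s0; rewrite subr_ge0 gerBl expR_ge0 andbT -[leRHS]expR0 ler_expR oppr_le0.
Qed.

(** The square of the interval is compact and the local Lipschitz estimates are
    valid near each of its points, diagonal included, so finitely many of them
    give a constant valid for all pairs. *)
Lemma locally_lipschitz_itv (f : R -> R) (r : R) :
  [locally [lipschitz f x | x in [set: R]]] ->
  exists2 L, 0 <= L & forall x y, -r <= x <= r -> -r <= y <= r ->
    `|f x - f y| <= L * `|x - y|.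
Proof.
move=> flip.
have cK : compact (`[-r, r]%classic `*` `[-r, r]%classic : set (R * R)).
  by apply: compact_setX; exact: segment_compact.
have : \forall M \near +oo, forall z : R * R,
    (`[-r, r]%classic `*` `[-r, r]%classic) z ->
    `|f z.1 - f z.2| <= M * `|z.1 - z.2|.
  apply: (proj1 (compact_near_coveringP _) cK) => z Kz.
  have /pinfty_ex_gt0[M M0 HM] := flip z (conj I I).
  have HM' : \forall z' \near z, `|f z'.1 - f z'.2| <= M * `|z'.1 - z'.2|.
    have : \forall z' \near z, (setT `*` setT) z' ->
        `|f z'.1 - f z'.2| <= M * `|z'.1 - z'.2| by exact: HM.
    by apply: filterS => w; apply.
  exists ([set z' | `|f z'.1 - f z'.2| <= M * `|z'.1 - z'.2|],
          [set M' | M <= M']).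
    by split => //; apply: nbhs_pinfty_ge; exact: num_real.
  by move=> [z' M'] [/= h MM]; apply: (le_trans h); rewrite ler_wpM2r.
move=> /pinfty_ex_gt0[M M0 HM]; exists M; first exact: ltW.
move=> x y xr yr; apply: (HM (x, y)); split; rewrite /= in_itv/=; [exact: xr|exact: yr].
Qed.

End real_line.

(** * Borel sets of row vectors *)

Section borel_rV.
Context {R : realType} {n : nat}.

(** Countable base of the topology: cubes with rational centre and radius
    [1 / (m + 1)]. It makes every open set a countable union of cylinders, so
    that the sigma-algebra generated by the coordinates contains the open sets,
    on [R^n] and, with pairs of cubes, on [R^n * R^n]. *)
Definition rbox (c : 'rV[rat]_n * nat) : set 'rV[R]_n :=
  [set x | forall i, x ord0 i \in `]ratr (c.1 ord0 i) - c.2.+1%:R^-1,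
                                   ratr (c.1 ord0 i) + c.2.+1%:R^-1[].

Lemma measurable_rbox c : measurable (rbox c).
Proof.
have -> : rbox c = \bigcap_(i in [set: 'I_n])
    ((fun x : 'rV[R]_n => x ord0 i) @^-1` `]ratr (c.1 ord0 i) - c.2.+1%:R^-1,
                                   ratr (c.1 ord0 i) + c.2.+1%:R^-1[%classic).
  by apply/seteqP; split=> x /= H => [i _|i]; exact: H.
apply: fin_bigcap_measurable => // i _.
by rewrite -[X in measurable X]setTI; apply: measurable_coord.
Qed.

Lemma rbox_nbhs (x : 'rV[R]_n) (U : set 'rV[R]_n) : nbhs x U ->
  exists2 c, rbox c x & rbox c `<=` U.
Proof.
move=> /nbhs_ballP[e /= e0 xeU].
have [m me] : exists m : nat, 2 * m.+1%:R^-1 < e.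
  exists (Num.truncn (2 / e)); rewrite -ltr_pdivlMr ?invr_gt0//.
  by rewrite invrK mulrC -ltr_pdivrMr// truncnS_gt.
have im0 : 0 < m.+1%:R^-1 :> R by rewrite invr_gt0.
have Hq i : exists q : rat, ratr q \in `]x ord0 i - m.+1%:R^-1, x ord0 i + m.+1%:R^-1[.
  by apply: rat_in_itvoo; rewrite ltrBlDr -addrA ltrDl addr_gt0.
exists (\row_i sval (cid (Hq i)), m) => [i|y yc].
  rewrite mxE/=; case: cid => q /=; rewrite !in_itv/= => /andP[? ?].
  by apply/andP; split; [rewrite ltrBlDr | rewrite -ltrBlDr].
apply: xeU; split => // i j; rewrite (ord1 i) /ball/=.
have := yc j; rewrite mxE/=; case: cid => q /=.
rewrite !in_itv/= ltr_norml => /andP[q1 q2] /andP[y1 y2].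
move: me im0 q1 q2 y1 y2; set d := _^-1; move: (ratr q) (x _ _) (y _ _) d.
move=> q' x' y' d ? ? ? ? ? ?; apply/andP; split; lra.
Qed.

Lemma open_measurable_rV (U : set 'rV[R]_n) : open U -> measurable U.
Proof.
move=> oU.
have -> : U = \bigcup_(k in [set k | exists2 c, unpickle k = Some c & rbox c `<=` U])
   (if unpickle k is Some c then rbox c else set0).
  apply/seteqP; split => [x Ux|x [k [c /= ->]]]; last exact.
  have [c cx cU] := rbox_nbhs (open_nbhs_nbhs (conj oU Ux)).
  by exists (pickle c) => /=; rewrite ?pickleK//; exists c => //; rewrite pickleK.
apply: bigcup_measurable => k _; case: unpickle => [c|]; last exact: measurable0.
exact: measurable_rbox.
Qed.

Lemma open_measurable_rV2 (U : set ('rV[R]_n * 'rV[R]_n)) : open U -> measurable U.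
Proof.
move=> oU.
have -> : U = \bigcup_(k in [set k | exists2 c, unpickle k = Some c &
      rbox c.1 `*` rbox c.2 `<=` U])
   (if unpickle k is Some c then rbox c.1 `*` rbox c.2 else set0).
  apply/seteqP; split => [[x y] Ux|x [k [c /= ->]]]; last exact.
  have [[A B] /= [Ax By] ABU] := open_nbhs_nbhs (conj oU Ux).
  have [c cx cA] := rbox_nbhs Ax.
  have [c' cy cB] := rbox_nbhs By.
  exists (pickle (c, c')) => /=; rewrite ?pickleK//; exists (c, c') => //.
  by move=> [x' y'] /= [/cA ? /cB ?]; exact: ABU.
apply: bigcup_measurable => k _; case: unpickle => [c|]; last exact: measurable0.
by apply: measurableX; exact: measurable_rbox.
Qed.

Lemma continuous_measurable_gen d (X : measurableType d) (Y : topologicalType)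
    (i : X -> Y) (phi : Y -> R) :
  (forall U : set Y, open U -> measurable (i @^-1` U)) -> continuous phi ->
  measurable_fun setT (phi \o i : X -> measurableTypeR R).
Proof.
move=> oi cphi; apply: (measurability _ (RGenOpens.measurableE R)) => //.
move=> _ [_ [a [b ->] <-]]; rewrite setTI.
rewrite comp_preimage; apply: oi; apply: open_comp => [x _|]; first exact: cphi.
exact: interval_open.
Qed.

Lemma continuous_measurable_rV (phi : 'rV[R]_n -> R) :
  continuous phi -> measurable_fun setT (phi : _ -> measurableTypeR R).
Proof. by apply: continuous_measurable_gen; exact: open_measurable_rV. Qed.

Lemma continuous_measurable_rV2 (phi : 'rV[R]_n * 'rV[R]_n -> R) :
  continuous phi -> measurable_fun setT (phi : _ -> measurableTypeR R).
Proof. by apply: continuous_measurable_gen; exact: open_measurable_rV2. Qed.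

End borel_rV.

Lemma ler_coord_norm (R : realType) n (x : 'rV[R]_n) i : `|x ord0 i| <= `|x|.
Proof.
rewrite {2}/Num.norm/= mx_normrE.
exact: (le_bigmax _ (fun ij : 'I_1 * 'I_n => `|x ij.1 ij.2|) (ord0, i)).
Qed.

Section bounded_rV.
Context {R : realType} {n : nat} (Omega : set 'rV[R]_n).
Hypothesis Omega_bounded : bounded_set Omega.

Lemma bounded_subset_cube : exists2 M : R, 0 <= M &
  Omega `<=` [set x | forall i, `[-M, M]%classic (x ord0 i)].
Proof.
have /pinfty_ex_gt0[M M0 HM] := Omega_bounded.
exists M; first exact: ltW.
move=> x Ox i /=; rewrite in_itv/= -ler_norml.
apply: le_trans (HM x Ox).
exact: ler_coord_norm.
Qed.

Lemma bounded_subset_compact : exists2 Q, compact Q & Omega `<=` Q.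
Proof.
have [M M0 OM] := bounded_subset_cube.
exists [set x : 'rV[R]_n | forall i, `[-M, M]%classic (x ord0 i)] => //.
apply: (@rV_compact R n (fun=> `[-M, M]%classic)) => i.
exact: segment_compact.
Qed.

End bounded_rV.

Section bounded_rV_measure.
Context {R : realType} {n : nat}.

Lemma bounded_rV_lty (Omega : set 'rV[R]_n) : bounded_set Omega ->
  measurable Omega -> (lebesgue_rV n Omega < +oo)%E.
Proof.
move=> /bounded_subset_cube[M M0 OM] mO.
have mQ (i : 'I_n) : measurable (`[-M, M]%classic : set (measurableTypeR R)) by [].
have mQs : measurable [set x : 'rV[R]_n | forall i, `[-M, M]%classic (x ord0 i)].
  have -> : [set x : 'rV[R]_n | forall i, `[-M, M]%classic (x ord0 i)] =
      \bigcap_(i in [set: 'I_n]) ((fun x : 'rV[R]_n => x ord0 i) @^-1` `[-M, M]%classic).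
    by apply/seteqP; split=> x H => [i _|i]; [exact: H|exact: (H i I)].
  apply: fin_bigcap_measurable => // i _.
  by rewrite -[X in measurable X]setTI; apply: measurable_coord.
apply: (@le_lt_trans _ _ (lebesgue_rV n
    [set x | forall i, `[-M, M]%classic (x ord0 i)])).
  by apply: le_measure => //; rewrite inE.
rewrite (lebesgue_rV_box mQ).
rewrite (eq_bigr (fun=> (M - - M)%:E)) => [|i _].
  by rewrite prodEFin ltry.
rewrite lebesgue_measure_itv/= lte_fin.
by case: ltP => // ?; congr EFin; lra.
Qed.

End bounded_rV_measure.

(** * Continuity of C^1 functions *)

Section kernel_continuity.
Context {R : realType}.

(** The hypothesis on the directional derivatives bounds ['D_v phi] near [z],
    and the mean value theorem on the segments parallel to [v] gives a Lipschitz
    estimate in this one direction, uniformly in the base point. *)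
Lemma class_C1_line_lipschitz (V : normedModType R) (phi : V -> R) (v z : V) :
  class_C 1 phi -> exists C, exists2 r, 0 <= C /\ 0 < r & forall z' (t : R),
    `|z' - z| <= r -> `|t| <= r -> `|phi (z' + t *: v) - phi z'| <= C * `|t|.
Proof.
move=> [/= dphi /(_ v) cD].
have := cD z => /cvgr_norm_le => /(_ (`|'D_v phi z| + 1)).
rewrite ltrDl ltr01 => /(_ isT) /nbhs_ballP[r /= r0 Hr].
exists (`|'D_v phi z| + 1), (r / (2 * (`|v| + 1))).
  by rewrite addr_ge0// divr_gt0// mulr_gt0// ltr_wpDl.
move=> z' t z'r tr.
pose psi (s : R) : R := phi (z' + s *: v).
pose dpsi (s : R) : R := 'D_v phi (z' + s *: v).
have psiE (s : R) : (fun k : R => k^-1 *: (psi (k *: (1 : R) + s) - psi s)) =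
    (fun k : R => k^-1 *: (phi (k *: v + (z' + s *: v)) - phi (z' + s *: v))).
  apply/funext => k; rewrite /psi; congr (_ *: (phi _ - _)).
  by rewrite scalerDl /= /GRing.scale/= mulr1 addrCA.
have Dpsi (s : R) : is_derive s (1 : R) psi (dpsi s).
  split; first by rewrite /derivable psiE; exact: dphi.
  by rewrite /derive psiE.
have v10 : 0 < `|v| + 1 by rewrite ltr_wpDl.
have bd s : `|s| <= `|t| -> `|dpsi s| <= `|'D_v phi z| + 1.
  move=> st; apply: Hr; rewrite /= -ball_normE/= opprD addrA.
  apply: le_lt_trans (ler_normD _ _) _; rewrite normrN normrZ distrC.
  have h1 : `|s| * `|v| <= r / (2 * (`|v| + 1)) * `|v|.
    by rewrite ler_wpM2r// (le_trans st).
  apply: le_lt_trans (lerD z'r h1) _.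
  rewrite -[X in X + _]mulr1 -mulrDr addrC invfM mulrA -mulrA mulVf ?gt_eqF//.
  by rewrite mulr1; lra.
have cpsi (a b : R) : {within `[a, b], continuous psi}.
  apply: continuous_subspaceT => s; apply: differentiable_continuous.
  by apply/derivable1_diffP; have [] := Dpsi s.
have -> : phi (z' + t *: v) - phi z' = psi t - psi 0 by rewrite /psi scale0r addr0.
have [t0|t0] := leP 0 t.
  have [s] := MVT_segment t0 (fun x _ => Dpsi x) (cpsi _ _).
  rewrite in_itv/= subr0 => /andP[s0 st] ->; rewrite normrM ler_wpM2r//.
  by apply: bd; rewrite !ger0_norm.
have [s] := MVT_segment (ltW t0) (fun x _ => Dpsi x) (cpsi _ _).
rewrite in_itv/= sub0r => /andP[ts s0]; rewrite distrC => ->.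
rewrite normrM normrN ler_wpM2r//.
by apply: bd; rewrite !ler0_norm ?lerN2// ltW.
Qed.

(** The directions are crossed one after the other; the estimate in each
    direction is uniform near [z], hence applies from the point already reached. *)
Lemma class_C1_span_lipschitz (V : normedModType R) (phi : V -> R) (z : V)
  (I : Type) (v : I -> V) (s : seq I) :
  class_C 1 phi -> exists C, exists2 r, 0 <= C /\ 0 < r & forall (a : I -> R) m,
    (forall i, `|a i| <= m) -> m <= r ->
    `|phi (z + \sum_(i <- s) a i *: v i) - phi z| <= C * m.
Proof.
move=> Cphi; elim: s => [|i s [C [r [C0 r0] IH]]].
  exists 0, 1 => // a m _ _; by rewrite big_nil addr0 subrr normr0 mul0r.
have [C' [r' [C'0 r'0] H]] := class_C1_line_lipschitz (v i) z Cphi.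
pose S := \sum_(j <- s) `|v j| + 1.
have S0 : 0 < S by rewrite ltr_wpDl// sumr_ge0.
exists (C' + C), (Num.min r (Num.min r' (r' / S))).
  by rewrite addr_ge0// !lt_min r0 r'0 divr_gt0.
move=> a m am; rewrite !le_min => /andP[mr /andP[mr' mS]].
have m0 : 0 <= m by apply: le_trans (am i).
rewrite big_cons mulrDl.
set w := \sum_(j <- s) _.
have -> : z + (a i *: v i + w) = z + w + a i *: v i.
  by rewrite (addrC (a i *: v i)) addrA.
have -> : phi (z + w + a i *: v i) - phi z =
  (phi (z + w + a i *: v i) - phi (z + w)) + (phi (z + w) - phi z).
  by rewrite addrA subrK.
apply: le_trans (ler_normD _ _) (lerD _ _); last exact: IH.
apply: (@le_trans _ _ (C' * `|a i|)); last by rewrite ler_wpM2l.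
apply: H; last exact: le_trans (am i) mr'.
rewrite addrAC subrr add0r.
apply: (@le_trans _ _ (m * S)); last by rewrite -ler_pdivlMr.
apply: le_trans (ler_norm_sum _ _ _) _.
rewrite /S mulrDr mulr1 mulr_sumr; apply: ler_wpDr => //.
by apply: ler_sum => j _; rewrite normrZ ler_wpM2r.
Qed.

(** Continuity is not part of the definition of [class_C 1], which speaks of
    directional derivatives. It follows in finite dimension because
    finitely many directions, here the two canonical bases, span the space. *)
Lemma class_C1_continuous n (phi : 'rV[R]_n * 'rV[R]_n -> R) :
  class_C 1 phi -> continuous phi.
Proof.
move=> Cphi z.
pose v (i : 'I_n + 'I_n) : 'rV[R]_n * 'rV[R]_n :=
  match i with inl j => (delta_mx 0 j, 0) | inr j => (0, delta_mx 0 j) end.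
have [C [r [C0 r0] H]] := class_C1_span_lipschitz z v (index_enum ('I_n + 'I_n : finType)%type) Cphi.
have decomp (w : 'rV[R]_n * 'rV[R]_n) : w = \sum_i
    (match i with inl j => w.1 ord0 j | inr j => w.2 ord0 j end) *: v i.
  rewrite big_sumType/=.
  transitivity ((w.1, 0) + (0, w.2) : 'rV[R]_n * 'rV[R]_n).
    by case: w => a b /=; rewrite /GRing.add/= /add_pair/= addr0 add0r.
  congr (_ + _).
    rewrite [w.1 in LHS]row_sum_delta.
    rewrite (big_morph (fun x : 'rV[R]_n => (x, 0 : 'rV[R]_n))
      (id1 := 0) (op1 := +%R))//.
      by apply: eq_bigr => j _; rewrite /GRing.scale/= /scale_pair/= scaler0.
    by move=> a b; rewrite /GRing.add/= /add_pair/= addr0.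
  rewrite [w.2 in LHS]row_sum_delta.
  rewrite (big_morph (fun x : 'rV[R]_n => (0 : 'rV[R]_n, x))
    (id1 := 0) (op1 := +%R))//.
    by apply: eq_bigr => j _; rewrite /GRing.scale/= /scale_pair/= scaler0.
  by move=> a b; rewrite /GRing.add/= /add_pair/= addr0.
apply/cvgrPdist_le => e e0.
have d0 : 0 < Num.min r (e / (C + 1)).
  by rewrite lt_min r0 divr_gt0// ltr_wpDl.
apply/(@nbhs_normP R ('rV[R]_n * 'rV[R]_n)%type).
exists (Num.min r (e / (C + 1))) => //= z' /=.
rewrite distrC => zz'.
pose a (i : 'I_n + 'I_n) :=
  match i with inl j => (z' - z).1 ord0 j | inr j => (z' - z).2 ord0 j end.
have := H a `|z' - z|; rewrite -[X in z + X](decomp (z' - z)) (addrC z) subrK => H'.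
rewrite distrC; apply: le_trans (H' _ _) _.
- move=> i; apply: le_trans (_ : Num.max `|(z' - z).1| `|(z' - z).2| <= _); last by [].
  by case: i => j; rewrite le_max ler_coord_norm ?orbT.
- by apply: ltW; apply: lt_le_trans zz' _; rewrite ge_min lexx.
- apply: (@le_trans _ _ (C * (e / (C + 1)))).
    rewrite ler_wpM2l//; apply: ltW; apply: lt_le_trans zz' _.
    by rewrite ge_min lexx orbT.
  by rewrite mulrCA ler_piMr ?(ltW e0)// ler_pdivrMr ?ltr_wpDl// mul1r lerDl.
Qed.

(** * Uniformity over compact sets *)

Section compact_uniformity.
Context {U V : topologicalType} (phi : U * V -> R) (K : set V).
Hypotheses (cK : compact K) (cphi : continuous phi).

Lemma compact_equicontinuous_at x (e : R) : 0 < e ->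
  \forall x' \near x, forall y, K y -> `|phi (x, y) - phi (x', y)| <= e.
Proof.
move=> e0; apply: (proj1 (compact_near_coveringP _) cK) => y Ky.
have e20 : 0 < e / 2 by rewrite divr_gt0.
have H1 : \forall z \near (x, y), `|phi (x, y) - phi z| <= e / 2.
  by have /cvgrPdist_le h := @cphi (x, y); exact: h.
have [[A B] /= [Ax By] AB] := H1.
exists (B, A) => //= -[y' x'] [/= By' Ax'].
have := AB (x, y') (conj (nbhs_singleton Ax) By').
have := AB (x', y') (conj Ax' By').
rewrite /= => h1 h2; apply: (le_trans (ler_distD (phi (x, y)) _ _)).
by rewrite [e]splitr lerD// distrC.
Qed.

End compact_uniformity.

Lemma compact_prod_bounded (U : topologicalType) (phi : U -> R) (K : set U) :
  compact K -> continuous phi -> exists2 C : R, 0 < C & forall z, K z -> `|phi z| <= C.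
Proof.
move=> cK cphi.
have : compact (phi @` K).
  by apply: continuous_compact => //; apply: continuous_subspaceT.
move=> /compact_bounded/pinfty_ex_gt0[M M0 HM]; exists M => // z Kz.
by apply: HM; exists z.
Qed.

End kernel_continuity.

(** * Linear relaxation in L^1 *)

Section finite_L1.
Context d (T : measurableType d) (R : realType).
Variables (mu : {measure set T -> \bar R}) (D : set T).
Hypotheses (mD : measurable D) (fD : (mu D < +oo)%E).
Implicit Types phi psi : T -> R.

Local Notation intg phi := (mu.-integrable D (EFin \o phi)).

Definition L1norm phi : R := \int[mu]_(x in D) `|phi x|.

Lemma intg_measurable phi : intg phi -> measurable_fun D phi.
Proof. by move=> /measurable_int/measurable_EFinP. Qed.

Lemma intg_le_ae phi psi : measurable_fun D phi -> intg psi ->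
  {ae mu, forall x, D x -> `|phi x| <= psi x} -> intg phi.
Proof.
move=> mphi ipsi le; apply/integrableP; split; first exact/measurable_EFinP.
have mpsi := intg_measurable ipsi.
apply: (@le_lt_trans _ _ (\int[mu]_(x in D) `|(psi x)%:E|)%E).
  apply: ae_ge0_le_integral => //.
  - by apply/measurable_EFinP; exact: measurableT_comp.
  - by apply/measurable_EFinP; exact: measurableT_comp.
  - by apply: filterS le => x h /h; rewrite lee_fin => /le_trans; apply; rewrite ler_norm.
by have /integrableP[] := ipsi.
Qed.

Lemma intg_cst (r : R) : intg (cst r).
Proof.
apply/integrableP; split; first by apply/measurable_EFinP; exact: measurable_cst.
rewrite (_ : (fun x => _) = cst `|r|%:E); last exact/funext.
by rewrite integral_cst//= lte_mul_pinfty.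
Qed.

Lemma intg_bounded phi (M : R) : measurable_fun D phi ->
  {ae mu, forall x, D x -> `|phi x| <= M} -> intg phi.
Proof. by move=> mphi; exact: (intg_le_ae mphi (intg_cst M)). Qed.

Lemma intgD phi psi : intg phi -> intg psi -> intg (fun x => phi x + psi x).
Proof. by move=> i1 i2; have := integrableD mD i1 i2. Qed.

Lemma intgB phi psi : intg phi -> intg psi -> intg (fun x => phi x - psi x).
Proof. by move=> i1 i2; have := integrableB mD i1 i2. Qed.

Lemma intgZ (r : R) phi : intg phi -> intg (fun x => r * phi x).
Proof. by move=> i1; have := integrableZl mD r i1. Qed.

Lemma intg_norm phi : intg phi -> intg (fun x => `|phi x|).
Proof. exact: integrable_norm. Qed.

Lemma intg_max0 phi : intg phi -> intg (fun x => Num.max 0 (phi x)).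
Proof.
move=> iphi; apply: (intg_le_ae _ (intg_norm iphi)).
  by apply: measurable_maxr => //; exact: intg_measurable.
apply/aeW => x _; rewrite ger0_norm ?le_max ?lexx//.
by rewrite ge_max normr_ge0 ler_norm.
Qed.

Lemma le_int_ae phi psi : intg phi -> intg psi ->
  {ae mu, forall x, D x -> phi x <= psi x} ->
  \int[mu]_(x in D) phi x <= \int[mu]_(x in D) psi x.
Proof.
move=> iphi ipsi le; rewrite -subr_ge0 -RintegralB//.
have -> : \int[mu]_(x in D) (psi x - phi x) =
    \int[mu]_(x in D) Num.max 0 (psi x - phi x).
  congr fine; apply: ae_eq_integral => //.
  - by apply: (measurable_int mu); exact: intgB.
  - by apply: (measurable_int mu); apply: intg_max0; exact: intgB.
  - by apply: filterS le => x h /h px; rewrite max_r// subr_ge0.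
by apply: Rintegral_ge0 => x _; rewrite le_max lexx.
Qed.

Lemma l1norm_ge0 phi : 0 <= L1norm phi.
Proof. exact: Rintegral_ge0. Qed.

Lemma le_l1norm phi psi : intg phi -> intg psi ->
  {ae mu, forall x, D x -> `|phi x| <= psi x} -> L1norm phi <= \int[mu]_(x in D) psi x.
Proof. by move=> iphi ipsi; apply: le_int_ae => //; exact: intg_norm. Qed.

Lemma normr_int_le phi : intg phi -> `|\int[mu]_(x in D) phi x| <= L1norm phi.
Proof. exact: le_normr_Rintegral. Qed.

Lemma l1normD phi psi : intg phi -> intg psi ->
  L1norm (fun x => phi x + psi x) <= L1norm phi + L1norm psi.
Proof.
move=> i1 i2; rewrite -RintegralD//; [|exact: intg_norm..].
apply: le_l1norm; [exact: intgD|by apply: intgD; exact: intg_norm|].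
by apply/aeW => x _; exact: ler_normD.
Qed.

Lemma l1normZ (r : R) phi : intg phi -> L1norm (fun x => r * phi x) = `|r| * L1norm phi.
Proof.
move=> i1; rewrite /L1norm -RintegralZl//; last exact: intg_norm.
by apply: eq_Rintegral => x _; rewrite normrM.
Qed.

Lemma l1norm_eq0 phi : intg phi -> L1norm phi <= 0 -> {ae mu, forall x, D x -> phi x = 0}.
Proof.
move=> iphi le0.
have l0 : L1norm phi = 0 by apply/eqP; rewrite eq_le le0 l1norm_ge0.
have mphi : measurable_fun D (EFin \o phi) by exact: (measurable_int mu).
have : (\int[mu]_(x in D) `|(EFin \o phi) x|)%E = 0%E.
  transitivity (L1norm phi)%:E; last by rewrite l0.
  rewrite /L1norm /Rintegral fineK//.
  by rewrite ge0_fin_numE ?integral_ge0//; have /integrableP[] := iphi.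
move=> /(ae_eq_integral_abs mu mD mphi); apply: filterS => x h /h [].
by move=> [].
Qed.

Lemma int_max0_le0 phi : intg phi -> \int[mu]_(x in D) Num.max 0 (phi x) <= 0 ->
  {ae mu, forall x, D x -> phi x <= 0}.
Proof.
move=> iphi le0; have := @l1norm_eq0 _ (intg_max0 iphi).
have -> : L1norm (fun x => Num.max 0 (phi x)) = \int[mu]_(x in D) Num.max 0 (phi x).
  by apply: eq_Rintegral => x _; rewrite ger0_norm// le_max lexx.
move=> /(_ le0); apply: filterS => x h /h <-; by rewrite le_max lexx orbT.
Qed.

(** [w] solves [w' = G - w] on [0, +oo[, the derivative being taken in [L^1(D)].
    The forcing [G] is kept abstract so that the same estimates serve for a
    solution of the nonlinear equation and for the difference of two of them. *)
Definition l1_relaxation (w G : R -> T -> R) :=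
  [/\ forall t, 0 <= t -> intg (w t), forall t, 0 <= t -> intg (G t) &
    forall t e : R, 0 <= t -> 0 < e -> exists2 r : R, 0 < r & forall s : R, 0 <= s ->
      `|s - t| < r ->
      L1norm (fun x => w s x - w t x - (s - t) * (G t x - w t x)) <= e * `|s - t|].

Lemma l1_relaxation_increment (w G : R -> T -> R) (t s e : R) : l1_relaxation w G ->
   0 <= t -> 0 <= s ->
  L1norm (fun x => w s x - w t x - (s - t) * (G t x - w t x)) <= e * `|s - t| ->
  L1norm (fun x => w s x - w t x) <= (L1norm (fun x => G t x - w t x) + e) * `|s - t|.
Proof.
move=> [iw iG _] t0 s0 h.
have iD := intgB (iG _ t0) (iw _ t0).
have iR := intgB (intgB (iw _ s0) (iw _ t0)) (intgZ (s - t) iD).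
have := l1normD iR (intgZ (s - t) iD).
rewrite l1normZ//; under [X in X <= _]eq_Rintegral do rewrite subrK.
by move: h; rewrite -/(L1norm _); lra.
Qed.

(** Comparison principle. If the forcing stays within [b] of [c], then [w] stays
    within [(1 - exp (- t)) b] of the solution [exp (- t) w 0 + (1 - exp (- t)) c]
    of the equation with forcing [c]. The integral of the positive part of the
    excess vanishes at time 0; since [y' = - y + (G - c)] pushes the excess back,
    its right increments are at most [o(s)], and [dini_nonincreasing] applies.
    Working with this integral turns an [L^1] equation into almost everywhere
    bounds. *)
Lemma relaxation_enclosure (w G : R -> T -> R) (c : T -> R) (b t1 : R) :
  l1_relaxation w G -> intg c -> 0 <= b -> 0 <= t1 ->
  (forall s : R, 0 <= s -> s < t1 -> {ae mu, forall x, D x -> `|G s x - c x| <= b}) ->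
  {ae mu, forall x, D x ->
    `|w t1 x - w 0 x - (1 - expR (- t1)) * (c x - w 0 x)| <= (1 - expR (- t1)) * b}.
Proof.
move=> relax ic b0 t10 Gc; have [iw iG Hw] := relax.
pose k (s : R) := 1 - expR (- s).
pose ex s x := `|w s x - w 0 x - k s * (c x - w 0 x)| - k s * b.
have iD0 : intg (fun x => c x - w 0 x) by apply: intgB => //; exact: iw.
have iex s : 0 <= s -> intg (ex s).
  move=> s0; apply: intgB; last exact: intg_cst.
  by apply/intg_norm/intgB; [apply: intgB; exact: iw|exact: intgZ].
pose phi s := \int[mu]_(x in D) Num.max 0 (ex s x).
pose A := L1norm (fun x => c x - w 0 x) + b * fine (mu D).
have A0 : 0 <= A by rewrite addr_ge0 ?l1norm_ge0// mulr_ge0// fine_ge0.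
have iA r : intg (fun x => r * (`|c x - w 0 x| + b)).
  by apply/intgZ/intgD; [exact: intg_norm|exact: intg_cst].
have intA r : \int[mu]_(x in D) (r * (`|c x - w 0 x| + b)) = r * A.
  rewrite RintegralZl//; last by apply: intgD; [exact: intg_norm|exact: intg_cst].
  rewrite RintegralD//; [|exact: intg_norm|exact: intg_cst].
  by rewrite Rintegral_cst.
suff : phi t1 <= phi 0.
  have -> : phi 0 = 0.
    rewrite /phi (@eq_Rintegral _ _ _ _ _ (cst 0)); first by rewrite Rintegral_cst// mul0r.
    by move=> x _; rewrite /ex /k oppr0 expR0 !(subrr, mul0r, subr0, normr0) maxxx.
  move=> /(int_max0_le0 (iex _ t10)); apply: filterS => x h /h.
  by rewrite subr_le0.
apply: dini_nonincreasing => // t e.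
  move=> t0 tt1 e0.
  have e20 : 0 < e / 2 by rewrite divr_gt0.
  have [r r0 Hr] := Hw t (e / 2) t0 e20.
  exists (Num.min r (Num.min 1 (e / 2 / (A + 1)))).
    by rewrite !lt_min r0 ltr01 divr_gt0// ltr_wpDl.
  move=> s s0; rewrite !lt_min => /andP[sr /andP[s1 sA]] _.
  have ts0 : 0 <= t + s by rewrite addr_ge0// ltW.
  have := Hr (t + s) ts0; rewrite addrAC subrr add0r (gtr0_norm s0) => /(_ sr) HR.
  pose Rem x := w (t + s) x - w t x - s * (G t x - w t x).
  have iRem : intg Rem.
    by apply: intgB; [apply: intgB; exact: iw|apply/intgZ/intgB; [exact: iG|exact: iw]].
  have iex0 := intg_max0 (iex _ t0).
  have : phi (t + s) <= phi t + L1norm Rem + s ^+ 2 * A.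
    rewrite /phi -intA -RintegralD//; last exact: intg_norm.
    rewrite -RintegralD//; last by apply: intgD => //; exact: intg_norm.
    apply: le_int_ae; [exact/intg_max0/iex| |].
      by apply: intgD => //; apply: intgD => //; exact: intg_norm.
    apply: filterS (Gc t t0 tt1) => x h /h {}h.
    rewrite ge_max; apply/andP; split.
      by rewrite !addr_ge0// ?le_max ?lexx// mulr_ge0 ?sqr_ge0// addr_ge0.
    (* [rho] is the second-order error of replacing [exp (- s)] by [1 - s] *)
    pose rho := k (t + s) - ((1 - s) * k t + s).
    have rhoE : `|rho| <= s ^+ 2.
      have -> : rho = - expR (- t) * (expR (- s) - (1 - s)).
        by rewrite /rho /k opprD expRD; ring.
      have /andP[h1 h2] := expRN_bounds (ltW s0) (ltW s1).
      rewrite normrM normrN (ger0_norm (expR_ge0 _)) ger0_norm ?subr_ge0//.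
      apply: (@le_trans _ _ (1 * (s ^+ 2))); last by rewrite mul1r.
      apply: ler_pM => //; rewrite ?expR_ge0 ?subr_ge0//; last by lra.
      by rewrite -[leRHS]expR0 ler_expR oppr_le0.
    have E : w (t + s) x - w 0 x - k (t + s) * (c x - w 0 x) =
       Rem x + (1 - s) * (w t x - w 0 x - k t * (c x - w 0 x))
        + s * (G t x - c x) - rho * (c x - w 0 x).
      by rewrite /Rem /rho; ring.
    rewrite /ex E.
    set y := w t x - w 0 x - k t * (c x - w 0 x).
    have s10 : 0 <= 1 - s by rewrite subr_ge0 ltW.
    have n1 : `|(1 - s) * y| = (1 - s) * `|y| by rewrite normrM (ger0_norm s10).
    have n2 : `|s * (G t x - c x)| <= s * b by rewrite normrM (gtr0_norm s0) ler_pM2l.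
    have n3 : `|rho * (c x - w 0 x)| <= s ^+ 2 * `|c x - w 0 x|.
      by rewrite normrM ler_wpM2r.
    have n4 : - (rho * b) <= s ^+ 2 * b.
      by rewrite -mulNr ler_wpM2r// (le_trans _ rhoE)// -normrN ler_norm.
    have n5 : (1 - s) * (`|y| - k t * b) <= Num.max 0 (`|y| - k t * b).
      have [h0|h0] := leP 0 (`|y| - k t * b).
        by rewrite ler_piMl// gerBl ltW.
      by rewrite nmulr_lle0.
    have -> : k (t + s) = (1 - s) * k t + s + rho by rewrite /rho; ring.
    apply: le_trans (_ : `|Rem x| + `|(1 - s) * y| + `|s * (G t x - c x)| +
       `|rho * (c x - w 0 x)| - ((1 - s) * k t + s + rho) * b <= _).
      rewrite lerD2r; apply: le_trans (ler_normB _ _) _.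
      rewrite lerD2r; apply: le_trans (ler_normD _ _) _.
      by rewrite lerD2r ler_normD.
    move: n1 n2 n3 n4 n5; move: `|Rem x| `|(1 - s) * y| `|s * (G t x - c x)|
      `|rho * (c x - w 0 x)| `|c x - w 0 x| (s ^+ 2) (Num.max _ _) => *; lra.
  move=> /le_trans; apply; rewrite -addrA lerD2l.
  move: HR; rewrite -/(L1norm Rem) => HR.
  have : s * A <= e / 2.
    apply: le_trans (_ : s * (A + 1) <= _); first by rewrite ler_wpM2l// ?ltW//; lra.
    by rewrite -ler_pdivlMr ?ltW// ltr_wpDl.
  by move=> sAe; rewrite expr2 -mulrA; nra.
move=> t0 tt1 e0.
have [r r0 Hr] := Hw t 1 (ltW t0) ltr01.
pose B := L1norm (fun x => G t x - w t x) + 1 + A.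
have B0 : 0 < B by rewrite /B addrAC ltr_wpDl// addr_ge0 ?l1norm_ge0.
exists (Num.min r (e / B)); first by rewrite lt_min r0 divr_gt0.
move=> s s0; rewrite lt_min => /andP[sr sB] st.
have ts0 : 0 <= t - s by rewrite subr_ge0.
have := Hr (t - s) ts0; rewrite addrAC subrr add0r normrN (gtr0_norm s0) => /(_ sr) HR.
have := @l1_relaxation_increment w G t (t - s) 1 relax (ltW t0) ts0.
rewrite addrAC subrr add0r normrN (gtr0_norm s0) => /(_ HR) {}HR.
have iI : intg (fun x => w (t - s) x - w t x) by apply: intgB; apply: iw => //; exact: ltW.
have iex0 := intg_max0 (iex _ ts0).
have : phi t <= phi (t - s) + L1norm (fun x => w (t - s) x - w t x) + s * A.
  rewrite /phi -intA -RintegralD//; last exact: intg_norm.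
  rewrite -RintegralD//; last by apply: intgD => //; exact: intg_norm.
  apply: le_int_ae; [exact/intg_max0/iex/ltW| |].
    by apply: intgD => //; apply: intgD => //; exact: intg_norm.
  apply/aeW => x _.
  rewrite ge_max; apply/andP; split.
    by rewrite !addr_ge0// ?le_max ?lexx// mulr_ge0 ?(ltW s0)// addr_ge0.
  pose dk := k t - k (t - s).
  have dkE : `|dk| <= s.
    have -> : dk = expR (- (t - s)) * (1 - expR (- s)).
      by rewrite mulrBr mulr1 -expRD -opprD subrK /dk /k; ring.
    rewrite normrM (ger0_norm (expR_ge0 _)) ger0_norm; last first.
      by rewrite subr_ge0 -[leRHS]expR0 ler_expR oppr_le0 ltW.
    rewrite -[leRHS]mul1r; apply: ler_pM; rewrite ?expR_ge0//.
    - by rewrite subr_ge0 -[leRHS]expR0 ler_expR oppr_le0 ltW.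
    - by rewrite -[leRHS]expR0 ler_expR oppr_le0.
    - by rewrite lerBlDr -lerBlDl expR_ge1Dx.
  rewrite /ex.
  have E : w t x - w 0 x - k t * (c x - w 0 x) =
     (w (t - s) x - w 0 x - k (t - s) * (c x - w 0 x)) - (w (t - s) x - w t x)
      - dk * (c x - w 0 x).
    by rewrite /dk; ring.
  rewrite E; set y := w (t - s) x - w 0 x - _.
  have n3 : `|dk * (c x - w 0 x)| <= s * `|c x - w 0 x| by rewrite normrM ler_wpM2r.
  have n4 : - (dk * b) <= s * b.
    by rewrite -mulNr ler_wpM2r// (le_trans _ dkE)// -normrN ler_norm.
  have n5 : `|y| - k (t - s) * b <= Num.max 0 (`|y| - k (t - s) * b) by rewrite le_max lexx orbT.
  have -> : k t = k (t - s) + dk by rewrite /dk; ring.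
  apply: le_trans (_ : `|y| + `|w (t - s) x - w t x| +
       `|dk * (c x - w 0 x)| - (k (t - s) + dk) * b <= _).
    rewrite lerD2r; apply: le_trans (ler_normB _ _) _.
    by rewrite lerD2r ler_normB.
  move: n3 n4 n5; move: `|y| `|w (t - s) x - w t x|
    `|dk * (c x - w 0 x)| `|c x - w 0 x| (Num.max _ _) => *; lra.
move=> /le_trans; apply; rewrite -addrA lerD2l.
apply: le_trans (_ : B * s <= e).
  by move: HR; rewrite /B -/(L1norm _); lra.
by rewrite mulrC -ler_pdivlMr// ltW.
Qed.

End finite_L1.

(** * Comparison of two relaxations *)

Section relaxation.
Context d (T : measurableType d) (R : realType).
Variables (mu : {measure set T -> \bar R}) (D : set T).
Hypotheses (mD : measurable D) (fD : (mu D < +oo)%E).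

Local Notation intg phi := (mu.-integrable D (EFin \o phi)).
Local Notation l1norm := (L1norm mu D).
Local Notation l1_relaxation := (l1_relaxation mu D).

Lemma le_l1norm_triangle (phi psi : T -> R) : intg phi -> intg psi ->
  l1norm phi <= l1norm (fun x => phi x - psi x) + l1norm psi.
Proof.
move=> i1 i2; apply: le_trans (l1normD mD (intgB mD i1 i2) i2).
by rewrite (_ : (fun x => phi x - psi x + psi x) = phi)//; apply/funext => x; rewrite subrK.
Qed.

Lemma eq_l1norm (phi psi : T -> R) : phi =1 psi -> l1norm phi = l1norm psi.
Proof. by move=> /funext ->. Qed.

Lemma l1normBC (phi psi : T -> R) :
  l1norm (fun x => phi x - psi x) = l1norm (fun x => psi x - phi x).
Proof. by apply: eq_Rintegral => x _; rewrite distrC. Qed.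

Lemma l1_relaxation_shift w G (t0 : R) : 0 <= t0 -> l1_relaxation w G ->
  l1_relaxation (fun t => w (t0 + t)) (fun t => G (t0 + t)).
Proof.
move=> t00 [iw iG Hw]; split => [t t_ge0|t t_ge0|t e t_ge0 e0].
- by apply: iw; rewrite addr_ge0.
- by apply: iG; rewrite addr_ge0.
have [r r0 Hr] := Hw (t0 + t) e (addr_ge0 t00 t_ge0) e0.
exists r => // s s0 st.
have E : t0 + s - (t0 + t) = s - t by ring.
by have := Hr (t0 + s) (addr_ge0 t00 s0); rewrite E; exact.
Qed.

Lemma l1_relaxationB w G w' G' : l1_relaxation w G -> l1_relaxation w' G' ->
  l1_relaxation (fun t x => w t x - w' t x) (fun t x => G t x - G' t x).
Proof.
move=> [iw iG Hw] [iw' iG' Hw']; split => [t t0|t t0|t e t0 e0].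
- by apply: intgB => //; [exact: iw|exact: iw'].
- by apply: intgB => //; [exact: iG|exact: iG'].
have e20 : 0 < e / 2 by rewrite divr_gt0.
have [r r0 Hr] := Hw t (e / 2) t0 e20.
have [r' r'0 Hr'] := Hw' t (e / 2) t0 e20.
exists (Num.min r r'); first by rewrite lt_min r0 r'0.
move=> s s0; rewrite lt_min => /andP[sr sr'].
have i1 : intg (fun x => w s x - w t x - (s - t) * (G t x - w t x)).
  by apply: intgB => //; [|apply: intgZ => //]; apply: intgB => //; [exact: iw|exact: iw|exact: iG|exact: iw].
have i2 : intg (fun x => w' s x - w' t x - (s - t) * (G' t x - w' t x)).
  by apply: intgB => //; [|apply: intgZ => //]; apply: intgB => //; [exact: iw'|exact: iw'|exact: iG'|exact: iw'].
have i2N : intg (fun x => (-1) * (w' s x - w' t x - (s - t) * (G' t x - w' t x))).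
  exact: intgZ.
have := l1normD mD i1 i2N; rewrite l1normZ// normrN1 mul1r => h.
rewrite (@eq_l1norm _ (fun x => w s x - w t x - (s - t) * (G t x - w t x) +
    (-1) * (w' s x - w' t x - (s - t) * (G' t x - w' t x)))); last by move=> x; ring.
apply: le_trans h _.
have := lerD (Hr s s0 sr) (Hr' s s0 sr'); rewrite -mulrDl -splitr; exact: le_trans.
Qed.

(** The relaxation term [- w] contracts the norm, so that the function
    [exp (- L t) * l1norm (w t)] has nonpositive right increments up to [o(s)]. *)
Lemma relaxation_gronwall w G (L t1 : R) : l1_relaxation w G -> 0 <= L -> 0 <= t1 ->
  (forall t : R, 0 <= t -> t < t1 -> l1norm (G t) <= L * l1norm (w t)) ->
  l1norm (w t1) <= expR (L * t1) * l1norm (w 0).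
Proof.
move=> relax L0 t10 HG; have [iw iG Hw] := relax.
pose phi t := expR (- (L * t)) * l1norm (w t).
suff : phi t1 <= phi 0.
  rewrite /phi mulr0 oppr0 expR0 mul1r expRN mulrC ler_pdivrMr ?expR_gt0//.
  by rewrite mulrC.
have el1 (s : R) : 0 <= s -> expR (- (L * s)) <= 1.
  by move=> s0; rewrite -[leRHS]expR0 ler_expR oppr_le0 mulr_ge0.
apply: dini_nonincreasing => // t e t0 tt1 e0.
  have [r r0 Hr] := Hw t e t0 e0.
  exists (Num.min r 1); first by rewrite lt_min r0 ltr01.
  move=> s s0; rewrite lt_min => /andP[sr s1] _.
  have ts0 : 0 <= t + s by rewrite addr_ge0// ltW.
  have := Hr (t + s) ts0; rewrite addrAC subrr add0r (gtr0_norm s0) => /(_ sr) HR.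
  have iR : intg (fun x => w (t + s) x - w t x - s * (G t x - w t x)).
    by apply: intgB => //; [|apply: intgZ => //]; apply: intgB => //; [exact: iw|exact: iw|exact: iG|exact: iw].
  have i1 : intg (fun x => (1 - s) * w t x) by apply: intgZ => //; exact: iw.
  have i2 : intg (fun x => s * G t x) by apply: intgZ => //; exact: iG.
  have : l1norm (w (t + s)) <= e * s + ((1 - s) * l1norm (w t) + s * l1norm (G t)).
    have := l1normD mD iR (intgD mD i1 i2); have := l1normD mD i1 i2.
    rewrite !l1normZ//; [|exact: iG|exact: iw].
    have s10 : 0 <= 1 - s by rewrite subr_ge0 ltW.
    rewrite (gtr0_norm s0) (ger0_norm s10) => h1 h2.
    rewrite (@eq_l1norm (w (t + s)) (fun x => w (t + s) x - w t x - s * (G t x - w t x) +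
        ((1 - s) * w t x + s * G t x))); last by move=> x; ring.
    by apply: le_trans h2 _; apply: lerD.
  move=> h; have h' : l1norm (w (t + s)) <= (1 + L * s) * l1norm (w t) + e * s.
    have := ler_wpM2l (ltW s0) (HG t t0 tt1).
    have : 0 <= s * l1norm (w t) by rewrite mulr_ge0 ?l1norm_ge0// ltW.
    by move: h; nra.
  rewrite /phi mulrDr opprD expRD -mulrA.
  have := ler_wpM2l (expR_ge0 (- (L * s))) h'.
  move=> /(ler_wpM2l (expR_ge0 (- (L * t)))) /le_trans; apply.
  rewrite !mulrDr; apply: lerD.
    apply: ler_wpM2l; first exact: expR_ge0.
    rewrite mulrA ler_piMl ?l1norm_ge0// expRN mulrC ler_pdivrMr ?expR_gt0//.
    by rewrite mul1r expR_ge1Dx.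
  have es0 : 0 <= e * s by rewrite mulr_ge0 ?(ltW e0) ?(ltW s0).
  by rewrite mulrA ler_piMl// mulr_ile1 ?expR_ge0 ?el1// ltW.
have t_ge0 := ltW t0.
have [r r0 Hr] := Hw t 1 t_ge0 ltr01.
pose B := l1norm (fun x => G t x - w t x) + 1.
have B0 : 0 < B by rewrite ltr_wpDl// l1norm_ge0.
exists (Num.min r (e / B)); first by rewrite lt_min r0 divr_gt0.
move=> s s0; rewrite lt_min => /andP[sr sB] st.
have ts0 : 0 <= t - s by rewrite subr_ge0.
have := Hr (t - s) ts0; rewrite addrAC subrr add0r normrN (gtr0_norm s0) => /(_ sr) HR.
have := @l1_relaxation_increment _ _ _ _ _ mD w G t (t - s) 1 relax t_ge0 ts0.
rewrite addrAC subrr add0r normrN (gtr0_norm s0) => /(_ HR) {}HR.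
have h : l1norm (w t) <= e + l1norm (w (t - s)).
  apply: le_trans (le_l1norm_triangle (iw _ t_ge0) (iw _ ts0)) _.
  rewrite lerD2r l1normBC; apply: le_trans HR _.
  by rewrite mulrC -ler_pdivlMr// ltW.
rewrite /phi; apply: (@le_trans _ _ (expR (- (L * (t - s))) * l1norm (w t))).
  rewrite ler_wpM2r ?l1norm_ge0// ler_expR lerN2 ler_wpM2l// gerBl.
  exact: ltW.
apply: (@le_trans _ _ (expR (- (L * (t - s))) * (e + l1norm (w (t - s))))).
  by rewrite ler_wpM2l ?expR_ge0.
by rewrite mulrDr addrC lerD2l ler_piMl ?(ltW e0)//; exact: el1.
Qed.

End relaxation.

(** * Nonnegative functions with small integrals *)

Section vanishing_integrals.
Context d (T : measurableType d) (R : realType).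
Variables (mu : {measure set T -> \bar R}) (D : set T).
Hypothesis mD : measurable D.

Local Notation intg phi := (mu.-integrable D (EFin \o phi)).

(** Fatou's lemma in contrapositive form: the infimum of the tail of [phi] has
    integral zero because the integrals are small along the tail, so almost
    nowhere can the tail be bounded below by a positive number. *)
Lemma int_vanishing_inf (phi : nat -> T -> R) :
  (forall n, intg (phi n)) -> (forall n x, 0 <= phi n x) ->
  (forall (e : R) m, 0 < e -> exists2 n, (m <= n)%N & \int[mu]_(x in D) phi n x <= e) ->
  {ae mu, forall x, D x -> forall (c : R) m, 0 < c ->
     (forall n, (m <= n)%N -> c <= phi n x) -> False}.
Proof.
move=> iphi phi0 small.
pose g m x := einfs (fun n => (phi n x)%:E) m.
have mphi n : measurable_fun D (EFin \o phi n) by exact: (measurable_int mu).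
have mg m : measurable_fun D (g m).
  exact: (@measurable_fun_einfs _ _ _ D (fun n => EFin \o phi n)).
have g0 m x : (0 <= g m x)%E.
  by apply: le_ereal_inf_tmp => _ [n _ <-]; rewrite lee_fin.
have gE m : {ae mu, forall x, D x -> g m x = 0%E}.
  have : (\int[mu]_(x in D) `|g m x| = 0)%E.
    apply/eqP; rewrite eq_le integral_ge0// andbT.
    apply/lee_addgt0Pr => e e0; rewrite add0e.
    have [n mn le] := small e m e0.
    apply: (@le_trans _ _ (\int[mu]_(x in D) (phi n x)%:E)%E).
      apply: ge0_le_integral => //.
      - exact: measurableT_comp.
      - exact: mphi.
      - move=> x _; rewrite gee0_abs//; apply: ereal_inf_lbound.
        by exists n.
    have fin : (\int[mu]_(x in D) (phi n x)%:E)%E \is a fin_num.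
      exact: (integrable_fin_num mD (iphi n)).
    by rewrite -(fineK fin) lee_fin.
  by move=> /(ae_eq_integral_abs mu mD (mg m)).
have : {ae mu, forall x, forall m, D x -> g m x = 0%E}.
  exact: ae_foralln.
apply: filterS => x gx Dx c m c0 le.
have : (c%:E <= g m x)%E.
  by apply: le_ereal_inf_tmp => _ [n /= mn <-]; rewrite lee_fin; exact: le.
by rewrite gx// lee_fin leNgt c0.
Qed.

End vanishing_integrals.

(** * L^p norms and sets of finite measure *)

Section Lp_finite_support.
Context d (T : measurableType d) (R : realType).
Variables (mu : {measure set T -> \bar R}) (D : set T).
Hypotheses (mD : measurable D) (fD : (mu D < +oo)%E).
Variables (p : \bar R) (p1 : (1 <= p)%E).
Implicit Types phi psi : T -> R.

Local Notation intg phi := (mu.-integrable D (EFin \o phi)).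
Local Notation l1norm := (L1norm mu D).

Lemma le_Lnorm phi psi : measurable_fun setT phi -> measurable_fun setT psi ->
  {ae mu, forall x, `|phi x| <= `|psi x|} ->
  ('N[mu]_p[EFin \o phi] <= 'N[mu]_p[EFin \o psi])%E.
Proof.
move=> mphi mpsi le; rewrite unlock /Lnorm; case: p p1 => [r r1| _|//].
  rewrite lee_fin in r1; have r0 : 0 < r by exact: lt_le_trans r1.
  apply: gt0_ler_poweR.
  - by rewrite invr_ge0 ltW.
  - by rewrite in_itv/= leey andbT integral_ge0// => x _; rewrite poweR_ge0.
  - by rewrite in_itv/= leey andbT integral_ge0// => x _; rewrite poweR_ge0.
  apply: ae_ge0_le_integral => //.
  - by move=> x _; rewrite poweR_ge0.
  - apply: (measurableT_comp (measurable_poweR _)).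
    by apply: measurableT_comp => //; exact/measurable_EFinP.
  - by move=> x _; rewrite poweR_ge0.
  - apply: (measurableT_comp (measurable_poweR _)).
    by apply: measurableT_comp => //; exact/measurable_EFinP.
  - apply: filterS le => x h _; rewrite /= lee_fin.
    by rewrite ge0_ler_powR// ?nnegrE// ltW.
case: ifPn => // _; apply: le_ess_sup.
by apply: filterS le => x h; rewrite /= lee_fin.
Qed.

Lemma Lnorm_indic_lty : ('N[mu]_p[EFin \o \1_D] < +oo)%E.
Proof.
rewrite unlock /Lnorm; case: p p1 => [r r1| _|//].
  rewrite lee_fin in r1; have r0 : 0 < r by exact: lt_le_trans r1.
  rewrite poweR_lty//; under eq_integral => x _.
    rewrite (_ : _ `^ r = (\1_D x)%:E)%E; first over.
    rewrite /= indicE; case: (x \in D) => /=; rewrite ?normr1 ?powR1//.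
    by rewrite normr0 powR0// gt_eqF.
  by rewrite integral_indic// setIT.
case: ifPn => // _; apply: (@le_lt_trans _ _ 1%E); last exact: ltry.
apply/ess_supP/aeW => x /=; rewrite lee_fin indicE.
by case: (x \in D); rewrite ?normr1 ?normr0.
Qed.

Lemma Lnorm_le_bound : exists2 C : R, 0 <= C & forall phi (M : R), measurable_fun setT phi ->
  0 <= M -> {ae mu, forall x, `|phi x| <= M * \1_D x} ->
  ('N[mu]_p[EFin \o phi] <= (C * M)%:E)%E.
Proof.
have mI : measurable_fun setT (\1_D : T -> R) by exact: measurable_indic.
have iL : (\1_D : T -> R) \in Lfun mu p.
  by rewrite inE; apply/andP; split; rewrite inE//=; exact: Lnorm_indic_lty.
exists (fine 'N[mu]_p[EFin \o \1_D]%E); first by rewrite fine_ge0// Lnorm_ge0.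
move=> phi M mphi M0 le.
apply: (@le_trans _ _ 'N[mu]_p[EFin \o (fun x => M * \1_D x)%R]%E).
  apply: le_Lnorm => //; first exact: measurable_funM.
  by apply: filterS le => x h; rewrite [leRHS]ger0_norm// mulr_ge0.
have := LnormZ (Lfun_Sub p1 iL) M => /= E.
rewrite (_ : EFin \o _ = EFin \o (M \*: (\1_D : T -> R)))//.
rewrite E ger0_norm// EFinM muleC fineK// ge0_fin_numE ?Lnorm_ge0//.
exact: Lnorm_indic_lty.
Qed.

Let N1_indic phi : (\int[mu]_(x in D) `|phi x|%:E = 'N[mu]_1[EFin \o (phi \* \1_D)%R])%E.
Proof.
rewrite Lnorm1 integral_mkcond; apply: eq_integral => x _ /=.
by rewrite patchE indicE; case: (x \in D); rewrite ?mulr1// mulr0 normr0.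
Qed.

(** Hoelder's inequality against the indicator of [D], whose conjugate norm is
    finite; the exponents 1 and [+oo] are treated apart. *)
Lemma l1norm_le_Lnorm : exists2 C : R, 0 <= C & forall phi, measurable_fun setT phi ->
  ('N[mu]_p[EFin \o phi] < +oo)%E ->
  intg phi /\ l1norm phi <= C * fine 'N[mu]_p[EFin \o phi]%E.
Proof.
suff [C C0 HC] : exists2 C : R, 0 <= C & forall phi, measurable_fun setT phi ->
    ('N[mu]_p[EFin \o phi] < +oo)%E ->
    (\int[mu]_(x in D) `|phi x|%:E <= C%:E * 'N[mu]_p[EFin \o phi])%E.
  exists C => // phi mphi fphi; have H := HC phi mphi fphi.
  have fin : 'N[mu]_p[EFin \o phi]%E \is a fin_num.
    by rewrite ge0_fin_numE ?Lnorm_ge0.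
  have Hf : (\int[mu]_(x in D) `|phi x|%:E < +oo)%E.
    by apply: le_lt_trans H _; rewrite lte_mul_pinfty.
  split.
    apply/integrableP; split => //.
    by apply/measurable_EFinP; exact: measurable_funTS.
  rewrite -lee_fin EFinM (fineK fin) /L1norm /Rintegral fineK//.
  by rewrite ge0_fin_numE// integral_ge0.
have mI : measurable_fun setT (\1_D : T -> R) by exact: measurable_indic.
have [C C0 HC] := Lnorm_le_bound.
case: p p1 HC => [r r1 _| _ _|//].
  rewrite lee_fin le_eqVlt in r1; case/predU1P: r1 => [<-|r1].
    exists 1 => // phi mphi _; rewrite mul1e Lnorm1 ge0_subset_integral//.
    by do 2 apply: measurableT_comp => //.
  pose q := (1 - r^-1)^-1.
  have r0 : 0 < r by exact: lt_trans r1.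
  have q0 : 0 < q by rewrite invr_gt0 subr_gt0 invf_lt1.
  have rq : r^-1 + q^-1 = 1 by rewrite /q invrK addrC subrK.
  have fI : ('N[mu]_q%:E[EFin \o \1_D] < +oo)%E.
    rewrite unlock /Lnorm poweR_lty//; under eq_integral => x _.
      rewrite (_ : _ `^ q = (\1_D x)%:E)%E; first over.
      rewrite /= indicE; case: (x \in D) => /=; rewrite ?normr1 ?powR1//.
      by rewrite normr0 powR0// gt_eqF.
    by rewrite integral_indic// setIT.
  exists (fine 'N[mu]_q%:E[EFin \o \1_D])%E; first by rewrite fine_ge0// Lnorm_ge0.
  move=> phi mphi fphi; rewrite N1_indic fineK ?ge0_fin_numE ?Lnorm_ge0// muleC.
  exact: hoelder.
exists (fine (mu D)); first by rewrite fine_ge0.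
move=> phi mphi fphi; rewrite fineK ?ge0_fin_numE//.
have [mu0|mu0] := eqVneq (mu setT) 0%E.
  have muD0 : mu D = 0%E.
    apply/eqP; rewrite eq_le measure_ge0 andbT -mu0.
    by apply: le_measure => //; rewrite inE.
  rewrite muD0 mul0e le_eqVlt; apply/orP; left; apply/eqP.
  apply: (@integral_abs_eq0 _ _ _ _ _ (EFin \o phi)) => //.
  by apply/measurable_EFinP; exact: measurable_funTS.
have muT : (0 < mu setT)%E by rewrite lt_neqAle eq_sym mu0 measure_ge0.
have fin : 'N[mu]_+oo[EFin \o phi]%E \is a fin_num.
  by rewrite ge0_fin_numE ?Lnorm_ge0.
rewrite muleC -[X in (X * _)%E]fineK// -integral_cst//.
apply: ae_ge0_le_integral => //.
- by apply/measurable_EFinP/measurableT_comp => //; exact: measurable_funTS.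
- by move=> x _; rewrite lee_fin fine_ge0// Lnorm_ge0.
have := ess_sup_ge mu (abse \o (EFin \o phi)).
apply: filterS => x h _; rewrite fineK//.
by rewrite unlock /Lnorm muT.
Qed.

End Lp_finite_support.

Section Lspace_of_function.
Context d (T : measurableType d) (R : realType).
Variables (mu : {measure set T -> \bar R}) (p : \bar R) (p1 : (1 <= p)%E).

(** Elements of the space are equivalence classes: a class is built from a
    function by passing to the quotient, and the representative that comes back
    agrees with the function almost everywhere only. *)
Lemma Lspace_representative (phi : T -> R) :
  measurable_fun setT (phi : T -> measurableTypeR R) ->
  ('N[mu]_p[EFin \o phi] < +oo)%E ->
  exists u : LspaceType mu p1, (u : T -> R) = phi %[ae mu].
Proof.
move=> mphi fphi.
pose mf := isMeasurableFun.Build d _ T (measurableTypeR R) phi mphi.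
pose f : {mfun T >-> measurableTypeR R} := HB.pack phi mf.
pose c : {mfun_ mu, T >-> measurableTypeR R} := (\pi f)%qT.
have cf : (c : T -> R) = phi %[ae mu].
  have /eqquotP/asboolP : repr c = f %[mod_eq @ae_eq_op _ _ R T (measurableTypeR R) mu]%qT.
    by rewrite reprK.
  by [].
have cfin : finite_norm mu p (c : T -> R).
  apply: le_lt_trans fphi; apply: le_Lnorm => //.
    exact: (measurable_funPT (repr c)).
  by apply: filterS cf => x h; rewrite (h I).
pose m := isFinLebesgue.Build d T R mu p p1 c cfin.
pose u : LspaceType mu p1 := HB.pack c m.
by exists u.
Qed.

(** When the whole space is null the norm is zero by convention, and both
    sides hold. *)
Lemma Lnorm_infty_leP (phi : T -> R) (r : R) : 0 <= r ->
  ('N[mu]_(+oo)[EFin \o phi] <= r%:E)%E <-> {ae mu, forall x, `|phi x| <= r}.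
Proof.
move=> r0; rewrite unlock /Lnorm; have [mu0|mu0] := ltP 0%E (mu setT).
  split=> [/ess_supP|h]; first by apply: filterS => x; rewrite /= lee_fin.
  by apply/ess_supP; apply: filterS h => x; rewrite /= lee_fin.
split => // _; have {}mu0 : mu setT = 0%E.
  by apply/eqP; rewrite eq_le mu0 measure_ge0.
by exists setT; split.
Qed.

End Lspace_of_function.

(** * The integral operator on the domain *)

Section kernel_operator.
Context {R : realType} {N : nat}.
Local Notation mu := (@lebesgue_rV R N).
Variables (Omega : set 'rV[R]_N) (J : 'rV[R]_N -> 'rV[R]_N -> R).
Hypotheses (mO : measurable Omega) (bO : bounded_set Omega).
Hypotheses (cJ : continuous (fun z : 'rV[R]_N * 'rV[R]_N => J z.1 z.2))
  (J_ge0 : forall x y, 0 <= J x y)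
  (J_sym : forall x y, J x y = J y x)
  (J_int1 : forall x, (\int[mu]_y (J x y)%:E = 1)%E).
Implicit Types (v w phi : 'rV[R]_N -> R).

Local Notation intg phi := (mu.-integrable Omega (EFin \o phi)).
Local Notation l1norm := (L1norm mu Omega).

Definition KO v x := \int[mu]_(y in Omega) (J x y * v y).

Let fO : (mu Omega < +oo)%E.
Proof. exact: bounded_rV_lty. Qed.

Let cJx x : continuous (J x).
Proof.
move=> y; apply: (@continuous_comp _ _ _ (fun y => (x, y))
  (fun z : 'rV[R]_N * 'rV[R]_N => J z.1 z.2)); last exact: cJ.
move=> A [[B C] /= [Bx Cy] BC]; apply: filterS Cy => y' Cy'.
by apply: BC; split => //; exact: nbhs_singleton.
Qed.

Lemma measurable_kernel x : measurable_fun setT (J x).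
Proof. exact: continuous_measurable_rV. Qed.

Lemma kernel_bounded : exists2 C : R, 0 < C & forall x y, Omega x -> Omega y -> J x y <= C.
Proof.
have [Q cQ OQ] := bounded_subset_compact bO.
have [C C0 HC] := compact_prod_bounded (compact_setX cQ cQ) cJ.
exists C => // x y Ox Oy; apply: le_trans (ler_norm _) _.
by apply: (HC (x, y)); split; exact: OQ.
Qed.

Lemma kernel_bounded_at x : exists2 C : R, 0 < C & forall y, Omega y -> `|J x y| <= C.
Proof.
have [Q cQ OQ] := bounded_subset_compact bO.
have [C C0 HC] := compact_prod_bounded cQ (@cJx x).
by exists C => // y Oy; apply: HC; exact: OQ.
Qed.

Lemma kernel_equicontinuous x (e : R) : 0 < e ->
  \forall x' \near x, forall y, Omega y -> `|J x y - J x' y| <= e.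
Proof.
move=> e0; have [Q cQ OQ] := bounded_subset_compact bO.
have := compact_equicontinuous_at cQ cJ x e0.
by apply: filterS => x' h y /OQ /h.
Qed.

Lemma intg_kernelM x v : intg v -> intg (fun y => J x y * v y).
Proof.
move=> iv; have [C C0 HC] := kernel_bounded_at x.
apply: (intg_le_ae mO _ (intg_norm (intgZ mO C iv))).
  apply: measurable_funM; last exact: (intg_measurable iv).
  by apply: measurable_funTS; exact: measurable_kernel.
apply/aeW => y Oy; rewrite !normrM ger0_norm//.
by rewrite ler_wpM2r// -(ger0_norm (J_ge0 _ _)) (le_trans (HC _ Oy))// ler_norm.
Qed.

Lemma KO_le_int v x psi : intg v -> intg psi ->
  {ae mu, forall y, Omega y -> `|J x y * v y| <= psi y} ->
  `|KO v x| <= \int[mu]_(y in Omega) psi y.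
Proof.
move=> iv ipsi le; apply: le_trans (normr_int_le mO (intg_kernelM x iv)) _.
by apply: le_l1norm => //; exact: intg_kernelM.
Qed.

Lemma KOB v w x : intg v -> intg w -> KO (fun y => v y - w y) x = KO v x - KO w x.
Proof.
move=> iv iw; rewrite /KO -RintegralB//; [|exact: intg_kernelM..].
by apply: eq_Rintegral => y _; rewrite mulrBr.
Qed.

Lemma int_kernel_le1 x : \int[mu]_(y in Omega) J x y <= 1.
Proof.
have mJ := measurable_kernel x.
have : (\int[mu]_(y in Omega) (J x y)%:E <= 1)%E.
  rewrite -(J_int1 x); apply: ge0_subset_integral => //.
  - exact/measurable_EFinP.
  - by move=> y _; rewrite lee_fin.
move=> h; rewrite -lee_fin /Rintegral fineK// ge0_fin_numE.
  exact: le_lt_trans h (ltry _).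
by apply: integral_ge0 => y _; rewrite lee_fin.
Qed.

Lemma intg_kernel x : intg (J x).
Proof.
have [C C0 HC] := kernel_bounded_at x.
apply: (@intg_bounded _ _ _ _ _ mO fO _ C); last exact/aeW.
by apply: measurable_funTS; exact: measurable_kernel.
Qed.

Lemma KO_le_sup v (M : R) x : intg v -> 0 <= M ->
  {ae mu, forall y, Omega y -> `|v y| <= M} -> `|KO v x| <= M.
Proof.
move=> iv M0 vM.
apply: (@le_trans _ _ (\int[mu]_(y in Omega) (M * J x y))).
  apply: KO_le_int => //; first by apply: intgZ => //; exact: intg_kernel.
  apply: filterS vM => y h /h {}h.
  by rewrite normrM ger0_norm// mulrC ler_wpM2r.
rewrite RintegralZl//; last exact: intg_kernel.
by rewrite ler_piMr// int_kernel_le1.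
Qed.

Lemma KO_le_l1norm C v x : (forall x y, Omega x -> Omega y -> J x y <= C) ->
  intg v -> Omega x -> `|KO v x| <= C * l1norm v.
Proof.
move=> HC iv Ox; rewrite /L1norm -RintegralZl//; last exact: intg_norm.
apply: KO_le_int => //; first by apply: intgZ => //; exact: intg_norm.
by apply/aeW => y Oy; rewrite normrM ger0_norm// ler_wpM2r// HC.
Qed.

Lemma KO_modulus v x x' (e : R) : intg v ->
  (forall y, Omega y -> `|J x y - J x' y| <= e) ->
  `|KO v x - KO v x'| <= e * l1norm v.
Proof.
move=> iv Je; rewrite /KO -RintegralB//; [|exact: intg_kernelM..].
have iB : intg (fun y => J x y * v y - J x' y * v y).
  by apply: intgB => //; exact: intg_kernelM.
apply: le_trans (normr_int_le mO iB) _.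
rewrite /L1norm -RintegralZl//; last exact: intg_norm.
apply: le_l1norm => //; first by apply: intgZ => //; exact: intg_norm.
by apply/aeW => y Oy; rewrite -mulrBl normrM ler_wpM2r// Je.
Qed.

Lemma KO_continuous v : intg v -> continuous (KO v).
Proof.
move=> iv x; apply/(@cvgrPdist_le _ _ _ (nbhs x)) => e e0.
have l0 : 0 < l1norm v + 1 by rewrite ltr_wpDl// l1norm_ge0.
have d0 : 0 < e / (l1norm v + 1) by rewrite divr_gt0.
apply: (@filterS _ (nbhs x) (nbhs_filter x) _ _ _ (kernel_equicontinuous x d0)) => x' h.
apply: le_trans (KO_modulus iv h) _.
by rewrite mulrAC ler_pdivrMr// ler_wpM2l ?(ltW e0)// lerDl.
Qed.

Lemma measurable_KO v : intg v -> measurable_fun setT (KO v).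
Proof. by move=> /KO_continuous/continuous_measurable_rV. Qed.

Let int_kernel_restrict a v x : intg v ->
  (\int[mu]_y (a * (J x y * (v \_ Omega) y))%:E = (a * KO v x)%:E)%E.
Proof.
move=> iv; have iJv := intg_kernelM x iv.
have JvE : (fun y => (J x y * (v \_ Omega) y)%:E) =
    ((EFin \o (fun y => J x y * v y)) \_ Omega).
  by apply/funext => y; rewrite !patchE; case: ifP; rewrite ?mulr0.
under eq_integral do rewrite EFinM.
rewrite integralZl//; last by rewrite JvE; apply/(integrable_mkcond _ mO).
rewrite JvE -integral_mkcond EFinM /KO /Rintegral fineK//.
exact: integrable_fin_num.
Qed.

(** Fubini's theorem for the bounded functions [v] and [w] extended by zero; the
    symmetry of [J] exchanges the two iterated integrals. *)
Lemma KO_sym v w (Mv Mw : R) : measurable_fun setT v -> measurable_fun setT w ->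
  (forall x, Omega x -> `|v x| <= Mv) -> (forall x, Omega x -> `|w x| <= Mw) ->
  \int[mu]_(x in Omega) (w x * KO v x) = \int[mu]_(x in Omega) (v x * KO w x).
Proof.
move=> mv mw vM wM.
have iv : intg v by apply: (@intg_bounded _ _ _ _ _ mO fO _ Mv); [exact: measurable_funTS|exact/aeW].
have iw : intg w by apply: (@intg_bounded _ _ _ _ _ mO fO _ Mw); [exact: measurable_funTS|exact/aeW].
have mvO : measurable_fun setT (v \_ Omega).
  by apply/(measurable_restrictT _ mO); exact: measurable_funTS.
have mwO : measurable_fun setT (w \_ Omega).
  by apply/(measurable_restrictT _ mO); exact: measurable_funTS.
pose H (z : 'rV[R]_N * 'rV[R]_N) :=
  (w \_ Omega) z.1 * (J z.1 z.2 * (v \_ Omega) z.2).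
have mH : measurable_fun setT H.
  apply: measurable_funM; first exact: (measurableT_comp mwO measurable_fst).
  apply: measurable_funM; last exact: (measurableT_comp mvO measurable_snd).
  exact: continuous_measurable_rV2.
have [C C0 HC] := kernel_bounded.
have iH : (mu \x mu)%E.-integrable setT (EFin \o H).
  apply/integrableP; split; first exact/measurable_EFinP.
  apply: (@le_lt_trans _ _
    (\int[(mu \x mu)%E]_z ((`|Mw| * (C * `|Mv|)) * \1_(Omega `*` Omega) z)%:E)%E).
    apply: ge0_le_integral => //.
    - by apply/measurable_EFinP; exact: measurableT_comp.
    - apply/measurable_EFinP; apply: measurable_funM => //.
      by apply: measurable_indic; exact: measurableX.
    move=> -[x y] _ /=; rewrite lee_fin /H !patchE indicE/= in_setX.
    case: (boolP (x \in Omega)) => [/set_mem xO|]; last by rewrite /= mul0r normr0 mulr0.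
    case: (boolP (y \in Omega)) => [/set_mem yO|]; last by rewrite /= !mulr0 normr0.
    rewrite /= mulr1 !normrM (ger0_norm (J_ge0 _ _)).
    rewrite !ler_pM ?mulr_ge0 ?HC//.
      by rewrite (le_trans (wM _ xO))// ler_norm.
    by rewrite (le_trans (vM _ yO))// ler_norm.
  under eq_integral do rewrite EFinM.
  rewrite ge0_integralZl_EFin//.
  - rewrite integral_indic ?setIT//; last exact: measurableX.
    have E : (mu \x mu)%E (Omega `*` Omega) = (mu Omega * mu Omega)%E.
      exact: product_measure1E.
    apply: lte_mul_pinfty => //; rewrite ?lee_fin ?mulr_ge0// ?ltW//.
    apply: (@le_lt_trans _ _ (mu Omega * mu Omega)%E); first by rewrite -E.
    by rewrite lte_mul_pinfty// ge0_fin_numE.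
  - apply/measurable_EFinP; apply: measurable_indic; exact: measurableX.
  - by rewrite !mulr_ge0// ltW.
have FH := Fubini iH; rewrite Rintegral_mkcond [in RHS]Rintegral_mkcond.
congr fine; transitivity (\int[mu]_x \int[mu]_y (EFin \o H) (x, y))%E.
  apply: eq_integral => x _; transitivity ((w \_ Omega) x * KO v x)%:E.
    by rewrite !patchE; case: ifP; rewrite ?mul0r.
  by rewrite -int_kernel_restrict.
rewrite FH; apply: eq_integral => y _.
transitivity (((v \_ Omega) y * KO w y)%:E).
  rewrite -int_kernel_restrict//; apply: eq_integral => x _ /=.
  by rewrite /H/= (J_sym y); congr EFin; ring.
by rewrite !patchE; case: ifP; rewrite ?mul0r.
Qed.

(** A function equal to [c] off the domain is [c] plus a function supported in
    the domain, and the operator maps the constant [c] to itself because [J] has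
    mass one. This is applied to [f \o u] with [c = f 0], where [u] vanishes
    off the domain, and reduces the equation to integrals over the domain. *)
Lemma Kop_decomposition phi c x : measurable_fun setT phi ->
  {ae mu, forall y, ~ Omega y -> phi y = c} ->
  intg (fun y => phi y - c) -> Kop J phi x = c + KO (fun y => phi y - c) x.
Proof.
move=> mphi phic iphi.
have iJ : mu.-integrable setT (EFin \o J x).
  apply/integrableP; split; first by apply/measurable_EFinP; exact: measurable_kernel.
  under eq_integral do rewrite /= ger0_norm//.
  by rewrite J_int1 ltry.
have ires : mu.-integrable setT (EFin \o ((fun y => J x y * (phi y - c)) \_ Omega)).
  rewrite -restrict_EFin; apply/(integrable_mkcond _ mO).
  exact: intg_kernelM.
rewrite /Kop (_ : \int[mu]_y (J x y * phi y) =
  \int[mu]_y (c * J x y + ((fun y => J x y * (phi y - c)) \_ Omega) y)); last first.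
  congr fine; apply: ae_eq_integral => //.
  - apply/measurable_EFinP; apply: measurable_funM => //; exact: measurable_kernel.
  - apply/measurable_EFinP; apply: measurable_funD.
      by apply: measurable_funM => //; exact: measurable_kernel.
    by have /measurable_int/measurable_EFinP := ires.
  - apply: filterS phic => y h _; rewrite patchE; congr EFin.
    case: ifPn => [yO|/negP] /=; first by rewrite mulrBr (mulrC c) addrC subrK.
    by rewrite inE => /h ->; rewrite addr0 mulrC.
rewrite RintegralD//; last by have := integrableZl measurableT c iJ.
rewrite RintegralZl// [X in c * X](_ : _ = 1) ?mulr1.
  by rewrite /KO [in RHS]Rintegral_mkcond.
by rewrite /Rintegral J_int1.
Qed.

End kernel_operator.

(** * Continuous functions on a symmetric interval *)

Section clamp.
Context {R : realType}.
Implicit Types r x y : R.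

(** Composing with the projection on [[- r, r]] extends a function from this
    interval to the line, keeping its continuity and its bounds, and leaves it
    unchanged along functions with values in the interval. *)
Definition clamp r x := Num.max (- r) (Num.min r x).

Lemma clamp_id r x : - r <= x <= r -> clamp r x = x.
Proof. by move=> /andP[? ?]; rewrite /clamp min_r// max_r. Qed.

Lemma clamp_itv r x : 0 <= r -> - r <= clamp r x <= r.
Proof.
move=> r0; rewrite /clamp le_max lexx/= ge_max ge_min lexx/= andbT.
by lra.
Qed.

Lemma clamp_lip r x y : `|clamp r x - clamp r y| <= `|x - y|.
Proof.
rewrite /clamp; apply/ler_normlP.
have := ler_norm (x - y); have := ler_norm (y - x); rewrite (distrC y).
move: `|x - y| => d h1 h2.
by split; case: (leP r x) => ?; case: (leP r y) => ?;
  rewrite /Num.max; do ?case: ifPn => ?; lra.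
Qed.

Lemma clamp_continuous r : continuous (clamp r).
Proof.
move=> x; apply/(@cvgrPdist_le _ _ _ (nbhs x)) => e e0.
apply/nbhs_normP; exists e => //= y xy.
by apply: le_trans (clamp_lip r x y) _; exact: ltW.
Qed.

Lemma clamp_continuous_comp (S : topologicalType) r (phi : R -> S) : 0 <= r ->
  {within `[- r, r], continuous phi} -> continuous (phi \o clamp r).
Proof.
move=> r0 /subspace_continuousP cphi x A.
have xr : `[- r, r]%classic (clamp r x) by rewrite /= in_itv/=; exact: clamp_itv.
move=> Ax.
have h : nbhs (clamp r x) [set y | `[- r, r]%classic y -> A (phi y)].
  exact: (cphi _ xr A Ax).
have h' : nbhs x (clamp r @^-1` [set y | `[- r, r]%classic y -> A (phi y)]).
  exact: (@clamp_continuous r x _ h).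
by apply: filterS h' => y; apply; rewrite /= in_itv/=; exact: clamp_itv.
Qed.

Lemma uniformly_continuous_itv r (psi : R -> R) (e : R) : continuous psi -> 0 < e ->
  exists2 d : R, 0 < d & forall x y, - r <= x <= r -> `|x - y| < d ->
    `|psi x - psi y| <= e.
Proof.
move=> cpsi e0.
have e20 : 0 < e / 2 by rewrite divr_gt0.
have : \forall d \near (0 : R)^'+, forall x, `[- r, r]%classic x -> forall y,
    `|x - y| < d -> `|psi x - psi y| <= e.
  apply: (proj1 (compact_near_coveringP _) (@segment_compact _ (- r) r)) => x xr.
  have /cvgrPdist_le/(_ _ e20)/nbhs_normP[d /= d0 Hd] := cpsi x.
  have d20 : 0 < d / 2 by rewrite divr_gt0.
  exists ([set x' | `|x - x'| < d / 2], [set d' | d' < d / 2]).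
    split => /=; first by apply/nbhs_normP; exists (d / 2).
    exact: nbhs_right_lt.
  move=> [x' d'] /= [xx' dd'] y x'y.
  have h1 : `|psi x - psi x'| <= e / 2 by apply: Hd => /=; lra.
  have h2 : `|psi x - psi y| <= e / 2.
    by apply: Hd => /=; have := ler_distD x' x y; lra.
  by have := ler_distD (psi x) (psi x') (psi y); rewrite (distrC (psi x') (psi x)); lra.
move=> [d /= d0 Hd].
exists (d / 2); first by rewrite divr_gt0.
move=> x y xr xy; apply: (Hd (d / 2)) => //.
- by rewrite /= sub0r normrN gtr0_norm ?divr_gt0//; lra.
- by rewrite divr_gt0.
Qed.

(** Uniform continuity with a linear remainder: points at distance at least [d]
    are covered by the bound of [psi], paid at the rate [2 * B / d]. *)
Lemma almost_lipschitz_itv r (psi : R -> R) (e : R) : continuous psi -> 0 < e ->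
  exists2 C : R, 0 <= C & forall x y, - r <= x <= r -> - r <= y <= r ->
    `|psi x - psi y| <= e + C * `|x - y|.
Proof.
move=> cpsi e0; have [d d0 Hd] := uniformly_continuous_itv r cpsi e0.
have [B B0 HB] := compact_prod_bounded (@segment_compact _ (- r) r) cpsi.
exists (2 * B / d); first by rewrite divr_ge0 ?mulr_ge0// ltW.
move=> x y xr yr; have [xy|xy] := ltP `|x - y| d.
  apply: le_trans (Hd _ _ xr xy) _.
  by rewrite lerDl mulr_ge0// divr_ge0 ?mulr_ge0// ltW.
apply: le_trans (ler_normB _ _) _.
have hx : `|psi x| <= B by apply: HB; rewrite /= in_itv.
have hy : `|psi y| <= B by apply: HB; rewrite /= in_itv.
apply: (@le_trans _ _ (2 * B)); first by lra.
apply: (@le_trans _ _ (2 * B / d * `|x - y|)); last by rewrite lerDr ltW.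
by rewrite mulrAC ler_pdivlMr// ler_wpM2l// mulr_ge0// ltW.
Qed.

End clamp.

(** * The potential of the inverse functions *)

Section potential.
Context {R : realType}.
Local Notation lambda := (@lebesgue_measure R).
Variables (f finv ginv : R -> R) (rho sg : R).
Hypotheses (rho_gt0 : 0 < rho) (cf : continuous f)
  (f_incr : forall x y : R, x < y -> f x < f y) (fK : cancel f finv).
Hypothesis (theta_wd : theta_well_defined f finv ginv rho).
Hypothesis (sg_ginv : forall x y : R, - rho < x -> x <= y -> y < rho ->
  sg * ginv x <= sg * ginv y).

Let f_le (x y : R) : x <= y -> f x <= f y.
Proof. by rewrite le_eqVlt => /predU1P[->//|/f_incr/ltW]. Qed.

Let p s := ginv (finv s).

Let Nrr : - rho <= rho.
Proof. by rewrite ge0_cp// ltW. Qed.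

Let theta_range m s : - rho <= m <= rho -> Num.min 0 (f m) < s < Num.max 0 (f m) ->
  f (- rho) < s < f rho.
Proof.
move=> mr ms.
have [H _] := theta_wd (m := m) ltac:(by rewrite in_itv).
by have [w] := H s ms; rewrite in_itv/= => /andP[w1 w2] <-; rewrite !f_incr.
Qed.

(** If [f rho] were negative, the inverse of [f] would have to be defined, with
    values inside the interval, at points between [f rho] and zero, that is,
    beyond the values of [f] on the interval. *)
Lemma f_rho_ge0 : 0 <= f rho.
Proof.
rewrite leNgt; apply/negP => f0.
have := @theta_range rho (f rho / 2); rewrite lexx (min_r (ltW f0)) (max_l (ltW f0)).
rewrite Nrr.
have -> : f rho < f rho / 2 < 0 by apply/andP; split; lra.
move=> /(_ isT isT) /andP[_]; lra.
Qed.

Lemma f_Nrho_le0 : f (- rho) <= 0.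
Proof.
rewrite leNgt; apply/negP => f0.
have := @theta_range (- rho) (f (- rho) / 2); rewrite lexx (min_l (ltW f0)) (max_r (ltW f0)).
rewrite Nrr.
have -> : 0 < f (- rho) / 2 < f (- rho) by apply/andP; split; lra.
move=> /(_ isT isT) /andP[+ _]; lra.
Qed.

Let A := f (- rho).
Let B := f rho.

(** The definition of [theta] at [m = rho] and at [m = - rho] gives integrability
    on either side of zero. *)
Let integrable_p : lambda.-integrable `[A, B] (EFin \o p).
Proof.
have rin : rho \in `[- rho, rho] by rewrite in_itv/= lexx andbT.
have nrin : - rho \in `[- rho, rho] by rewrite in_itv/= lexx/=.
have [_] := theta_wd rin; rewrite (min_l f_rho_ge0) (max_r f_rho_ge0) -/B => i1.
have [_] := theta_wd nrin; rewrite (min_r f_Nrho_le0) (max_l f_Nrho_le0) -/A => i2.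
have E : `[A, B]%classic = `[A, 0%R] `|` `]0%R, B].
  apply/seteqP; split => x /=; rewrite !in_itv/=.
    move=> /andP[Ax xB]; have [x0|x0] := leP x 0; [left|right] => //.
    by rewrite Ax.
  have := f_rho_ge0; have := f_Nrho_le0; rewrite -/A -/B => ? ?.
  by case=> /andP[? ?]; apply/andP; split; lra.
have i1' : lambda.-integrable `]0, B] (EFin \o p).
  by apply: integrableS i1 => //; apply: subset_itvr; rewrite bnd_simp.
rewrite E; apply/integrableP.
move/integrableP : i1' => [m1 l1]; move/integrableP : i2 => [m2 l2].
have mU : measurable_fun (`[A, 0%R] `|` `]0%R, B]) (EFin \o p).
  by apply/measurable_funU => //; split.
split => //; rewrite ge0_integral_setU//=.
- by apply: lte_add_pinfty; [exact: l2|exact: l1].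
- by apply/measurable_EFinP; apply: measurableT_comp => //; exact/measurable_EFinP.
- apply/disj_setPS => x /= []; rewrite !in_itv/= => /andP[_ x0] /andP[x0' _].
  by move: x0; rewrite leNgt x0'.
Qed.

(** The function [- i] of the statement, up to an additive constant: integrating
    from [f (- rho)] keeps the interval of integration oriented. *)
Definition potential m := \int[lambda]_(s in `[f (- rho), f m]) ginv (finv s).

Lemma potential_continuous : {within `[- rho, rho], continuous potential}.
Proof.
have AB : A <= B by exact: f_le.
have /subspace_continuousP cI := parameterized_integral_continuous AB integrable_p.
apply/subspace_continuousP => m mr.
have fm : `[A, B]%classic (f m).
  by move: mr; rewrite /= !in_itv/= => /andP[? ?]; rewrite !f_le.
move=> U Um.
have h : nbhs (f m) [set s | `[A, B]%classic s ->
    U (\int[lambda]_(t in `[A, s]) p t)] by exact: (cI _ fm U Um).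
have h' : nbhs m (f @^-1` [set s | `[A, B]%classic s ->
    U (\int[lambda]_(t in `[A, s]) p t)]) by exact: (cf h).
apply: filterS h' => x h' xr; apply: h'.
by move: xr; rewrite /= !in_itv/= => /andP[? ?]; rewrite !f_le.
Qed.

Let potentialB a b : - rho <= a -> a <= b -> b <= rho ->
  potential b - potential a = \int[lambda]_(s in `]f a, f b]) p s.
Proof.
move=> ra ab br; rewrite /potential; apply: Rintegral_itvB.
- apply: integrableS integrable_p => //; apply: subset_itvl.
  by rewrite bnd_simp; exact: f_le.
- by rewrite bnd_simp; exact: f_le.
- by rewrite bnd_simp; exact: f_le.
Qed.

Let p_between a b s : a <= b -> f a < s <= f b -> exists2 w, a <= w <= b & p s = ginv w.
Proof.
move=> ab /andP[as_ sb].
have [||w wab fw] := @IVT R f a b s ab.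
- exact: continuous_subspaceT.
- by rewrite (min_l (f_le ab)) (max_r (f_le ab)) (ltW as_).
by exists w; [move: wab; rewrite in_itv|rewrite /p -fw fK].
Qed.

(** As a function of [s = f m] the potential has derivative [ginv (finv s)], which
    is monotone with sign [sg]. The convexity inequality is obtained by bounding the
    integrand over [[f a, f b]] by its value at an endpoint, without
    differentiating the integral. *)
Lemma potential_convex a b : - rho < a < rho -> - rho < b < rho ->
  sg * (potential b - potential a) <= sg * ginv b * (f b - f a).
Proof.
move=> /andP[ra ar] /andP[rb br].
have ip x y : - rho < x -> y < rho -> lambda.-integrable `]f x, f y] (EFin \o p).
  move=> rx yr; apply: integrableS integrable_p => //.
  by apply: subset_itv; rewrite bnd_simp; apply: f_le; exact: ltW.
have lty (x y : R) : (lambda `]x, y] < +oo)%E.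
  by rewrite lebesgue_measure_itv/=; case: ifP => _; rewrite ?ltry// -EFinB ltry.
have icst x y c : lambda.-integrable `]f x, f y] (EFin \o cst c).
  by apply: intg_cst => //; exact: lty.
have cstE x y c : x <= y -> \int[lambda]_(s in `]f x, f y]) c = c * (f y - f x).
  move=> xy; rewrite Rintegral_cst//= lebesgue_measure_itv/= lte_fin.
  have [//|fyx] := ltP (f x) (f y).
  by have -> : f y = f x; [apply/eqP; rewrite eq_le fyx f_le|rewrite subrr].
have sgip x y : - rho < x -> y < rho -> lambda.-integrable `]f x, f y] (EFin \o (fun s => sg * p s)).
  by move=> *; apply: intgZ => //; exact: ip.
have [ab|/ltW ba] := leP a b.
  rewrite potentialB ?(ltW ra) ?(ltW br)// -RintegralZl//; last exact: ip.
  rewrite -cstE//; apply: le_Rintegral => //; [exact: sgip|exact: icst|].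
  move=> s; rewrite /= in_itv/= => /(p_between ab)[w /andP[aw wb] ->].
  by apply: sg_ginv => //; exact: lt_le_trans aw.
rewrite -[_ - _]opprB potentialB ?(ltW rb) ?(ltW ar)// mulrN -[f b - _]opprB mulrN lerN2.
rewrite -RintegralZl//; last exact: ip.
rewrite -cstE//; apply: le_Rintegral => //; [exact: icst|exact: sgip|].
move=> s; rewrite /= in_itv/= => /(p_between ba)[w /andP[bw wa] ->].
by apply: sg_ginv => //; exact: le_lt_trans wa ar.
Qed.

End potential.

(** * Pointwise dissipation *)

Section pointwise_dissipation.
Context {R : realType}.
Variables (f ginv PF : R -> R) (rho sg : R).
Hypotheses (sg1 : `|sg| = 1)
  (f_incr : forall x y : R, x < y -> f x < f y)
  (f_derivable : forall x : R, derivable f x 1)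
  (f'_gt0 : forall x, 0 < derive1 f x)
  (sg_ginv : forall x y : R, - rho < x -> x <= y -> y < rho ->
    sg * ginv x <= sg * ginv y)
  (ginv_inj : forall x y : R, - rho < x < rho -> - rho < y < rho ->
    ginv x = ginv y -> x = y)
  (PF_convex : forall a b : R, - rho < a < rho -> - rho < b < rho ->
    sg * (PF b - PF a) <= sg * ginv b * (f b - f a)).

Let f_le (x y : R) : x <= y -> f x <= f y.
Proof. by rewrite le_eqVlt => /predU1P[->//|/f_incr/ltW]. Qed.

(** Value after time [s] of a point starting at [a] and relaxing towards [F]. *)
Definition relaxed (a F s : R) := a + (1 - expR (- s)) * (F - a).

(** To first order in [s] and up to the factor [beta], a bound for the variation of
    the integrand of the Lyapunov functional when the value [a] moves to
    [relaxed a F s]. It is a product of two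
    differences with opposite signs: the relaxed value is between [a] and [F],
    [f] is increasing and [sg * ginv] is monotone. *)
Definition slack (a F s : R) :=
  sg * (ginv (relaxed a F s) - ginv F) * (f (relaxed a F s) - f a).

Lemma relaxed_between a F s : 0 <= s ->
  (a <= F -> a <= relaxed a F s <= F) /\ (F <= a -> F <= relaxed a F s <= a).
Proof.
move=> /one_sub_expRN_itv; rewrite /relaxed; move: (1 - _) => k /andP[k0 k1].
by split => aF; apply/andP; split; nra.
Qed.

Lemma relaxed_itv a F s r : 0 <= s -> - r <= a <= r -> - r <= F <= r ->
  - r <= relaxed a F s <= r.
Proof.
move=> /(relaxed_between a F)[h1 h2] /andP[a1 a2] /andP[F1 F2].
have [/h1|/ltW/h2] := leP a F => /andP[b1 b2]; apply/andP; split; lra.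
Qed.

Lemma slack_le0 a F s : - rho < a < rho -> - rho < F < rho -> 0 <= s -> slack a F s <= 0.
Proof.
move=> /andP[a1 a2] /andP[F1 F2] /(relaxed_between a F)[h1 h2].
rewrite /slack (mulrBr sg); have [/h1|/ltW/h2] := leP a F => /andP[b1 b2].
  apply: mulr_le0_ge0; rewrite ?subr_le0 ?subr_ge0 ?f_le//.
  by apply: sg_ginv => //; lra.
apply: mulr_ge0_le0; rewrite ?subr_le0 ?subr_ge0 ?f_le//.
by apply: sg_ginv => //; lra.
Qed.

Let slope a : exists2 e : R, 0 < e & forall y : R, y != a -> `|y - a| < e ->
  derive1 f a / 2 < (f y - f a) / (y - a).
Proof.
have m2 : derive1 f a / 2 < derive1 f a by have := f'_gt0 a; lra.
have : h^-1 *: (f (h *: (1 : R) + a) - f a) @[h --> (0 : R)^'] --> derive1 f a.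
  by rewrite derive1E; exact: f_derivable.
move=> cvgf; have H := cvgr_gt _ cvgf _ m2.
have /nbhs_normP[e /= e0 He] : \forall h \near (0 : R), h != 0 ->
    derive1 f a / 2 < h^-1 *: (f (h *: (1 : R) + a) - f a) by exact: H.
exists e => // y ya yae; have := He (y - a).
rewrite /= sub0r normrN => /(_ yae); rewrite subr_eq0 => /(_ ya).
by rewrite /GRing.scale/= mulr1 subrK [X in _ < X -> _]mulrC.
Qed.

(** The relaxed value stays on the side of [a] with respect to the midpoint of
    [a] and [F], which bounds the factor with [ginv] away from zero, while
    the factor with [f] grows linearly in [s] because [f] has positive derivative
    at [a]. *)
Lemma slack_lower a F : - rho < a < rho -> - rho < F < rho -> a != F ->
  exists c, exists2 d, 0 < c /\ 0 < d & forall s, 0 < s -> s < d -> slack a F s <= - (c * s).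
Proof.
move=> ar Fr aF; have /andP[a1 a2] := ar; have /andP[F1 F2] := Fr.
have [e e0 He] := slope a.
have m0 := f'_gt0 a; set m := derive1 f a in m0 He.
pose mid := (a + F) / 2.
pose c1 := `|ginv F - ginv mid|.
have midr : - rho < mid < rho by rewrite /mid; apply/andP; split; lra.
have c10 : 0 < c1.
  rewrite normr_gt0 subr_eq0; apply/eqP => /(ginv_inj Fr midr).
  by rewrite /mid => h; move/eqP: aF; apply; lra.
have D0 : 0 < `|F - a| by rewrite normr_gt0 subr_eq0 eq_sym.
(* times at most [1 / 2] keep the relaxed value before the midpoint; the other
   bound brings it within the range of the slope estimate *)
exists (c1 * (m / 4 * `|F - a|)), (Num.min 2^-1 (e / `|F - a|)).
  by rewrite !mulr_gt0 ?divr_gt0// lt_min invr_gt0 ltr0n divr_gt0.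
move=> s s0; rewrite lt_min => /andP[s12 se].
have k2 : s / 2 <= 1 - expR (- s) <= s.
  have s1 : s <= 1 by lra.
  have /andP[h1 h2] := expRN_bounds (ltW s0) s1.
  by apply/andP; split; rewrite ?expr2 in h2 *; nra.
have slack0 := slack_le0 ar Fr (ltW s0).
have slE : slack a F s =
    - (`|ginv (relaxed a F s) - ginv F| * `|f (relaxed a F s) - f a|).
  rewrite -[LHS]opprK; congr (- _); rewrite -[RHS]mul1r -sg1 -!normrM mulrA.
  by rewrite -[in RHS]normrN ger0_norm// oppr_ge0.
rewrite slE lerN2 /relaxed; move: (1 - expR (- s)) k2 => k /andP[ks1 ks2].
have k0 : 0 < k by lra.
have kN1 : k <= 1 / 2 by lra.
set b := a + k * (F - a).
have ba : b - a = k * (F - a) by rewrite /b; lra.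
have bNa : b != a 
  by rewrite -subr_eq0 ba; apply: mulf_neq0; [rewrite gt_eqF|rewrite subr_eq0 eq_sym].
have bae : `|b - a| < e.
  rewrite ba normrM gtr0_norm//; apply: le_lt_trans (_ : s * `|F - a| < _).
    by rewrite ler_wpM2r.
  by rewrite -ltr_pdivlMr.
have slp := He b bNa bae.
have df : m / 2 * `|b - a| <= `|f b - f a|.
  rewrite -ler_pdivlMr ?normr_gt0 ?subr_eq0// -normf_div.
  by apply: le_trans (ltW slp) (ler_norm _).
have dg : c1 <= `|ginv b - ginv F|.
  rewrite /c1 -[leLHS]mul1r -[leRHS]mul1r -sg1 -!normrM.
  rewrite -[`|sg * (ginv b - _)|]normrN -mulrN opprB !mulrBr.
  have [aF'|aF'] := ltP a F.
    have bm : b <= mid by rewrite /b /mid; nra.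
    have ab : a < b by rewrite /b; nra.
    have := sg_ginv (x := b) (y := mid); have := sg_ginv (x := mid) (y := F).
    have -> : - rho < b by lra. rewrite bm F2.
    have /andP[-> ->] := midr.
    have -> : mid <= F by rewrite /mid; lra.
    move=> /(_ isT isT isT) g1 /(_ isT isT isT) g2.
    rewrite !ger0_norm ?subr_ge0//; lra.
  have {}aF' : F < a by rewrite lt_neqAle eq_sym aF.
  have bm : mid <= b by rewrite /b /mid; nra.
  have ab : b < a by rewrite /b; nra.
  have := sg_ginv (x := mid) (y := b); have := sg_ginv (x := F) (y := mid).
  have -> : b < rho by lra. rewrite bm F1.
  have /andP[-> ->] := midr.
  have -> : F <= mid by rewrite /mid; lra.
  move=> /(_ isT isT isT) g1 /(_ isT isT isT) g2.
  rewrite !ler0_norm ?subr_le0//; lra.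
have bE : `|b - a| = k * `|F - a| by rewrite ba normrM gtr0_norm.
apply: le_trans (_ : c1 * (m / 2 * `|b - a|) <= _); last first.
  by apply: ler_pM => //; rewrite ?mulr_ge0 ?divr_ge0// ltW.
rewrite bE -[leLHS]mulrA ler_wpM2l ?(ltW c10)//.
have k_s : 0 <= k - s / 2 by lra.
have := mulr_ge0 (mulr_ge0 (ltW m0) (ltW D0)) k_s.
by move: `|F - a| => D; nra.
Qed.

(** Along a solution the value [a1] at time [s] is the relaxed value up to [del].
    The convexity of the potential at [a1] produces [ginv a1 - ginv F]; replacing
    [a1] by the relaxed value costs [eta] in [ginv], multiplied by the increment of
    [f], and [del] in [f], multiplied by the bound of [ginv]. *)
Lemma dissipation_pointwise (Lf Gam eta del d r a0 a1 F s : R) :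
  0 <= Lf -> 0 <= eta -> 0 <= Gam -> r < rho ->
  (forall x y, - rho <= x <= rho -> - rho <= y <= rho -> `|f x - f y| <= Lf * `|x - y|) ->
  (forall x, - r <= x <= r -> `|ginv x| <= Gam) ->
  - r <= a0 <= r -> - r <= a1 <= r -> - r <= F <= r -> 0 <= s ->
  `|ginv a1 - ginv (relaxed a0 F s)| <= eta ->
  `|a1 - relaxed a0 F s| <= del -> `|a1 - a0| <= d ->
  sg * (PF a1 - PF a0) - sg * ginv F * (f a1 - f a0) <=
    slack a0 F s + eta * (Lf * d) + 2 * Gam * (Lf * del).
Proof.
move=> Lf0 eta0 Gam0 rr f_lip ginvG a0r a1r Fr s0 geta bdel ad.
have br := relaxed_itv s0 a0r Fr.
have in_rho x : - r <= x <= r -> - rho <= x <= rho.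
  by move=> /andP[? ?]; apply/andP; split; lra.
have in_rho' x : - r <= x <= r -> - rho < x < rho.
  by move=> /andP[? ?]; apply/andP; split; lra.
have conv := PF_convex (in_rho' _ a0r) (in_rho' _ a1r).
rewrite /slack; set b := relaxed a0 F s in br geta bdel *.
have fa : `|f a1 - f a0| <= Lf * d.
  by apply: le_trans (f_lip _ _ (in_rho _ a1r) (in_rho _ a0r)) _; rewrite ler_wpM2l.
have fb : `|f a1 - f b| <= Lf * del.
  by apply: le_trans (f_lip _ _ (in_rho _ a1r) (in_rho _ br)) _; rewrite ler_wpM2l.
have t1 : sg * (ginv a1 - ginv b) * (f a1 - f a0) <= eta * (Lf * d).
  apply: le_trans (ler_norm _) _; rewrite !normrM sg1 mul1r.
  by apply: ler_pM.
have t2 : sg * (ginv b - ginv F) * (f a1 - f b) <= 2 * Gam * (Lf * del).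
  apply: le_trans (ler_norm _) _; rewrite !normrM sg1 mul1r.
  apply: ler_pM => //; apply: le_trans (ler_normB _ _) _.
  by have := ginvG _ br; have := ginvG _ Fr; lra.
have -> : sg * (PF a1 - PF a0) - sg * ginv F * (f a1 - f a0) =
  (sg * (PF a1 - PF a0) - sg * ginv a1 * (f a1 - f a0)) +
  (sg * (ginv a1 - ginv b) * (f a1 - f a0) + sg * (ginv b - ginv F) * (f a1 - f b)
   + sg * (ginv b - ginv F) * (f b - f a0)) by ring.
lra.
Qed.

End pointwise_dissipation.

(** * Compact classes of functions *)

Section bounded_modulus.
Context {R : realType} {X : topologicalType}.
Variables (M : X -> X -> R -> Prop) (r : R).

(** The modulus of continuity is an arbitrary relation: [M x x' e] says that the
    values at [x] and [x'] are required to differ by at most [e]. *)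
Definition bounded_modulus : set {ptws X -> R} :=
  [set w | (forall x, `|w x| <= r) /\ forall x x' e, M x x' e -> `|w x - w x'| <= e].

Let eval_continuous (x : X) : continuous (fun w : {ptws X -> R} => w x).
Proof. exact: (@proj_continuous X (fun=> R) x). Qed.

Let closed_ball0 (c : R) : closed [set t : R | `|t| <= c].
Proof.
rewrite (_ : mkset _ = `[- c, c]%classic); first exact: itv_closed.
by apply/seteqP; split => t; rewrite /= in_itv/= ler_norml.
Qed.

(** The conditions are closed for pointwise convergence and cut out a subset of
    a product of compact intervals, so that Tychonoff's theorem applies. *)
Lemma compact_bounded_modulus : compact bounded_modulus.
Proof.
pose B := [set w : {ptws X -> R} | forall x, `[- r, r]%classic (w x)].
have cB : compact B.
  exact: (@tychonoff X (fun=> R) (fun=> `[- r, r]%classic) (fun=> @segment_compact _ _ _)).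
apply: (subclosed_compact _ cB); last first.
  by move=> w [wr _] x; rewrite /= in_itv/= -ler_norml.
have -> : bounded_modulus = [set w : {ptws X -> R} | forall x, `|w x| <= r] `&`
    \bigcap_(i in [set i : X * X * R | M i.1.1 i.1.2 i.2])
      [set w : {ptws X -> R} | `|w i.1.1 - w i.1.2| <= i.2].
  apply/seteqP; split => w [w1 w2]; split => //.
    by move=> [[x x'] e] /= /w2.
  by move=> x x' e m; have := w2 (x, x', e) m.
apply: closedI.
  have -> : [set w : {ptws X -> R} | forall x, `|w x| <= r] =
      \bigcap_(x in [set: X]) [set w : {ptws X -> R} | `|w x| <= r].
    by apply/seteqP; split => w wr x; [move=> _; exact: wr|exact: wr].
  apply: closed_bigI => x _.
  apply: (@closed_comp _ _ (fun w : {ptws X -> R} => w x) [set t : R | `|t| <= r]).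
    by move=> w _; exact: (@eval_continuous x w).
  exact: closed_ball0.
apply: closed_bigI => -[[x x'] e] _.
apply: (@closed_comp _ _ (fun w : {ptws X -> R} => w x - w x') [set t : R | `|t| <= e]).
  move=> w _; exact: (cvgB (@eval_continuous x w) (@eval_continuous x' w)).
exact: closed_ball0.
Qed.

(** Pointwise convergence within the class is uniform on compact sets: the
    modulus transports the closeness at one point to its neighbourhood. *)
Lemma bounded_modulus_uniform (Q : set X) (w0 : {ptws X -> R}) (eta : R) :
  (forall x e, 0 < e -> \forall x' \near x, M x x' e) -> compact Q ->
  bounded_modulus w0 -> 0 < eta ->
  \forall w \near w0, bounded_modulus w -> forall x, Q x -> `|w0 x - w x| <= eta.
Proof.
move=> Mnear cQ [_ w0M] eta0; have eta3 : 0 < eta / 3 by rewrite divr_gt0.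
have : \forall w \near w0, forall x, Q x -> bounded_modulus w -> `|w0 x - w x| <= eta.
  have := proj1 (compact_near_coveringP _) cQ _ (nbhs w0)
    (fun w x => bounded_modulus w -> `|w0 x - w x| <= eta) (nbhs_filter w0).
  apply => x Qx.
  exists ([set x' | M x x' (eta / 3)],
          [set w : {ptws X -> R} | `|w0 x - w x| <= eta / 3]).
    split => /=; first exact: Mnear.
    have /cvgrPdist_le h := @eval_continuous x w0.
    exact: h.
  move=> [x' w] /= [xx' wx] [_ wM].
  have h1 := w0M _ _ _ xx'; have h2 := wM _ _ _ xx'.
  have := ler_distD (w0 x) (w0 x') (w x'); have := ler_distD (w x) (w0 x) (w x').
  by rewrite (distrC (w0 x') (w0 x)); lra.
by apply: filterS => w hw bw x Qx; exact: hw.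
Qed.

End bounded_modulus.

(** * The metric of L^p *)

Section metric.
Context {R : realType} {M : metricType R}.

Lemma nbhs_mdistP (u : M) (A : set M) :
  nbhs u A <-> exists2 e : R, 0 < e & forall v, mdist u v < e -> A v.
Proof.
split.
  by move=> /nbhs_ballP[e /= e0 eA]; exists e => // v uv; apply: eA; rewrite ballEmdist.
by move=> [e e0 eA]; apply/nbhs_ballP; exists e => //= v; rewrite ballEmdist; exact: eA.
Qed.

Lemma closure_mdist (u : M) (A : set M) (e : R) : closure A u -> 0 < e ->
  exists2 v, A v & mdist u v < e.
Proof.
move=> uA e0; have [|v [Av uv]] := uA [set v | mdist u v < e].
  by apply/nbhs_mdistP; exists e.
by exists v.
Qed.

End metric.

Section Lspace_distance.
Context d (T : measurableType d) (R : realType).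
Variables (mu : {measure set T -> \bar R}) (D : set T).
Hypotheses (mD : measurable D) (fD : (mu D < +oo)%E).
Variables (p : \bar R) (p1 : (1 <= p)%E).
Local Notation Lp := (LspaceType mu p1).
Implicit Types u v : Lp.

Local Notation intg phi := (mu.-integrable D (EFin \o phi)).
Local Notation l1norm := (L1norm mu D).

Let measurable_LspaceB u v : measurable_fun setT (u \- v)%R.
Proof. by apply: measurable_funB; exact: measurable_Lspace. Qed.

Lemma mdist_le_add : exists2 C : R, 0 <= C & forall u v u' v' (M : R), 0 <= M ->
  {ae mu, forall x, `|u' x - v' x| <= `|u x - v x| + M * \1_D x} ->
  mdist u' v' <= mdist u v + C * M.
Proof.
have [C C0 HC] := Lnorm_le_bound mD fD p1; exists C => // u v u' v' M M0 le.
have mI : measurable_fun setT (fun x => M * \1_D x).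
  by apply: measurable_funM => //; exact: measurable_indic.
have mN : measurable_fun setT (fun x => `|u x - v x|).
  by apply: measurableT_comp => //; exact: measurable_LspaceB.
change (Lp_dist u' v' <= Lp_dist u v + C * M).
rewrite -lee_fin EFinD !Lp_dist_fin.
apply: (@le_trans _ _ ('N[mu]_p[EFin \o (fun x => `|u x - v x|)%R] +
    'N[mu]_p[EFin \o (fun x => M * \1_D x)%R])%E); last first.
  apply: leeD.
    by apply: le_Lnorm => //; apply/aeW => x; rewrite normr_id.
  apply: HC => //; apply/aeW => x; rewrite ger0_norm// mulr_ge0//.
apply: le_trans (eminkowski mu mN mI p1).
apply: le_Lnorm => //; first exact: measurable_funD.
apply: filterS le => x /le_trans; apply; exact: ler_norm.
Qed.

Lemma mdist_le_indic : exists2 C : R, 0 <= C & forall u v (M : R), 0 <= M ->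
  {ae mu, forall x, `|u x - v x| <= M * \1_D x} -> mdist u v <= C * M.
Proof.
have [C C0 HC] := mdist_le_add; exists C => // u v M M0 le.
have := HC u u u v M M0; rewrite mdistxx add0r; apply.
by apply: filterS le => x; rewrite subrr normr0 add0r.
Qed.

Lemma l1norm_le_mdist : exists2 C : R, 0 <= C & forall u v,
  intg (fun x => u x - v x) /\ l1norm (fun x => u x - v x) <= C * mdist u v.
Proof.
have [C C0 HC] := l1norm_le_Lnorm mD fD p1; exists C => // u v.
have fin : ('N[mu]_p[EFin \o (u \- v)%R] < +oo)%E by rewrite -Lp_dist_fin ltry.
exact: (HC _ (measurable_LspaceB u v) fin).
Qed.

Lemma intg_Lspace u : intg u.
Proof.
have [C C0 HC] := l1norm_le_Lnorm mD fD p1.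
by have [] := HC u (measurable_Lspace u) (@Lebesgue_finite _ _ _ _ _ _ u).
Qed.

(** The positive part of [`|u| - b] is dominated by [`|u - v|] for each [v] of the
    set, hence has zero norm when [u] is a limit of such [v]. *)
Lemma closed_dominated (b : T -> R) : measurable_fun setT b ->
  closed [set u : Lp | {ae mu, forall x, `|u x| <= b x}].
Proof.
move=> mb u uA.
pose e x := Num.max 0 (`|u x| - b x).
have me : measurable_fun setT e.
  apply: measurable_maxr => //; apply: measurable_funB => //.
  by apply: measurableT_comp => //; exact: measurable_Lspace.
have e0 : 'N[mu]_p[EFin \o e]%E = 0%E.
  apply/eqP; rewrite eq_le Lnorm_ge0 andbT.
  apply/lee_addgt0Pr => r r0; rewrite add0e.
  have [v vA uv] := closure_mdist uA r0.
  apply: (@le_trans _ _ (Lp_dist u v)%:E); last by rewrite lee_fin ltW.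
  rewrite Lp_dist_fin; apply: le_Lnorm => //.
  apply: filterS vA => x vx; rewrite ger0_norm ?le_max ?lexx// ge_max normr_ge0/=.
  by have := ler_distD 0 (u x) (v x); have := lerB_dist (u x) (v x); lra.
have meE : measurable_fun setT (EFin \o e) by exact/measurable_EFinP.
have := Lnorm_eq0_eq0 meE (lt_le_trans lte01 p1) e0.
apply: filterS => x /(_ I) [] ex; rewrite -subr_le0.
by rewrite -[leRHS]ex le_max lexx orbT.
Qed.

End Lspace_distance.

(** * The nonlinear field on the ball *)

Section neural_reaction.
Context {R : realType} {N : nat}.
Local Notation mu := (@lebesgue_rV R N).
Variables (Omega : set 'rV[R]_N) (J : 'rV[R]_N -> 'rV[R]_N -> R).
Hypotheses (mO : measurable Omega) (bO : bounded_set Omega).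
Hypotheses (cJ : continuous (fun z : 'rV[R]_N * 'rV[R]_N => J z.1 z.2))
  (J_ge0 : forall x y, 0 <= J x y)
  (J_int1 : forall x, (\int[mu]_y (J x y)%:E = 1)%E).
Variables (f g : R -> R) (beta h c1 c2 rho : R).
Hypotheses (beta_gt0 : 0 < beta) (h_ge0 : 0 <= h) (rho_gt0 : 0 < rho).
Hypotheses (cf : continuous f) (cg : continuous g).
Hypotheses (f_growth : forall x, `|f x| <= c1 * `|x| + c2)
  (g_lt_rho : forall x, `|g x| < rho).
Variables (Lf Lg CJ rho1 : R).
Hypotheses (Lf_ge0 : 0 <= Lf) (Lg_ge0 : 0 <= Lg) (CJ_ge0 : 0 <= CJ)
  (rho1_ge0 : 0 <= rho1) (rho1_lt : rho1 < rho).
(** On functions bounded by [rho], [f] takes values within [Lf * rho] of [f 0], so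
    the argument of [g] remains in a compact interval, on which [`|g|] is at most
    [rho1 < rho]. This strict inequality is what moves solutions away from the
    boundary of the ball. *)
Definition drive_bound := beta * (`|f 0| + Lf * rho) + beta * h.
Hypotheses
  (f_lip : forall x y : R, - rho <= x <= rho -> - rho <= y <= rho ->
     `|f x - f y| <= Lf * `|x - y|)
  (g_lip : forall x y : R, - drive_bound <= x <= drive_bound ->
     - drive_bound <= y <= drive_bound -> `|g x - g y| <= Lg * `|x - y|)
  (g_rho1 : forall x : R, - drive_bound <= x <= drive_bound -> `|g x| <= rho1)
  (J_CJ : forall x y, Omega x -> Omega y -> J x y <= CJ).
Implicit Types (u v : 'rV[R]_N -> R).

Local Notation intg phi := (mu.-integrable Omega (EFin \o phi)).
Local Notation l1norm := (L1norm mu Omega).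
Local Notation muO := (fine (mu Omega)).

Let fO : (mu Omega < +oo)%E.
Proof. exact: bounded_rV_lty. Qed.

Let muO_ge0 : 0 <= muO.
Proof. exact: fine_ge0. Qed.

Definition drive u x :=
  beta * (f 0 + KO Omega J (fun y => f (u y) - f 0) x) + beta * h.

Definition reaction u x := g (drive u x).

(** The values off the domain are left free: all estimates take place in
    [L^1] of the domain. *)
Definition in_ball u :=
  intg u /\ {ae mu, forall x, Omega x -> `|u x| <= rho}.

Lemma intg_fu u : intg u -> intg (fun y => f (u y) - f 0).
Proof.
move=> iu.
have ib : intg (fun y => c1 * `|u y| + (`|c2| + `|f 0|)).
  by apply: intgD => //; [apply: intgZ => //; exact: intg_norm|exact: intg_cst].
apply: (intg_le_ae mO _ ib).
  apply: measurable_funB => //.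
  apply: (measurableT_comp (continuous_measurable_fun cf)).
  exact: (intg_measurable iu).
apply/aeW => y _; apply: le_trans (ler_normB _ _) _; rewrite addrA lerD2r.
by apply: le_trans (f_growth _) _; rewrite lerD2l ler_norm.
Qed.

Lemma reaction_continuous u : intg u -> continuous (reaction u).
Proof.
move=> iu x; apply: (@continuous_comp _ _ _ (drive u) g); last exact: cg.
have := KO_continuous mO bO cJ J_ge0 (intg_fu iu) => cK.
exact: (cvgD (cvgM (cvg_cst beta) (cvgD (cvg_cst (f 0)) (cK x))) (cvg_cst (beta * h))).
Qed.

Lemma measurable_reaction u : intg u -> measurable_fun setT (reaction u).
Proof. by move=> /reaction_continuous/continuous_measurable_rV. Qed.

Lemma intg_reaction u : intg u -> intg (reaction u).
Proof.
move=> iu; apply: (@intg_bounded _ _ _ _ _ mO fO _ rho).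
  by apply: measurable_funTS; exact: measurable_reaction.
by apply/aeW => x _; exact/ltW/g_lt_rho.
Qed.

Lemma Fop_reaction u x : measurable_fun setT u -> intg u ->
  {ae mu, forall y, ~ Omega y -> u y = 0} -> Omega x ->
  Fop Omega J f g beta h u x = reaction u x.
Proof.
move=> m_u iu u0 Ox; rewrite /Fop mem_set// /reaction /drive.
rewrite (@Kop_decomposition R N Omega J mO bO cJ J_ge0 J_int1 (f \o u) (f 0))//.
- exact: (measurableT_comp (continuous_measurable_fun cf)).
- by apply: filterS u0 => y h1 /h1 /= ->.
- exact: intg_fu.
Qed.

Let rho_norm x : `|x| <= rho -> - rho <= x <= rho.
Proof. by rewrite ler_norml. Qed.

Let fu_lip u v : in_ball u -> in_ball v ->
  {ae mu, forall y, Omega y -> `|f (u y) - f (v y)| <= Lf * `|u y - v y|}.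
Proof.
move=> [_ ub] [_ vb]; apply: filterS2 ub vb => y hu hv Oy.
by apply: f_lip; apply: rho_norm; [exact: hu|exact: hv].
Qed.

Lemma fu_bound u : in_ball u ->
  {ae mu, forall y, Omega y -> `|f (u y) - f 0| <= Lf * rho}.
Proof.
move=> [_ ub]; apply: filterS ub => y hu Oy.
apply: le_trans (f_lip _ _) _; [exact/rho_norm/hu| |].
  by apply: rho_norm; rewrite normr0 ltW.
by rewrite subr0 ler_wpM2l// hu.
Qed.

Let Lfrho_ge0 : 0 <= Lf * rho. Proof. by rewrite mulr_ge0// ltW. Qed.

Lemma drive_bounded u x : in_ball u -> - drive_bound <= drive u x <= drive_bound.
Proof.
move=> bu; rewrite -ler_norml; apply: le_trans (ler_normD _ _) _.
have bh : 0 <= beta * h by rewrite mulr_ge0// ltW.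
rewrite (ger0_norm bh) lerD2r normrM gtr0_norm// ler_wpM2l ?(ltW beta_gt0)//.
apply: le_trans (ler_normD _ _) _; rewrite lerD2l.
apply: (KO_le_sup mO bO cJ J_ge0 J_int1) => //; first by apply: intg_fu; case: bu.
exact: fu_bound.
Qed.

Lemma reaction_bounded u x : in_ball u -> `|reaction u x| <= rho1.
Proof. by move=> bu; apply: g_rho1; exact: drive_bounded. Qed.

Let driveB u v x : intg u -> intg v -> drive u x - drive v x =
  beta * KO Omega J (fun y => f (u y) - f (v y)) x.
Proof.
move=> iu iv; rewrite /drive.
have -> : (fun y => f (u y) - f (v y)) =
    (fun y => (f (u y) - f 0) - (f (v y) - f 0)).
  by apply/funext => y; ring.
rewrite (KOB mO bO cJ J_ge0 x (intg_fu iu) (intg_fu iv)); ring.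
Qed.

Let intg_fuB u v : intg u -> intg v -> intg (fun y => f (u y) - f (v y)).
Proof.
move=> iu iv; have := intgB mO (intg_fu iu) (intg_fu iv).
rewrite (_ : (fun y => _ - _) = (fun y => f (u y) - f (v y)))//.
by apply/funext => y; ring.
Qed.

Definition reaction_lip := Lg * (beta * (CJ * Lf)).

Lemma reaction_lip_ge0 : 0 <= reaction_lip.
Proof. by rewrite /reaction_lip !mulr_ge0// ltW. Qed.

Lemma reaction_lipschitz u v x : in_ball u -> in_ball v -> Omega x ->
  `|reaction u x - reaction v x| <= reaction_lip * l1norm (fun y => u y - v y).
Proof.
move=> bu bv Ox; have [iu ub] := bu; have [iv vb] := bv.
apply: le_trans (g_lip (drive_bounded x bu) (drive_bounded x bv)) _.
rewrite driveB// normrM gtr0_norm// /reaction_lip -!mulrA.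
rewrite ler_wpM2l// ler_wpM2l ?(ltW beta_gt0)//.
apply: le_trans (KO_le_l1norm mO bO cJ J_ge0 J_CJ (intg_fuB iu iv) Ox) _.
rewrite ler_wpM2l// [l1norm (fun y => u y - v y)]/L1norm -RintegralZl//; last first.
  by apply/intg_norm/intgB.
apply: le_l1norm => //; first exact: intg_fuB.
  by apply/intgZ => //; apply/intg_norm/intgB.
exact: fu_lip.
Qed.

Definition reaction_modulus_cst := Lg * (beta * (Lf * rho * muO)).

Lemma reaction_modulus u x x' (e : R) : in_ball u ->
  (forall y, Omega y -> `|J x y - J x' y| <= e) -> 0 <= e ->
  `|reaction u x - reaction u x'| <= reaction_modulus_cst * e.
Proof.
move=> bu Je e0; have [iu ub] := bu.
apply: le_trans (g_lip (drive_bounded x bu) (drive_bounded x' bu)) _.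
rewrite /reaction_modulus_cst -!mulrA ler_wpM2l//.
rewrite (_ : drive u x - drive u x' = beta * (KO Omega J (fun y => f (u y) - f 0) x -
  KO Omega J (fun y => f (u y) - f 0) x')); last by rewrite /drive; ring.
rewrite normrM gtr0_norm// ler_wpM2l ?(ltW beta_gt0)//.
apply: le_trans (KO_modulus mO bO cJ J_ge0 (intg_fu iu) Je) _.
rewrite mulrC !mulrA ler_wpM2r//.
rewrite -(Rintegral_cst mu mO); apply: le_l1norm => //.
- exact: intg_fu.
- exact: intg_cst.
- exact: fu_bound.
Qed.

(** * Solutions in L^1 of the domain *)

Definition l1_solution (u : R -> 'rV[R]_N -> R) :=
  l1_relaxation mu Omega u (fun t => reaction (u t)).

Lemma l1_solution_shift (u : R -> 'rV[R]_N -> R) (t0 : R) : 0 <= t0 -> l1_solution u ->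
  l1_solution (fun t => u (t0 + t)).
Proof. exact: l1_relaxation_shift. Qed.

Definition inner_radius (s : R) := expR (- s) * rho + (1 - expR (- s)) * rho1.

Lemma inner_radius_bounds (s : R) : 0 < s ->
  [/\ 0 <= inner_radius s, inner_radius s < rho & rho1 <= inner_radius s].
Proof.
move=> s0; rewrite /inner_radius.
have e0 := expR_gt0 (- s).
have e1 : 0 < 1 - expR (- s) by rewrite subr_gt0 -[ltRHS]expR0 ltr_expR oppr_lt0.
have gap : 0 < rho - rho1 by rewrite subr_gt0.
have p1 := mulr_gt0 e1 gap; have p2 := mulr_gt0 e0 gap.
split; last 2 first; [by lra|by lra|].
by rewrite addr_ge0 ?mulr_ge0// ltW.
Qed.

Section one_solution.
Variable u : R -> 'rV[R]_N -> R.
Hypotheses (su : l1_solution u) (u0_ball : in_ball (u 0)).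

Let iu (t : R) : 0 <= t -> intg (u t). Proof. by case: su => + _ _; exact. Qed.

Let contract (t b : R) : 0 <= t ->
  (forall x, `|(u t x) - u 0 x - (1 - expR (- t)) * (0 - u 0 x)| <= (1 - expR (- t)) * b ->
   `|u 0 x| <= rho -> `|u t x| <= expR (- t) * rho + (1 - expR (- t)) * b).
Proof.
move=> t0 x.
have -> : (u t x) - u 0 x - (1 - expR (- t)) * (0 - u 0 x) = u t x - expR (- t) * u 0 x by ring.
move=> h1 h2; rewrite -[u t x](subrK (expR (- t) * u 0 x)) addrC.
apply: le_trans (ler_normD _ _) _; apply: lerD => //.
by rewrite normrM ger0_norm ?expR_ge0// ler_wpM2l ?expR_ge0.
Qed.

(** The comparison principle with [c = 0] and [b = rho]. *)
Lemma solution_ball (t : R) : 0 <= t -> in_ball (u t).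
Proof.
move=> t0; split; first exact: iu.
have := @relaxation_enclosure _ _ _ _ _ mO fO u (fun t => reaction (u t)) (cst 0) rho t su
  (intg_cst mO fO 0) (ltW rho_gt0) t0.
move=> /(_ _)/wrap[s s0 st|].
  by apply/aeW => x _; rewrite subr0; exact/ltW/g_lt_rho.
have [_ u0b] := u0_ball; apply: filterS2 u0b => x h1 h2 Ox.
have := contract t0 (h2 Ox) (h1 Ox); rewrite -mulrDl addrC subrK mul1r; exact.
Qed.

(** The comparison principle with [c = 0] and [b = rho1]: after any positive time
    the solution is bounded away from [rho], where [ginv] may be unbounded. *)
Lemma solution_smoothing (t : R) : 0 <= t -> {ae mu, forall x, Omega x ->
  `|u t x| <= expR (- t) * rho + (1 - expR (- t)) * rho1}.
Proof.
move=> t0.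
have := @relaxation_enclosure _ _ _ _ _ mO fO u (fun t => reaction (u t)) (cst 0) rho1 t su
  (intg_cst mO fO 0) rho1_ge0 t0.
move=> /(_ _)/wrap[s s0 st|].
  by apply/aeW => x _; rewrite subr0; apply: reaction_bounded; exact: solution_ball.
have [_ u0b] := u0_ball; apply: filterS2 u0b => x h1 h2 Ox.
exact: (contract t0 (h2 Ox) (h1 Ox)).
Qed.

Lemma solution_inner (s t : R) : 0 <= s -> 0 <= t ->
  {ae mu, forall x, Omega x -> `|u (s + t) x| <= inner_radius s}.
Proof.
move=> s0 t0; apply: filterS (solution_smoothing (addr_ge0 s0 t0)) => x hx Ox.
apply: le_trans (hx Ox) _; rewrite /inner_radius.
have : expR (- (s + t)) <= expR (- s) by rewrite ler_expR lerN2 lerDl.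
by move: rho1_lt; nra.
Qed.

Let one_minus_exp (t : R) : 1 - expR (- t) <= t.
Proof. by rewrite lerBlDr -lerBlDl expR_ge1Dx. Qed.

Lemma solution_lip_start (t : R) : 0 <= t -> {ae mu, forall x, Omega x ->
  `|u t x - u 0 x| <= 2 * rho * t}.
Proof.
move=> t0.
have := @relaxation_enclosure _ _ _ _ _ mO fO u (fun t => reaction (u t)) (cst 0) rho t su
  (intg_cst mO fO 0) (ltW rho_gt0) t0.
move=> /(_ _)/wrap[s s0 st|].
  by apply/aeW => x _; rewrite subr0; exact/ltW/g_lt_rho.
have [_ u0b] := u0_ball; apply: filterS2 u0b => x h1 h2 Ox.
move: (h2 Ox) (h1 Ox); set k := 1 - _.
have -> : (u t x) - u 0 x - k * (cst 0 x - u 0 x) = (u t x - u 0 x) + k * u 0 x.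
  by rewrite /cst; ring.
have [k0 k1] := andP (one_sub_expRN_itv t0); rewrite -/k in k0 k1.
have kt : k <= t by exact: one_minus_exp.
move=> a1 a2; rewrite -[_ - _](addrK (k * u 0 x)).
apply: le_trans (ler_normB _ _) _; rewrite normrM (ger0_norm k0).
have : k * `|u 0 x| <= k * rho by rewrite ler_wpM2l.
have : k * rho <= t * rho by rewrite ler_wpM2r// ltW.
by move: a1; lra.
Qed.

(** The comparison principle with [c] the field at time 0, from which the field
    along the solution deviates at most linearly in time. *)
Lemma solution_second_start (t : R) : 0 <= t -> {ae mu, forall x, Omega x ->
  `|u t x - u 0 x - (1 - expR (- t)) * (reaction (u 0) x - u 0 x)| <=
    reaction_lip * (2 * rho * muO) * t ^+ 2}.
Proof.
move=> t0; pose b := reaction_lip * (2 * rho * muO) * t.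
have rl := reaction_lip_ge0.
have C0 : 0 <= reaction_lip * (2 * rho * muO).
  by rewrite !mulr_ge0// ltW.
have b0 : 0 <= b by rewrite mulr_ge0.
have i0 := iu (lexx 0).
have := @relaxation_enclosure _ _ _ _ _ mO fO u (fun t => reaction (u t)) (reaction (u 0)) b t su
  (intg_reaction i0) b0 t0.
move=> /(_ _)/wrap[s s0 st|].
  apply/aeW => x Ox.
  apply: le_trans (reaction_lipschitz (solution_ball s0) u0_ball Ox) _.
  rewrite /b -mulrA ler_wpM2l// mulrAC.
  apply: (@le_trans _ _ (2 * rho * s * muO)); last first.
    by rewrite ler_wpM2r// ler_wpM2l ?(ltW st)// mulr_ge0// ltW.
  rewrite -(Rintegral_cst mu mO); apply: le_l1norm => //.
  - by apply: intgB => //; exact: iu.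
  - exact: intg_cst.
  - exact: solution_lip_start.
apply: filterS => x h2 Ox; apply: le_trans (h2 Ox) _.
apply: (@le_trans _ _ (t * b)); first by rewrite ler_wpM2r// one_minus_exp.
by rewrite /b expr2 mulrCA.
Qed.

End one_solution.

Section two_solutions.
Variables u v : R -> 'rV[R]_N -> R.
Hypotheses (su : l1_solution u) (u0_ball : in_ball (u 0)).
Hypotheses (sv : l1_solution v) (v0_ball : in_ball (v 0)).

Lemma solutions_l1_stable (t : R) : 0 <= t ->
  l1norm (fun x => u t x - v t x) <=
  expR (reaction_lip * muO * t) * l1norm (fun x => u 0 x - v 0 x).
Proof.
move=> t0; have rl := reaction_lip_ge0.
apply: (relaxation_gronwall mO (l1_relaxationB mO su sv)) => //.
  by rewrite mulr_ge0.
move=> s s0 _; rewrite mulrAC -(Rintegral_cst mu mO).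
have [bu bv] := (solution_ball su u0_ball s0, solution_ball sv v0_ball s0).
apply: le_l1norm => //.
- by apply: intgB => //; apply: intg_reaction; [case: bu|case: bv].
- exact: intg_cst.
- by apply/aeW => x Ox; exact: reaction_lipschitz.
Qed.

(** Gronwall's lemma controls the difference in [L^1], the operator turns this into
    a uniform bound on the difference of the fields, and the comparison principle
    then bounds the difference of the solutions almost everywhere. This pointwise
    form gives continuity in every [L^p] at once. *)
Lemma solutions_stable (t : R) : 0 <= t -> {ae mu, forall x, Omega x ->
  `|u t x - v t x| <= `|u 0 x - v 0 x| +
    reaction_lip * (expR (reaction_lip * muO * t) * l1norm (fun x => u 0 x - v 0 x))}.
Proof.
move=> t0; set b := reaction_lip * _.
have rl := reaction_lip_ge0.
have b0 : 0 <= b.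
  apply: mulr_ge0 => //; apply: mulr_ge0; first exact: expR_ge0.
  exact: l1norm_ge0.
have := @relaxation_enclosure _ _ _ _ _ mO fO _ _ (cst 0) b t (l1_relaxationB mO su sv)
  (intg_cst mO fO 0) b0 t0.
move=> /(_ _)/wrap[s s0 st|].
  have [bu bv] := (solution_ball su u0_ball s0, solution_ball sv v0_ball s0).
  apply/aeW => x Ox; rewrite subr0.
  apply: le_trans (reaction_lipschitz bu bv Ox) _.
  rewrite /b ler_wpM2l//; apply: le_trans (solutions_l1_stable s0) _.
  by rewrite ler_wpM2r ?l1norm_ge0// ler_expR ler_wpM2l ?(ltW st)// mulr_ge0.
apply: filterS => x hx Ox; move: (hx Ox); set k := 1 - _.
have [k0 k1] := andP (one_sub_expRN_itv t0); rewrite -/k in k0 k1.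
set w0 := u 0 x - v 0 x; set wt := u t x - v t x.
have -> : wt - w0 - k * (cst 0 x - w0) = wt - (1 - k) * w0.
  by rewrite /cst; ring.
move=> a1; rewrite -[wt](subrK ((1 - k) * w0)) addrC.
apply: le_trans (ler_normD _ _) _; apply: lerD.
  by rewrite normrM ger0_norm ?subr_ge0// ler_piMl// gerBl.
by apply: le_trans a1 _; rewrite ler_piMl.
Qed.

End two_solutions.


(** * Approximation of orbits by a compact family *)

Section orbit_approximation.

(** The modulus of continuity that the kernel imparts to every value of the field
    on the ball. *)
Definition kernel_modulus (x x' : 'rV[R]_N) (e : R) :=
  exists e', [/\ 0 <= e', reaction_modulus_cst * e' <= e &
    forall y, Omega y -> `|J x y - J x' y| <= e'].

Local Notation profiles := (bounded_modulus kernel_modulus rho).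

Let modulus_cst_ge0 : 0 <= reaction_modulus_cst.
Proof. by rewrite /reaction_modulus_cst mulr_ge0// mulr_ge0 ?(ltW beta_gt0)// mulr_ge0. Qed.

Lemma kernel_modulus_near x (e : R) : 0 < e ->
  \forall x' \near x, kernel_modulus x x' e.
Proof.
move=> e0; have d0 : 0 < e / (reaction_modulus_cst + 1).
  by rewrite divr_gt0// ltr_wpDl.
have := kernel_equicontinuous bO cJ x d0; apply: filterS => x' hx'.
exists (e / (reaction_modulus_cst + 1)); split => //; first exact: ltW.
by rewrite mulrCA ler_piMr ?(ltW e0)// ler_pdivrMr ?ltr_wpDl// mul1r lerDl.
Qed.

Lemma reaction_profile u : in_ball u -> profiles (reaction u).
Proof.
move=> bu; split => [x|x x' e [e' [e'0 e'e Je]]].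
  exact: le_trans (reaction_bounded x bu) (ltW rho1_lt).
exact: le_trans (reaction_modulus bu Je e'0) e'e.
Qed.

Lemma profile_continuous w : profiles w -> continuous w.
Proof.
move=> [_ wM] x; apply/(@cvgrPdist_le _ _ _ (nbhs x)) => e e0.
exact: (@filterS _ (nbhs x) (nbhs_filter x) _ _ (fun x' => wM x x' e)
  (kernel_modulus_near x e0)).
Qed.

(** Variation of constants discretized with a step [tau]: each step multiplies the
    error by [exp (- tau)] and adds [C * tau ^+ 2], so that the total error remains
    below [2 * C * tau], uniformly in time. Each step replaces the profile by a
    convex combination of itself and a value of the field, which preserves the
    common bound and modulus. *)
Lemma orbit_approximation (u : R -> 'rV[R]_N -> R) (t eta : R) :
  l1_solution u -> in_ball (u 0) -> 0 <= t -> 0 < eta ->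
  exists a w, [/\ 0 <= a <= 1, profiles w &
    {ae mu, forall x, Omega x -> `|u t x - (a * u 0 x + w x)| <= eta}].
Proof.
move=> su u0b t0 eta0.
pose C := reaction_lip * (2 * rho * muO).
have C0 : 0 <= C by rewrite !mulr_ge0 ?reaction_lip_ge0// ltW.
(* enough steps for [tau <= 1 / 2] and [2 * C * tau <= eta] *)
pose n := Num.truncn (2 * t + 2 * C * t / eta).
pose tau := t / n.+1%:R.
have n0 : 0 < n.+1%:R :> R by rewrite ltr0n.
have nE : 2 * t + 2 * C * t / eta < n.+1%:R by exact: truncnS_gt.
have Ct0 : 0 <= 2 * C * t / eta by rewrite divr_ge0 ?mulr_ge0// ltW.
have tau0 : 0 <= tau by rewrite divr_ge0// ltW.
have tau12 : tau <= 1 / 2 by rewrite ler_pdivrMr//; lra.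
have tau_eta : 2 * C * tau <= eta.
  have nE' : 2 * C * t / eta <= n.+1%:R by lra.
  have := ler_wpM2r (ltW eta0) nE'; rewrite divfK ?gt_eqF// => ?.
  by rewrite mulrA ler_pdivrMr// [leRHS]mulrC.
have k_tau : tau / 2 <= 1 - expR (- tau).
  have tau1 : tau <= 1 by lra.
  by have /andP[_] := expRN_bounds tau0 tau1; rewrite expr2; nra.
have [kap0 kap1] := andP (one_sub_expRN_itv tau0).
have step (k : nat) : exists a w, [/\ 0 <= a <= 1, profiles w &
    {ae mu, forall x, Omega x -> `|u (k%:R * tau) x - (a * u 0 x + w x)| <= 2 * C * tau}].
  elim: k => [|k [a [w [/andP[a0 a1] [wr wM] ih]]]].
    exists 1, (cst 0); split; first by rewrite lexx ler01.
      split=> [x|x x' e [e' [e'0 e'e _]]]; first by rewrite normr0 ltW.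
      by rewrite subrr normr0; apply: le_trans e'e; rewrite mulr_ge0.
    apply/aeW => x _; rewrite mul0r mul1r addr0 subrr normr0.
    by apply: mulr_ge0 => //; exact: mulr_ge0.
  have kt0 : 0 <= k%:R * tau by rewrite mulr_ge0.
  have ukb := solution_ball su u0b kt0.
  pose F := reaction (u (k%:R * tau)).
  have [Fr FM] : profiles F by exact: reaction_profile.
  pose kap := 1 - expR (- tau).
  have e0 : 0 <= 1 - kap by rewrite /kap opprB addrC subrK expR_ge0.
  exists ((1 - kap) * a), (fun x => (1 - kap) * w x + kap * F x); split.
  - by rewrite mulr_ge0//= mulr_ile1// gerBl.
  - split=> [x|x x' e xx'].
      apply: le_trans (ler_normD _ _) _; rewrite !normrM (ger0_norm e0) (ger0_norm kap0).
      by have := ler_wpM2l e0 (wr x); have := ler_wpM2l kap0 (Fr x); rewrite -/kap; lra.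
    rewrite (_ : _ - _ = (1 - kap) * (w x - w x') + kap * (F x - F x')); last by ring.
    apply: le_trans (ler_normD _ _) _; rewrite !normrM (ger0_norm e0) (ger0_norm kap0).
    by have := ler_wpM2l e0 (wM _ _ _ xx'); have := ler_wpM2l kap0 (FM _ _ _ xx');
      rewrite -/kap; lra.
  have su' := l1_solution_shift kt0 su.
  have u0b' : in_ball (u (k%:R * tau + 0)) by rewrite addr0.
  have := solution_second_start su' u0b' tau0; rewrite addr0 -/F => sec.
  have -> : k.+1%:R * tau = k%:R * tau + tau by rewrite -natr1 mulrDl mul1r.
  apply: filterS2 sec ih => x h1 h2 Ox; have {}h1 := h1 Ox; have {}h2 := h2 Ox.
  move: h1; rewrite -/kap -/C => h1.
  set y := u (k%:R * tau + tau) x in h1 *; set z := u (k%:R * tau) x in h1 h2.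
  rewrite (_ : y - _ = (y - z - kap * (F x - z)) + (1 - kap) * (z - (a * u 0 x + w x)));
    last by ring.
  apply: le_trans (ler_normD _ _) _; rewrite normrM (ger0_norm e0).
  have := ler_wpM2l e0 h2; rewrite -/kap in k_tau.
  have : C * tau * (tau / 2) <= C * tau * kap by rewrite ler_wpM2l// mulr_ge0.
  by move: h1; rewrite expr2; nra.
have [a [w [a01 wP near_u]]] := step n.+1.
exists a, w; split => //; apply: filterS near_u => x hx Ox.
have E : n.+1%:R * tau = t by rewrite /tau mulrC divfK// gt_eqF.
by move: (hx Ox); rewrite E => /le_trans; apply.
Qed.

End orbit_approximation.

(** * The semigroup on the ball of L^p *)

Section phase_flow.
Variables (p : \bar R) (p1 : (1 <= p)%E).
Local Notation Lp := (LspaceType mu p1).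
Local Notation DD := (phase_ball Omega p1 rho).

(** The indicator carries the support condition, so that [closed_dominated] and
    [Lnorm_le_bound] apply to the ball. *)
Lemma phase_ballE : DD = [set a : Lp | {ae mu, forall x, `|a x| <= rho * \1_Omega x}].
Proof.
apply/seteqP; split => a.
  move=> [a0 /(Lnorm_infty_leP mu _ (ltW rho_gt0)) ar].
  apply: filterS2 a0 ar => x h1 h2; rewrite indicE.
  have [Ox|Ox] := boolP (x \in Omega); first by rewrite mulr1.
  by rewrite h1 ?normr0 ?mulr0// => Ox'; rewrite mem_set in Ox.
move=> ar; split.
  apply: filterS ar => x hx Ox; apply/normr0_eq0/eqP.
  by rewrite eq_le normr_ge0 andbT (le_trans hx)// indicE memNset// mulr0.
apply/(Lnorm_infty_leP mu _ (ltW rho_gt0)); apply: filterS ar => x /le_trans; apply.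
by rewrite ler_piMr ?(ltW rho_gt0)// indicE; case: (_ \in _).
Qed.

Lemma phase_ballP (a : Lp) : DD a <-> phase_space Omega a /\ in_ball a.
Proof.
split.
  move=> /[dup] [[a0 _]]; rewrite phase_ballE => ar; split => //; split.
    exact: (intg_Lspace mO fO a).
  by apply: filterS ar => x hx Ox; rewrite (le_trans hx)// indicE mem_set// mulr1.
move=> [a0 [_ ar]]; rewrite phase_ballE /=; apply: filterS2 a0 ar => x h1 h2.
rewrite indicE; have [Ox|Ox] := boolP (x \in Omega).
  by rewrite mulr1 h2//; exact: set_mem.
by rewrite h1 ?normr0 ?mulr0// => Ox'; rewrite mem_set in Ox.
Qed.

Lemma closed_phase_ball : closed DD.
Proof.
rewrite phase_ballE; apply: closed_dominated.
by apply: measurable_funM => //; exact: measurable_indic.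
Qed.

Lemma measurable_Fop (a : Lp) : phase_space Omega a ->
  measurable_fun setT (Fop Omega J f g beta h a).
Proof.
move=> a0; have ia := intg_Lspace mO fO a.
have -> : Fop Omega J f g beta h a = (fun x => reaction a x * \1_Omega x).
  apply/funext => x; rewrite indicE; have [Ox|Ox] := boolP (x \in Omega).
    by rewrite mulr1 Fop_reaction//; [exact: measurable_Lspace|exact: set_mem].
  by rewrite /Fop (negbTE Ox) mulr0.
by apply: measurable_funM; [exact: measurable_reaction|exact: measurable_indic].
Qed.

(** The [L^p] norm controls the [L^1] norm on the domain, so the difference
    quotients also converge in [L^1]; multiplying by [s - t] gives the increments. *)
Lemma global_solution_l1 (a : Lp) (u : R -> Lp) :
  global_solution Omega J f g beta h a u -> l1_solution (fun t => u t).
Proof.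
move=> [_ u_ph u'].
have iu t : intg (u t) by exact: (intg_Lspace mO fO (u t)).
split => [t _|t t0|t e t0 e0]; [exact: iu|exact/intg_reaction/iu|].
have [C C0 HC] := l1norm_le_Lnorm mO fO p1.
have eC0 : 0 < e / (C + 1) by rewrite divr_gt0// ltr_wpDl.
have nb : nbhs (0%E : \bar R) [set y | (y < (e / (C + 1))%:E)%E].
  apply: open_nbhs_nbhs; split; first exact: open_ereal_lt_ereal.
  by rewrite /= lte_fin.
have near_t := u' t t0 _ nb.
have /nbhs_ballP[r /= r0 Hr] : nbhs t [set s | s != t -> 0 <= s ->
    ('N[mu]_p[EFin \o (fun x => (s - t)^-1 * (u s x - u t x) -
      (- u t x + Fop Omega J f g beta h (u t) x))%R] < (e / (C + 1))%:E)%E].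
  exact: near_t.
exists r => // s s0 st; have [->|s_t] := eqVneq s t.
  rewrite (_ : l1norm _ = 0) ?subrr ?normr0 ?mulr0//.
  rewrite /L1norm (@eq_Rintegral _ _ _ _ _ (cst 0)) ?Rintegral_cst ?mul0r// => x _.
  by rewrite !subrr mul0r subrr normr0.
have {}Hr := Hr s; rewrite /= -ball_normE /= distrC in Hr; have {}Hr := Hr st s_t s0.
set q := (fun x => _) in Hr.
have mq : measurable_fun setT q.
  by apply: measurable_funB; [apply: measurable_funM => //; apply: measurable_funB|
    apply: measurable_funD; [apply: measurable_funN|apply: measurable_Fop; exact: u_ph]];
    exact: measurable_Lspace.
have [iq lq] := HC q mq (lt_le_trans Hr (leey _)).
have qe : l1norm q <= e.
  apply: le_trans lq _; apply: (@le_trans _ _ (C * (e / (C + 1)))).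
    rewrite ler_wpM2l// -lee_fin fineK ?ltW//.
    by rewrite ge0_fin_numE ?Lnorm_ge0// (lt_le_trans Hr)// leey.
  by rewrite mulrCA ler_piMr ?(ltW e0)// ler_pdivrMr ?ltr_wpDl// mul1r lerDl.
have -> : l1norm (fun x => u s x - u t x - (s - t) * (reaction (u t) x - u t x)) =
    l1norm (fun x => (s - t) * q x).
  apply: eq_Rintegral => x; rewrite inE => Ox; congr `| _ |; rewrite /q.
  rewrite Fop_reaction//; [|exact: measurable_Lspace|exact: u_ph].
  rewrite [RHS]mulrBr mulrA mulfV ?subr_eq0// mul1r; congr (_ - _ * _).
  by rewrite addrC.
by rewrite l1normZ// mulrC ler_wpM2r.
Qed.

Definition phase_solution (u : R -> Lp) :=
  [/\ l1_solution (fun t => u t), in_ball (u 0) &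
      forall t, 0 <= t -> phase_space Omega (u t)].

Lemma phase_solution_ball (u : R -> Lp) (t : R) : phase_solution u -> 0 <= t -> DD (u t).
Proof.
by move=> [su u0 uph] t0; apply/phase_ballP; split; [exact: uph|exact: (solution_ball su u0)].
Qed.

Lemma phase_solution_shift (u : R -> Lp) (s : R) : 0 <= s -> phase_solution u ->
  phase_solution (fun t => u (s + t)).
Proof.
move=> s0 [su u0 uph]; split.
- exact: (l1_solution_shift s0 su).
- by rewrite addr0; exact: (solution_ball su u0).
- by move=> t t0; apply: uph; rewrite addr_ge0.
Qed.

Let dominated_indic (a b : Lp) (phi : 'rV[R]_N -> R) : phase_space Omega a -> phase_space Omega b ->
  (forall x, 0 <= phi x) -> {ae mu, forall x, Omega x -> `|a x - b x| <= phi x} ->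
  {ae mu, forall x, `|a x - b x| <= phi x * \1_Omega x}.
Proof.
move=> a0 b0 phi0 ab; apply: filterS3 a0 b0 ab => x ha hb hab; rewrite indicE.
have [Ox|Ox] := boolP (x \in Omega); first by rewrite mulr1 hab//; exact: set_mem.
have {}Ox : ~ Omega x by move=> Ox'; rewrite mem_set in Ox.
by rewrite ha// hb// subrr normr0 mulr0.
Qed.

Lemma phase_solution_time_lipschitz : exists2 C : R, 0 <= C & forall (u : R -> Lp) (s t : R),
  phase_solution u -> 0 <= s -> 0 <= t -> mdist (u s) (u t) <= C * `|s - t|.
Proof.
have [C C0 HC] := @mdist_le_indic _ _ _ mu _ mO fO _ p1.
exists (C * (2 * rho)); first by rewrite !mulr_ge0// ltW.
have le_st (u : R -> Lp) (s t : R) : phase_solution u -> 0 <= s -> s <= t ->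
    mdist (u t) (u s) <= C * (2 * rho) * (t - s).
  move=> pu s0 st; rewrite -mulrA.
  have ts0 : 0 <= t - s by rewrite subr_ge0.
  have [ss ss0 ssph] := phase_solution_shift s0 pu.
  have rts : 0 <= 2 * rho * (t - s) by rewrite !mulr_ge0// ltW.
  have := solution_lip_start ss ss0 ts0; rewrite addr0 addrC subrK => h1.
  apply: HC => //; apply: dominated_indic => //; case: pu => _ _; apply => //.
  exact: le_trans st.
move=> u s t pu s0 t0; have [st|/ltW ts] := leP s t.
  by rewrite metric_sym distrC ger0_norm ?subr_ge0//; exact: le_st.
by rewrite ger0_norm ?subr_ge0//; exact: le_st.
Qed.

Lemma phase_solution_stable : exists2 C : R, 0 <= C & forall (u v : R -> Lp) (t : R),
  phase_solution u -> phase_solution v -> 0 <= t ->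
  mdist (u t) (v t) <=
    (1 + C * expR (reaction_lip * muO * t)) * mdist (u 0) (v 0).
Proof.
have [C C0 HC] := @mdist_le_add _ _ _ mu _ mO fO _ p1.
have [C' C'0 HC'] := @l1norm_le_mdist _ _ _ mu _ mO fO _ p1.
have rl := reaction_lip_ge0.
exists (C * (reaction_lip * C')); first by rewrite mulr_ge0// mulr_ge0.
move=> u v t [su u0 uph] [sv v0 vph] t0.
set E := expR _; have E0 : 0 <= E by exact: expR_ge0.
pose M := reaction_lip * (E * l1norm (fun x => u 0 x - v 0 x)).
have M0 : 0 <= M by rewrite mulr_ge0// mulr_ge0// l1norm_ge0.
have := HC (u 0) (v 0) (u t) (v t) M M0 => /(_ _)/wrap[].
  have := solutions_stable su u0 sv v0 t0; rewrite -/E -/M => st.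
  have := dominated_indic (uph _ t0) (vph _ t0) (fun x => addr_ge0 (normr_ge0 _) M0) st.
  apply: filterS => x /le_trans; apply; rewrite mulrDl lerD2r.
  by rewrite ler_piMr// indicE; case: (_ \in _).
move=> /le_trans; apply; rewrite mulrDl mul1r lerD2l.
have [_ h2] := HC' (u 0) (v 0).
rewrite (_ : C * (reaction_lip * C') * E * mdist (u 0) (v 0) =
  C * (reaction_lip * (E * (C' * mdist (u 0) (v 0))))); last by ring.
by do 3 (apply: ler_wpM2l => //).
Qed.

Lemma phase_solution_unique (u v : R -> Lp) (t : R) : phase_solution u -> phase_solution v ->
  u 0 = v 0 -> 0 <= t -> u t = v t.
Proof.
move=> pu pv uv0 t0; have [C C0 HC] := phase_solution_stable.
have := HC u v t pu pv t0; rewrite uv0 mdistxx mulr0 => h1.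
by apply/mdist_positivity/eqP; rewrite eq_le h1 mdist_ge0.
Qed.

(** By [orbit_approximation] the orbit lies in the closure of the image of the
    product of [[0, 1]] and the compact class of profiles under the map sending
    [(a, w)] to [a u(0) + w] on the domain. This map is continuous into [L^p] because
    pointwise convergence of profiles is uniform on the domain, so the image
    is compact, hence closed. *)
Lemma phase_orbit_precompact (u : R -> Lp) : phase_solution u ->
  compact (DD `&` closure [set v | exists2 t, 0 <= t & v = u t]).
Proof.
move=> pu; have [su u0b uph] := pu; have u0ph := uph 0 (lexx 0).
pose profiles : set {ptws 'rV[R]_N -> R} := bounded_modulus kernel_modulus rho.
pose S : set (R * {ptws 'rV[R]_N -> R}) := `[0, 1]%classic `*` profiles.
pose blend (z : R * {ptws 'rV[R]_N -> R}) x := (z.1 * u 0 x + z.2 x) * \1_Omega x.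
pose rep z : set Lp := [set v : Lp | (v : 'rV[R]_N -> R) = blend z %[ae mu]].
pose mk z : Lp := xget (u 0) (rep z).
have [C C0 HC] := @mdist_le_indic _ _ _ mu _ mO fO _ p1.
have u0r : {ae mu, forall x, Omega x -> `|u 0 x| <= rho} by case: u0b.
have mkP z : S z -> {ae mu, forall x, mk z x = blend z x}.
  move=> [/=]; rewrite in_itv/= => /andP[z0 z1] zP.
  suff [v vP] : exists v : Lp, rep z v.
    have : rep z (mk z) := xgetI (u 0) vP.
    by apply: filterS => x; exact.
  have mb : measurable_fun setT (blend z).
    apply: measurable_funM; last exact: measurable_indic.
    apply: measurable_funD; last exact: (continuous_measurable_rV (profile_continuous zP)).
    by apply: measurable_funM => //; exact: measurable_Lspace.
  apply: Lspace_representative => //.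
  have [C1 C10 HC1] := Lnorm_le_bound mO fO p1.
  have rho2 : 0 <= 2 * rho by rewrite mulr_ge0// ltW.
  apply: (le_lt_trans (HC1 _ _ mb rho2 _)); last exact: ltry.
  apply: filterS u0r => x hx; rewrite /blend indicE.
  have [Ox|Ox] := boolP (x \in Omega); last by rewrite !mulr0 normr0.
  rewrite !mulr1; apply: le_trans (ler_normD _ _) _.
  rewrite mulrDl mul1r; apply: lerD; last by case: zP => + _; exact.
  rewrite normrM (ger0_norm z0) -[leRHS]mul1r; apply: ler_pM => //.
  exact/hx/set_mem.
have [Q cQ OQ] := bounded_subset_compact bO.
have mk_continuous : {within S, continuous mk}.
  apply/subspace_continuousP => -[a0 w0] Sz0 A /nbhs_mdistP[e e0 eA].
  pose eta := e / 2 / (C + 1).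
  have eta0 : 0 < eta by rewrite !divr_gt0// ltr_wpDl.
  have [/= _ w0P] := Sz0.
  exists ([set a : R | `|a0 - a| < eta / rho],
      [set w : {ptws 'rV[R]_N -> R} | profiles w -> forall x, Q x -> `|w0 x - w x| <= eta]).
    split => /=; first by apply/nbhs_normP; exists (eta / rho) => //=; rewrite divr_gt0.
    exact: (bounded_modulus_uniform kernel_modulus_near cQ w0P eta0).
  move=> [a w] [/= aa ww] Sz; apply: eA; have [/= _ wP] := Sz.
  rewrite ltr_pdivlMr// in aa.
  have eta20 : 0 <= 2 * eta by rewrite mulr_ge0// ltW.
  have h1 : mdist (mk (a0, w0)) (mk (a, w)) <= C * (2 * eta).
    apply: HC => //; apply: filterS3 (mkP _ Sz0) (mkP _ Sz) u0r => x -> -> hx.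
    rewrite /blend/= indicE.
    have [Ox|Ox] := boolP (x \in Omega); last by rewrite !mulr0 subrr normr0.
    rewrite !mulr1 (_ : _ - _ = (a0 - a) * u 0 x + (w0 x - w x)); last by ring.
    apply: le_trans (ler_normD _ _) _; rewrite mulr_natl mulr2n; apply: lerD.
      rewrite normrM; apply: le_trans (ltW aa); rewrite ler_wpM2l//.
      exact/hx/set_mem.
    exact/ww/OQ/set_mem.
  apply: le_lt_trans h1 _; have E : eta * (C + 1) = e / 2.
    by rewrite /eta divfK// gt_eqF// ltr_wpDl.
  by move: E eta0; nra.
have cK : compact (mk @` S).
  apply: continuous_compact => //; apply: compact_setX; first exact: segment_compact.
  exact: compact_bounded_modulus.
have closedK : closed (mk @` S) by exact: compact_closed (@metric_hausdorff _ _) cK.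
have orbitK : [set v | exists2 t, 0 <= t & v = u t] `<=` mk @` S.
  move=> _ [t t0 ->]; apply: closedK => A /nbhs_mdistP[e e0 eA].
  have eta0 : 0 < e / (C + 1) by rewrite divr_gt0// ltr_wpDl.
  have [a [w [a01 wP uw]]] := orbit_approximation su u0b t0 eta0.
  have Sz : S (a, w) by split => //=; rewrite in_itv.
  exists (mk (a, w)); split; first by exists (a, w).
  apply: eA; apply: (@le_lt_trans _ _ (C * (e / (C + 1)))); last first.
    by rewrite mulrCA gtr_pMr// ltr_pdivrMr ?ltr_wpDl// mul1r ltrDl.
  apply: HC; first exact: ltW.
  apply: filterS3 (mkP _ Sz) (uph t t0) uw => x -> h1 h2; rewrite /blend/= indicE.
  have [Ox|Ox] := boolP (x \in Omega); first by rewrite !mulr1; exact/h2/set_mem.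
  have {}Ox : ~ Omega x by move=> Ox'; rewrite mem_set in Ox.
  by rewrite h1// !mulr0 subrr normr0.
apply: (subclosed_compact _ cK).
  by apply: closedI; [exact: closed_phase_ball|exact: closed_closure].
move=> v [_ vc]; apply: closedK; exact: (closure_subset orbitK).
Qed.

Section semigroup.
Variable T : R -> Lp -> Lp.
Hypothesis T_flow : generates_flow Omega J f g beta h T.

Lemma flow_phase_solution a : DD a -> phase_solution (T ^~ a).
Proof.
move=> /phase_ballP[a0 ba]; have sol := T_flow a0.
have su := global_solution_l1 sol; have [Ta ph _] := sol.
by split => //=; rewrite Ta.
Qed.

Lemma flow0 a : DD a -> T 0 a = a.
Proof. by move=> /phase_ballP[a0 _]; have [] := T_flow a0. Qed.

Lemma flow_invariant (t : R) a : 0 <= t -> DD a -> DD (T t a).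
Proof. by move=> t0 Da; exact: (phase_solution_ball (flow_phase_solution Da)). Qed.

Lemma flowD (s t : R) a : 0 <= s -> 0 <= t -> DD a -> T (s + t) a = T s (T t a).
Proof.
move=> s0 t0 Da; have Dt := flow_invariant t0 Da.
have := phase_solution_unique (phase_solution_shift t0 (flow_phase_solution Da))
  (flow_phase_solution Dt) _ s0.
by rewrite addr0 (flow0 Dt) addrC; exact.
Qed.

Lemma flow_continuous :
  {within [set z : R * Lp | 0 <= z.1 /\ DD z.2], continuous (fun z => T z.1 z.2)}.
Proof.
apply/subspace_continuousP => -[t0 a] /= [t00 Da].
have [C C0 HC] := phase_solution_stable.
have [C' C'0 HC'] := phase_solution_time_lipschitz.
pose K := 1 + C * expR (reaction_lip * muO * (t0 + 1)).
have K0 : 0 <= K by rewrite addr_ge0// mulr_ge0// expR_ge0.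
move=> A /nbhs_mdistP[e e0 eA].
exists ([set t | `|t0 - t| < Num.min 1 (e / 2 / (C' + 1))],
        [set b | mdist a b < e / 2 / (K + 1)]).
  split => /=.
    apply/nbhs_normP; exists (Num.min 1 (e / 2 / (C' + 1))) => //=.
    by rewrite lt_min ltr01 !divr_gt0// ltr_wpDl.
  by apply/nbhs_mdistP; exists (e / 2 / (K + 1)); rewrite ?divr_gt0// ltr_wpDl.
move=> [t b] /= [tt ab] [t_ge0 Db]; apply: eA.
move: tt; rewrite lt_min => /andP[t1 t2].
rewrite ltr_pdivlMr ?ltr_wpDl// in t2; rewrite ltr_pdivlMr ?ltr_wpDl// in ab.
have h1 := HC' _ t0 t (flow_phase_solution Da) t00 t_ge0.
have h2 := HC _ _ t (flow_phase_solution Da) (flow_phase_solution Db) t_ge0.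
rewrite (flow0 Da) (flow0 Db) in h2.
have d0 := mdist_ge0 a b.
have h3 : (1 + C * expR (reaction_lip * muO * t)) * mdist a b <= K * mdist a b.
  rewrite ler_wpM2r// lerD2l ler_wpM2l// ler_expR ler_wpM2l//.
    exact: mulr_ge0 reaction_lip_ge0 muO_ge0.
  by move: t1; rewrite distrC => /ltr_distlDr/ltW.
have h4 : C' * `|t0 - t| <= `|t0 - t| * (C' + 1).
  by rewrite mulrDr mulr1 mulrC lerDl.
have h5 := metric_triangle (T t0 a) (T t a) (T t b).
move: ab; rewrite mulrDr mulr1 => ab.
have := mdist_ge0 a b; move: h1 h2 h3 h4 h5 ab t2; nra.
Qed.

Lemma flow_semigroup : semigroup_on DD T.
Proof.
split; [exact: flow_invariant|exact: flow0|exact: flowD|exact: flow_continuous].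
Qed.

End semigroup.

End phase_flow.

(** * The Lyapunov functional *)

Section energy.
Variables (ginv PF : R -> R) (sg : R).
Hypotheses (J_sym : forall x y, J x y = J y x)
  (sg1 : `|sg| = 1)
  (f_incr : forall x y : R, x < y -> f x < f y)
  (f_derivable : forall x : R, derivable f x 1)
  (f'_gt0 : forall x, 0 < derive1 f x)
  (gK : cancel g ginv)
  (ginv_cont : forall x : R, - rho < x < rho -> {for x, continuous ginv})
  (sg_ginv : forall x y : R, - rho < x -> x <= y -> y < rho ->
    sg * ginv x <= sg * ginv y)
  (ginv_inj : forall x y : R, - rho < x < rho -> - rho < y < rho ->
    ginv x = ginv y -> x = y)
  (PF_cont : {within `[- rho, rho], continuous PF})
  (PF_convex : forall a b : R, - rho < a < rho -> - rho < b < rho ->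
    sg * (PF b - PF a) <= sg * ginv b * (f b - f a)).

Local Notation Int phi := (\int[mu]_(x in Omega) phi x).

Let fc x := f (clamp rho x).
Let Pc x := PF (clamp rho x).

Let cfc : continuous fc.
Proof. by move=> x; apply: continuous_comp; [exact: clamp_continuous|exact: cf]. Qed.

Let cPc : continuous Pc.
Proof. by apply: clamp_continuous_comp PF_cont; exact: ltW. Qed.

Definition excess u y := fc (u y) - f 0.

(** With [v = f u - f 0], the free energy
    [- 1/2 v K v - (f 0 + h) v + beta^-1 P(u)] integrated over the domain, [P] being
    the potential. Subtracting [f 0] makes [v] vanish off the domain; [f 0]
    reappears in the linear term. The sign [sg] is that of the monotonicity
    of [ginv], so that the functional decreases also when [g] is
    decreasing. Clamping extends it to all measurable functions without changing
    its values on the ball. *)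
Definition energy u := sg * (- (1 / 2) * Int (fun x => excess u x * KO Omega J (excess u) x)
  - (f 0 + h) * Int (excess u) + beta^-1 * Int (Pc \o u)).

Let M := Lf * rho.

Let zero_itv : - rho <= 0 <= rho.
Proof. by rewrite oppr_le0 (ltW rho_gt0). Qed.

Let excess_bound u x : `|excess u x| <= M.
Proof.
have cx := clamp_itv (u x) (ltW rho_gt0).
apply: le_trans (f_lip cx zero_itv) _; rewrite subr0 ler_wpM2l//.
by rewrite ler_norml.
Qed.

Let measurable_excess u : measurable_fun setT u -> measurable_fun setT (excess u).
Proof.
move=> m_u; apply: measurable_funB => //.
exact: (measurableT_comp (continuous_measurable_fun cfc)).
Qed.

Let bounded_intg (phi : 'rV[R]_N -> R) (B : R) : measurable_fun setT phi -> (forall x, `|phi x| <= B) ->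
  intg phi.
Proof.
move=> mphi bphi; apply: (@intg_bounded _ _ _ _ _ mO fO _ B); last exact/aeW.
exact: measurable_funTS.
Qed.

Let intg_excess u : measurable_fun setT u -> intg (excess u).
Proof. by move=> m_u; apply: (@bounded_intg _ M) => //; exact: measurable_excess. Qed.

Let Pc_bounded : exists2 B : R, 0 < B & forall x, `|Pc x| <= B.
Proof.
have [B B0 HB] := compact_prod_bounded (@segment_compact _ (- rho) rho) cPc.
exists B => // x; have cx := clamp_itv x (ltW rho_gt0).
rewrite /Pc -[clamp rho x](clamp_id cx); apply: HB.
by rewrite /= in_itv.
Qed.

Let intg_Pc u : measurable_fun setT u -> intg (Pc \o u).
Proof.
move=> m_u; have [B B0 HB] := Pc_bounded.
apply: (@bounded_intg _ B) => [|x]; last exact: HB.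
exact: (measurableT_comp (continuous_measurable_fun cPc)).
Qed.

Let KO_bound (v : 'rV[R]_N -> R) (B : R) x : 0 <= B -> measurable_fun setT v -> (forall x, `|v x| <= B) ->
  `|KO Omega J v x| <= B.
Proof.
move=> B0 mv vB; apply: (KO_le_sup mO bO cJ J_ge0 J_int1) => //.
  exact: bounded_intg vB.
exact/aeW.
Qed.

Let intg_MKO (v w : 'rV[R]_N -> R) (B B' : R) : measurable_fun setT v -> (forall x, `|v x| <= B) ->
  measurable_fun setT w -> (forall x, `|w x| <= B') -> 0 <= B' ->
  intg (fun x => v x * KO Omega J w x).
Proof.
move=> mv vB mw wB B'0; apply: (@bounded_intg _ (B * B')).
  apply: measurable_funM => //; apply: (measurable_KO mO bO cJ J_ge0).
  exact: bounded_intg wB.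
by move=> x; rewrite normrM; apply: ler_pM => //; exact: KO_bound.
Qed.

Let KO_excess u x : measurable_fun setT u -> in_ball u ->
  KO Omega J (fun y => f (u y) - f 0) x = KO Omega J (excess u) x.
Proof.
move=> m_u [iu ub]; congr fine; apply: ae_eq_integral => //.
- by apply: (measurable_int mu); apply: intg_kernelM => //; exact: intg_fu.
- by apply: (measurable_int mu); apply: intg_kernelM => //; exact: intg_excess.
- apply: filterS ub => y hy Oy; rewrite /excess /fc clamp_id//.
  by apply: rho_norm; exact: hy.
Qed.

(** First-order part of the integrand of the increment of the energy, [drive]
    being the argument of [g] in the field. Its derivative in [u1 x] at [u0 x] is
    [sg * (ginv (u0 x) - drive u0 x)] times [f' (u0 x)]. *)
Definition dissipation u0 u1 x :=
  sg * (Pc (u1 x) - Pc (u0 x)) - sg * drive u0 x * (fc (u1 x) - fc (u0 x)).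

Let M_ge0 : 0 <= M. Proof. exact: Lfrho_ge0. Qed.

Let measurable_drive u : intg u -> measurable_fun setT (drive u).
Proof.
move=> iu; apply: measurable_funD => //; apply: measurable_funM => //.
apply: measurable_funD => //; apply: (measurable_KO mO bO cJ J_ge0).
exact: intg_fu.
Qed.

Lemma intg_dissipation u0 u1 : measurable_fun setT u0 -> measurable_fun setT u1 ->
  in_ball u0 -> intg (dissipation u0 u1).
Proof.
move=> m0 m1 b0; apply: intgB => //.
  by apply: intgZ => //; apply: intgB => //; exact: intg_Pc.
rewrite (_ : (fun x => _) = (fun x => sg * (drive u0 x * (fc (u1 x) - fc (u0 x)))));
  last by apply/funext => x; rewrite mulrA.
apply: intgZ => //.
apply: (@bounded_intg _ (drive_bound * (M + M))).
  apply: measurable_funM; first by apply: measurable_drive; case: b0.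
  by apply: measurable_funB; apply: (measurableT_comp (continuous_measurable_fun cfc)).
move=> x; rewrite normrM; apply: ler_pM => //.
  by have := drive_bounded x b0; rewrite -ler_norml.
rewrite (_ : fc (u1 x) - fc (u0 x) = excess u1 x - excess u0 x); last first.
  by rewrite /excess; ring.
by apply: le_trans (ler_normB _ _) (lerD _ _); exact: excess_bound.
Qed.

(** Expanding the quadratic term around [u0]: the cross terms agree by symmetry of
    the operator and combine with the linear term into [drive u0]. *)
Lemma energyB u0 u1 : measurable_fun setT u0 -> measurable_fun setT u1 -> in_ball u0 ->
  let dv x := excess u1 x - excess u0 x in
  energy u1 - energy u0 = beta^-1 * Int (dissipation u0 u1)
    - sg / 2 * Int (fun x => dv x * KO Omega J dv x).
Proof.
move=> m0 m1 b0 dv.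
have mv0 := measurable_excess m0; have mv1 := measurable_excess m1.
have mdv : measurable_fun setT dv by exact: measurable_funB.
have dvB x : `|dv x| <= M + M.
  by apply: le_trans (ler_normB _ _) (lerD _ _); exact: excess_bound.
have MM0 : 0 <= M + M by rewrite addr_ge0.
have iv0 := intg_excess m0; have iv1 := intg_excess m1.
have idv : intg dv by exact: intgB.
pose v0 := excess u0; pose v1 := excess u1.
have K1 x : KO Omega J v1 x = KO Omega J v0 x + KO Omega J dv x.
  by rewrite (KOB mO bO cJ J_ge0 x iv1 iv0) addrC subrK.
have i00 : intg (fun x => v0 x * KO Omega J v0 x).
  exact: (intg_MKO mv0 (excess_bound u0) mv0 (excess_bound u0)).
have i0d : intg (fun x => v0 x * KO Omega J dv x).
  exact: (intg_MKO mv0 (excess_bound u0) mdv dvB).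
have id0 : intg (fun x => dv x * KO Omega J v0 x).
  exact: (intg_MKO mdv dvB mv0 (excess_bound u0)).
have idd : intg (fun x => dv x * KO Omega J dv x).
  exact: (intg_MKO mdv dvB mdv dvB).
have sym : Int (fun x => v0 x * KO Omega J dv x) = Int (fun x => dv x * KO Omega J v0 x).
  exact: (KO_sym mO bO cJ J_ge0 J_sym mdv mv0 (fun x _ => dvB x)
     (fun x _ => excess_bound u0 x)).
have quad : Int (fun x => v1 x * KO Omega J v1 x) = Int (fun x => v0 x * KO Omega J v0 x)
   + 2 * Int (fun x => dv x * KO Omega J v0 x) + Int (fun x => dv x * KO Omega J dv x).
  rewrite (_ : (fun x => v1 x * KO Omega J v1 x) = (fun x =>
     (v0 x * KO Omega J v0 x + v0 x * KO Omega J dv x) +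
     (dv x * KO Omega J v0 x + dv x * KO Omega J dv x))); last first.
    by apply/funext => x; rewrite K1 /dv -/v0 -/v1; ring.
  rewrite (RintegralD mO (intgD mO i00 i0d) (intgD mO id0 idd)).
  rewrite (RintegralD mO i00 i0d) (RintegralD mO id0 idd) sym.
  by rewrite mulr_natl mulr2n !addrA.
have iP : intg (fun x => Pc (u1 x) - Pc (u0 x)) := intgB mO (intg_Pc m1) (intg_Pc m0).
have iW : intg (fun x => sg * (Pc (u1 x) - Pc (u0 x))) := intgZ mO sg iP.
have WE : Int (dissipation u0 u1) = sg * (Int (Pc \o u1) - Int (Pc \o u0))
   - sg * beta * (Int (fun x => dv x * KO Omega J v0 x) + (f 0 + h) * Int dv).
  rewrite (_ : dissipation u0 u1 = (fun x => sg * (Pc (u1 x) - Pc (u0 x)) -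
      sg * beta * (dv x * KO Omega J v0 x + (f 0 + h) * dv x))); last first.
    apply/funext => x; rewrite /dissipation /drive KO_excess// -/v0 /dv /excess.
    by ring.
  have i1 : intg (fun x => (f 0 + h) * dv x) by exact: intgZ.
  have iD : intg (fun x => dv x * KO Omega J v0 x + (f 0 + h) * dv x) := intgD mO id0 i1.
  rewrite (RintegralB mO iW (intgZ mO (sg * beta) iD)).
  rewrite (RintegralZl sg mO iP) (RintegralZl (sg * beta) mO iD).
  rewrite (RintegralD mO id0 i1) (RintegralZl (f 0 + h) mO idv).
  by rewrite (RintegralB mO (intg_Pc m1) (intg_Pc m0)).
have dvE : Int dv = Int v1 - Int v0 by rewrite -RintegralB.
rewrite /energy -/v0 -/v1 quad WE dvE.
move: (Int (fun x => v0 x * KO Omega J v0 x)) (Int (fun x => dv x * KO Omega J v0 x))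
  (Int (fun x => dv x * KO Omega J dv x)) (Int v1) (Int v0) (Int (Pc \o u1))
  (Int (Pc \o u0)) (f 0 + h) => q0 q01 q1 n1 n0 p1 p0 c.
field.
by rewrite gt_eqF.
Qed.

Let beta_ge0 : 0 <= beta. Proof. exact: ltW. Qed.

Let ibeta_ge0 : 0 <= beta^-1. Proof. by rewrite invr_ge0. Qed.

Let drive_bound_ge0 : 0 <= drive_bound.
Proof. by rewrite /drive_bound addr_ge0// mulr_ge0// addr_ge0. Qed.

Let fc_lip u v : in_ball u -> in_ball v ->
  {ae mu, forall x, Omega x -> `|excess u x - excess v x| <= Lf * `|u x - v x|}.
Proof.
move=> [_ ub] [_ vb]; apply: filterS2 ub vb => x hu hv Ox.
have {}hu := rho_norm (hu Ox); have {}hv := rho_norm (hv Ox).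
rewrite /excess /fc !clamp_id//.
rewrite (_ : _ - _ - _ = f (u x) - f (v x)); [exact: f_lip|ring].
Qed.

Lemma energy_bounded : exists B : R, forall u, measurable_fun setT u -> `|energy u| <= B.
Proof.
have [B B0 HB] := Pc_bounded.
exists ((1 / 2) * (M * M * muO) + `|f 0 + h| * (M * muO) + beta^-1 * (B * muO)).
move=> u m_u; have mv := measurable_excess m_u; have iv := intg_excess m_u.
have int_le phi (C : R) : intg phi -> (forall x, `|phi x| <= C) -> `|Int phi| <= C * muO.
  move=> iphi phiC; apply: le_trans (normr_int_le mO iphi) _.
  rewrite -(Rintegral_cst mu mO); apply: le_l1norm => //; first exact: intg_cst.
  exact/aeW.
have vB := excess_bound u.
have q1 : `|Int (fun x => excess u x * KO Omega J (excess u) x)| <= M * M * muO.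
  apply: int_le; first exact: (intg_MKO mv vB mv vB).
  by move=> x; rewrite normrM; apply: ler_pM => //; exact: KO_bound.
have q2 : `|Int (excess u)| <= M * muO by exact: int_le.
have q3 : `|Int (Pc \o u)| <= B * muO by apply: int_le; [exact: intg_Pc|move=> x; exact: HB].
rewrite /energy normrM sg1 [leLHS]mul1r.
apply: le_trans (ler_normD _ _) _; apply: lerD.
  apply: le_trans (ler_normB _ _) _; apply: lerD.
    have half0 : 0 <= 1 / 2 :> R by rewrite divr_ge0.
    by rewrite normrM normrN (ger0_norm half0) ler_wpM2l.
  by rewrite normrM ler_wpM2l.
by rewrite normrM (ger0_norm ibeta_ge0) ler_wpM2l.
Qed.

(** The potential is continuous but may have infinite slope at [rho], hence the
    term [e]. *)
Lemma energy_almost_lipschitz (e : R) : 0 < e -> exists2 C : R, 0 <= C &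
  forall u w, measurable_fun setT u -> measurable_fun setT w -> in_ball u -> in_ball w ->
    energy u - energy w <= e + C * l1norm (fun x => u x - w x).
Proof.
move=> e0; pose e1 := beta * e / (muO + 1).
have muO1 : 0 < muO + 1 by rewrite ltr_wpDl.
have e10 : 0 < e1 by rewrite !mulr_gt0 ?invr_gt0.
have [C C0 HC] := almost_lipschitz_itv rho cPc e10.
pose A := drive_bound.
exists (beta^-1 * (C + A * Lf) + M * Lf).
  by apply: addr_ge0; apply: mulr_ge0 => //; apply: addr_ge0 => //; exact: mulr_ge0.
move=> u w m_u m_w bu bw.
have iD : intg (fun x => `|u x - w x|) by apply/intg_norm/intgB => //; [case: bu|case: bw].
set n := l1norm _.
have n0 : 0 <= n by exact: l1norm_ge0.
rewrite energyB//; set dv := fun x => excess u x - excess w x.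
have dvl := fc_lip bu bw.
have h1 : Int (dissipation w u) <= e1 * muO + (C + A * Lf) * n.
  have -> : e1 * muO + (C + A * Lf) * n = Int (fun x => e1 + (C + A * Lf) * `|u x - w x|).
    rewrite RintegralD//; [|exact: intg_cst|exact: intgZ].
    by rewrite Rintegral_cst// RintegralZl.
  apply: le_int_ae => //.
  - exact: intg_dissipation.
  - by apply: intgD => //; [exact: intg_cst|exact: intgZ].
  have [_ ub] := bu; have [_ wb] := bw.
  apply: filterS3 dvl ub wb => x hdv hu hw Ox.
  have {}hu := rho_norm (hu Ox); have {}hw := rho_norm (hw Ox); have {}hdv := hdv Ox.
  have hP := HC _ _ hu hw.
  have hd : `|drive w x| <= A by rewrite ler_norml; exact: drive_bounded.
  apply: le_trans (ler_norm _) _; rewrite /dissipation.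
  have -> : fc (u x) - fc (w x) = excess u x - excess w x by rewrite /excess; ring.
  apply: le_trans (ler_normB _ _) _; rewrite !normrM sg1 !mul1r mulrDl addrA.
  apply: lerD => //; rewrite -mulrA; apply: ler_pM => //.
have mdv : measurable_fun setT dv by apply: measurable_funB; exact: measurable_excess.
have dvB x : `|dv x| <= M + M.
  by apply: le_trans (ler_normB _ _) (lerD _ _); exact: excess_bound.
have MM0 : 0 <= M + M by rewrite addr_ge0.
have idd : intg (fun x => dv x * KO Omega J dv x) by exact: (intg_MKO mdv dvB mdv dvB).
have h2 : `|Int (fun x => dv x * KO Omega J dv x)| <= 2 * M * Lf * n.
  apply: le_trans (normr_int_le mO idd) _.
  rewrite -RintegralZl//; apply: le_l1norm => //; first exact: intgZ.
  apply: filterS dvl => x hdv Ox; rewrite normrM mulrC -mulrA; apply: ler_pM => //.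
    by rewrite mulr_natl mulr2n; exact: KO_bound.
  exact: hdv.
have h3 : - (sg / 2 * Int (fun x => dv x * KO Omega J dv x)) <= M * Lf * n.
  apply: le_trans (ler_norm _) _; rewrite normrN !normrM sg1 mul1r.
  by rewrite (ger0_norm (_ : 0 <= 2^-1))//; move: h2; lra.
have h4 : beta^-1 * (e1 * muO) <= e.
  rewrite /e1 !mulrA mulVf ?gt_eqF// mul1r mulrAC ler_pdivrMr// ler_wpM2l ?(ltW e0)//.
  by rewrite lerDl.
have := ler_wpM2l ibeta_ge0 h1.
move: h3 h4; rewrite mulrDr mulrDl !mulrA; lra.
Qed.

Let ginv_clamp r : r < rho -> 0 <= r -> continuous (ginv \o clamp r).
Proof.
move=> rr r0 x; apply: continuous_comp; first exact: clamp_continuous.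
by apply: ginv_cont; have /andP[? ?] := clamp_itv x r0; apply/andP; split; lra.
Qed.

Section energy_along_solution.
Variables (u : R -> 'rV[R]_N -> R) (r : R).
Hypotheses (su : l1_solution u) (m_u : forall t : R, 0 <= t -> measurable_fun setT (u t))
  (r_ge0 : 0 <= r) (r_lt : r < rho) (rho1_r : rho1 <= r)
  (ur : forall t : R, 0 <= t -> {ae mu, forall x, Omega x -> `|u t x| <= r}).

Let ub t : 0 <= t -> in_ball (u t).
Proof.
move=> t0; split; first by case: su => + _ _; exact.
by apply: filterS (ur t0) => x hx /hx /le_trans; apply; exact: ltW.
Qed.

(** The quadratic remainder of the increment is of order [s ^+ 2]; the pointwise
    estimate combines [dissipation_pointwise] with the second-order expansion of
    the solution. It needs [ginv] bounded and uniformly continuous, which is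
    why the solution is assumed to stay within a radius [r < rho]. *)
Lemma energy_step (e : R) : 0 < e -> exists2 d : R, 0 < d & forall s : R, 0 < s -> s < d ->
  energy (u s) <= energy (u 0) + beta^-1 * Int (dissipation (u 0) (u s)) + e * s /\
  {ae mu, forall x, Omega x -> dissipation (u 0) (u s) x <=
     slack f ginv sg (u 0 x) (reaction (u 0) x) s + e * s}.
Proof.
move=> e0; have u0b := ub (lexx 0).
have [Gam Gam0 HGam] := compact_prod_bounded (@segment_compact _ (- r) r)
  (ginv_clamp r_lt r_ge0).
pose C := reaction_lip * (2 * rho * muO).
have C0 : 0 <= C by rewrite !mulr_ge0 ?reaction_lip_ge0// ltW.
pose L := Lf * (2 * rho).
have L0 : 0 <= L by rewrite !mulr_ge0// ltW.
pose eta := e / 2 / (L + 1).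
have eta0 : 0 < eta by rewrite !divr_gt0// ltr_wpDl.
have [del del0 Hdel] := uniformly_continuous_itv r (ginv_clamp r_lt r_ge0) eta0.
pose D1 := 2 * Gam * (Lf * C); pose D2 := 1 / 2 * (L * L * muO).
have D10 : 0 <= D1 by rewrite !mulr_ge0// ltW.
have D20 : 0 <= D2.
  by apply: mulr_ge0; [exact: divr_ge0|apply: mulr_ge0 => //; exact: mulr_ge0].
(* [del] is the modulus of [ginv]; [D1] and [D2] are the coefficients of the
   second-order errors, which are thus fractions of [e * s] *)
exists (Num.min 1 (Num.min (del / (C + 1)) (Num.min (e / 2 / (D1 + 1)) (e / (D2 + 1))))).
  by rewrite !lt_min ltr01 !divr_gt0// ltr_wpDl.
move=> s s0; rewrite !lt_min => /and4P[s1 sdel sD1 sD2].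
have s_ge0 := ltW s0.
rewrite ltr_pdivlMr ?ltr_wpDl// in sdel; rewrite ltr_pdivlMr ?ltr_wpDl// in sD1.
rewrite ltr_pdivlMr ?ltr_wpDl// in sD2.
have m0 := m_u (lexx 0); have ms := m_u s_ge0; have usb := ub s_ge0.
have lip := solution_lip_start su u0b s_ge0.
pose dv x := excess (u s) x - excess (u 0) x.
split.
  have := energyB m0 ms u0b; rewrite /= -/dv => E.
  have mdv : measurable_fun setT dv by apply: measurable_funB; exact: measurable_excess.
  have dvB x : `|dv x| <= M + M.
    by apply: le_trans (ler_normB _ _) (lerD _ _); exact: excess_bound.
  have MM0 : 0 <= M + M by rewrite addr_ge0.
  have idd : intg (fun x => dv x * KO Omega J dv x) by exact: (intg_MKO mdv dvB mdv dvB).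
  have dvs : {ae mu, forall x, Omega x -> `|dv x| <= L * s}.
    apply: filterS2 (fc_lip usb u0b) lip => x h1 h2 Ox.
    apply: le_trans (h1 Ox) _; rewrite /L -mulrA ler_wpM2l//; exact: h2.
  have Ls0 : 0 <= L * s by rewrite mulr_ge0.
  have h2 : `|Int (fun x => dv x * KO Omega J dv x)| <= (L * s) * (L * s) * muO.
    apply: le_trans (normr_int_le mO idd) _.
    rewrite -(Rintegral_cst mu mO); apply: le_l1norm => //; first exact: intg_cst.
    apply: filterS (dvs) => x hx Ox; rewrite normrM; apply: ler_pM => //; first exact: hx.
    apply: (KO_le_sup mO bO cJ J_ge0 J_int1) => //.
    exact: bounded_intg dvB.
  have h3 : - (sg / 2 * Int (fun x => dv x * KO Omega J dv x)) <= D2 * s * s.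
    apply: le_trans (ler_norm _) _; rewrite normrN !normrM sg1 mul1r.
    by rewrite (ger0_norm (_ : 0 <= 2^-1))//; move: h2; rewrite /D2; nra.
  have h4 : D2 * s * s <= e * s.
    by rewrite ler_wpM2r//; move: sD2; nra.
  by move: E h3 h4; lra.
have second := solution_second_start su u0b s_ge0.
apply: filterS2 (filterI second lip) (filterI (ur (lexx 0)) (ur s_ge0)) => x [x1 x2] [x3 x4] Ox.
have a0r : - r <= u 0 x <= r by rewrite -ler_norml; exact: x3.
have asr : - r <= u s x <= r by rewrite -ler_norml; exact: x4.
have {}x1 := x1 Ox; have {}x2 := x2 Ox.
set F := reaction (u 0) x.
have Fr : - r <= F <= r by rewrite -ler_norml (le_trans _ rho1_r)//; exact: reaction_bounded.
have br := relaxed_itv s_ge0 a0r Fr.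
have bs : `|u s x - relaxed (u 0 x) F s| <= C * s ^+ 2.
  by rewrite /relaxed opprD addrA; exact: x1.
have s2 : C * s ^+ 2 <= C * s by rewrite ler_wpM2l// expr2 ler_piMr// ltW.
have geta : `|ginv (u s x) - ginv (relaxed (u 0 x) F s)| <= eta.
  have := Hdel (u s x) (relaxed (u 0 x) F s) asr; rewrite /= !clamp_id//; apply.
  by apply: le_lt_trans bs _; move: sdel; nra.
have ginvG y : - r <= y <= r -> `|ginv y| <= Gam.
  by move=> yr; have := HGam y; rewrite /= clamp_id//; apply; rewrite /= in_itv.
have in_rho y : - r <= y <= r -> clamp rho y = y.
  by rewrite -!ler_norml => yr; rewrite clamp_id// -ler_norml (le_trans yr)// ltW.
have := dissipation_pointwise sg1 PF_convex Lf_ge0 (ltW eta0) (ltW Gam0) r_lt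
  f_lip ginvG a0r asr Fr s_ge0 geta bs x2.
rewrite /dissipation /Pc /fc !in_rho// -/F.
have -> : ginv F = drive (u 0) x by rewrite /F /reaction gK.
move=> /le_trans; apply; rewrite -addrA lerD2l.
have h1 : eta * (L * s) <= e / 2 * s.
  rewrite mulrA ler_wpM2r//; rewrite /eta mulrAC ler_pdivrMr ?ltr_wpDl//.
  by rewrite ler_wpM2l ?divr_ge0 ?(ltW e0)// lerDl.
have h2 : D1 * s ^+ 2 <= e / 2 * s.
  by rewrite expr2 mulrA ler_wpM2r//; move: sD1; nra.
move: h1 h2; rewrite /L /D1; nra.
Qed.

Lemma energy_step_le (e : R) : 0 < e -> exists2 d : R, 0 < d & forall s : R, 0 < s -> s < d ->
  energy (u s) <= energy (u 0) + e * s.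
Proof.
move=> e0; pose e1 := e / (beta^-1 * muO + 1).
have b0 : 0 <= beta^-1 * muO by rewrite mulr_ge0.
have e10 : 0 < e1 by rewrite divr_gt0// ltr_wpDl.
have [d d0 Hd] := energy_step e10; exists d => // s s0 sd.
have [h1 h2] := Hd s s0 sd; apply: le_trans h1 _; rewrite -addrA lerD2l.
have m0 := m_u (lexx 0); have ms := m_u (ltW s0); have u0b := ub (lexx 0).
have : Int (dissipation (u 0) (u s)) <= e1 * s * muO.
  rewrite -(Rintegral_cst mu mO); apply: le_int_ae => //.
  - exact: intg_dissipation.
  - exact: intg_cst.
  apply: filterS2 h2 (ur (lexx 0)) => x hx hr Ox; apply: le_trans (hx Ox) _.
  rewrite gerDr; apply: (slack_le0 f_incr sg_ginv); last exact: ltW.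
    by rewrite -ltr_norml; exact: le_lt_trans (hr Ox) r_lt.
  rewrite -ltr_norml; apply: le_lt_trans (reaction_bounded x u0b) _.
  exact: le_lt_trans rho1_r r_lt.
move=> /(ler_wpM2l ibeta_ge0) h3.
apply: le_trans (lerD h3 (lexx _)) _.
have -> : beta^-1 * (e1 * s * muO) + e1 * s = e1 * (beta^-1 * muO + 1) * s by ring.
by rewrite /e1 divfK// gt_eqF// ltr_wpDl.
Qed.

(** If the energy is constant, the step estimate bounds the integrals of the
    difference quotients [- dissipation / s] by [o(1)] along a sequence of times.
    By Fatou's lemma they cannot stay bounded below on a set of positive measure,
    whereas [slack_lower] bounds them below wherever the field
    differs from the solution. *)
Lemma energy_constant_equilibrium :
  (forall t : R, 0 <= t -> energy (u t) = energy (u 0)) ->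
  {ae mu, forall x, Omega x -> reaction (u 0) x = u 0 x}.
Proof.
move=> cst_energy; have u0b := ub (lexx 0); have m0 := m_u (lexx 0).
pose en (n : nat) : R := n.+1%:R^-1.
have en0 n : 0 < en n by rewrite invr_gt0.
pose dn n := sval (cid2 (energy_step (en0 n))).
have dn0 n : 0 < dn n by rewrite /dn; case: cid2.
have Hdn n (s : R) : 0 < s -> s < dn n ->
    energy (u s) <= energy (u 0) + beta^-1 * Int (dissipation (u 0) (u s)) + en n * s /\
    {ae mu, forall x, Omega x -> dissipation (u 0) (u s) x <=
       slack f ginv sg (u 0 x) (reaction (u 0) x) s + en n * s}.
  by rewrite /dn; case: cid2 => d d0 /= H; exact: H.
(* times tending to zero at which the step estimate holds with error [en n] *)
pose sn n := Num.min (dn n / 2) (en n).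
have sn0 n : 0 < sn n by rewrite lt_min en0 divr_gt0.
have sn_dn n : sn n < dn n by rewrite gt_min; apply/orP; left; have := dn0 n; lra.
pose W n := dissipation (u 0) (u (sn n)).
have iW n : intg (W n) by apply: intg_dissipation => //; apply: m_u; exact: ltW.
pose psi n x := en n - (sn n)^-1 * W n x.
have ipsi n : intg (psi n) by apply: intgB => //; [exact: intg_cst|exact: intgZ].
pose phi n x := Num.max 0 (psi n x).
have psi_slack n : {ae mu, forall x, Omega x ->
    - ((sn n)^-1 * slack f ginv sg (u 0 x) (reaction (u 0) x) (sn n)) <= psi n x}.
  have [_ hW] := Hdn n (sn n) (sn0 n) (sn_dn n).
  apply: filterS hW => x hx Ox; rewrite /psi -/(W n) in hx *.
  have isn0 : 0 <= (sn n)^-1 by rewrite invr_ge0 ltW.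
  have snV : (sn n)^-1 * (en n * sn n) = en n by rewrite mulrCA mulVf ?gt_eqF// mulr1.
  by have := ler_wpM2l isn0 (hx Ox); rewrite [X in _ <= X -> _]mulrDr snV; lra.
have in_rho_u0 : {ae mu, forall x, Omega x -> - rho < u 0 x < rho}.
  by apply: filterS (ur (lexx 0)) => x hx Ox; rewrite -ltr_norml (le_lt_trans (hx Ox)).
have in_rho_F x : - rho < reaction (u 0) x < rho.
  by rewrite -ltr_norml; exact: g_lt_rho.
have psi_ge0 n : {ae mu, forall x, Omega x -> 0 <= psi n x}.
  apply: filterS2 (psi_slack n) in_rho_u0 => x h1 h2 Ox.
  apply: le_trans (h1 Ox); rewrite oppr_ge0 mulr_ge0_le0 ?invr_ge0 ?(ltW (sn0 n))//.
  by apply: (slack_le0 f_incr sg_ginv); [exact: h2|exact: in_rho_F|exact: ltW].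
have int_phi n : Int (phi n) <= en n * (muO + beta).
  apply: (@le_trans _ _ (Int (psi n))).
    apply: le_int_ae => //; first exact: intg_max0.
    by apply: filterS (psi_ge0 n) => x hx Ox; rewrite /phi max_r// hx.
  rewrite /psi RintegralB//; [|exact: intg_cst|exact: intgZ].
  rewrite Rintegral_cst// RintegralZl//.
  have [hW _] := Hdn n (sn n) (sn0 n) (sn_dn n).
  rewrite cst_energy ?(ltW (sn0 n))// in hW.
  have {}hW : - (beta^-1 * Int (W n)) <= en n * sn n by rewrite /W; lra.
  rewrite mulrDr lerD2l.
  have : beta * - (beta^-1 * Int (W n)) <= beta * (en n * sn n) by rewrite ler_wpM2l.
  rewrite mulrN mulVKf ?gt_eqF// => h'.
  rewrite -mulrN mulrC ler_pdivrMr//.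
  by rewrite (_ : en n * beta * sn n = beta * (en n * sn n)); [exact: h'|ring].
have van := int_vanishing_inf mO (phi := phi)
  (fun n => intg_max0 mO (ipsi n)) (fun n x => _).
have {van}van : {ae mu, forall x, Omega x -> forall (c : R) m, 0 < c ->
     (forall n, (m <= n)%N -> c <= phi n x) -> False}.
  apply: van => [n x|e m e0]; first by rewrite le_max lexx.
  have mb : 0 < muO + beta by rewrite ltr_wpDl.
  have ee0 : 0 < e / (muO + beta) by rewrite divr_gt0.
  exists (maxn m (Num.truncn (e / (muO + beta))^-1)); first exact: leq_maxl.
  apply: le_trans (int_phi _) _; rewrite -ler_pdivlMr//.
  rewrite /en -[leRHS]invrK lef_pV2 ?posrE ?invr_gt0//.
  apply: ltW; apply: (lt_le_trans (truncnS_gt _)).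
  by rewrite ler_nat ltnS leq_maxr.
have slack_all : {ae mu, forall x, forall n, Omega x ->
    - ((sn n)^-1 * slack f ginv sg (u 0 x) (reaction (u 0) x) (sn n)) <= psi n x}.
  by apply: ae_foralln => n; exact: psi_slack.
apply: filterS3 van slack_all in_rho_u0 => x vx sx rx Ox.
apply/eqP/negPn/negP => neq.
have neq' : u 0 x != reaction (u 0) x by rewrite eq_sym.
have [c [d [c0 d0] Hd]] := slack_lower sg1 f_incr f_derivable f'_gt0 sg_ginv
  ginv_inj (rx Ox) (in_rho_F x) neq'.
apply: (vx Ox c (Num.truncn d^-1) c0) => n nd.
rewrite le_max; apply/orP; right; apply: le_trans (sx n Ox).
have snd : sn n < d.
  apply: (@le_lt_trans _ _ (en n)); first by rewrite ge_min lexx orbT.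
  rewrite /en -[ltRHS]invrK ltf_pV2 ?posrE ?invr_gt0//.
  by apply: (lt_le_trans (truncnS_gt _)); rewrite ler_nat ltnS.
have := Hd (sn n) (sn0 n) snd; rewrite lerNr => h1.
by rewrite -mulrN mulrC ler_pdivlMr.
Qed.

End energy_along_solution.

Section energy_decrease.
Variable u : R -> 'rV[R]_N -> R.
Hypotheses (su : l1_solution u) (m_u : forall t : R, 0 <= t -> measurable_fun setT (u t))
  (u0_ball : in_ball (u 0)).

Let shift_ball (s : R) : 0 <= s -> in_ball (u (s + 0)).
Proof. by move=> s0; rewrite addr0; exact: (solution_ball su). Qed.

Lemma solution_l1_lip (s t : R) : 0 <= s -> 0 <= t ->
  l1norm (fun x => u (s + t) x - u s x) <= 2 * rho * muO * t.
Proof.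
move=> s0 t0.
have ss := l1_solution_shift s0 su.
have := solution_lip_start ss (shift_ball s0) t0; rewrite addr0 => h1.
rewrite mulrAC -(Rintegral_cst mu mO); apply: le_l1norm => //; last exact: intg_cst.
by have [iu _ _] := su; apply: intgB => //; apply: iu => //; rewrite addr_ge0.
Qed.

Lemma energy_left_semicontinuous (e : R) : 0 < e -> exists2 d : R, 0 < d &
  forall s t : R, 0 <= s -> 0 <= t -> t < d ->
    energy (u (s + t)) <= energy (u s) + e /\ energy (u s) <= energy (u (s + t)) + e.
Proof.
move=> e0; have e20 : 0 < e / 2 by rewrite divr_gt0.
have [C C0 HC] := energy_almost_lipschitz e20.
pose D := C * (2 * rho * muO).
have D0 : 0 <= D by rewrite !mulr_ge0// ltW.
exists (e / 2 / (D + 1)); first by rewrite divr_gt0// ltr_wpDl.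
move=> s t s0 t0; rewrite ltr_pdivlMr ?ltr_wpDl// => td.
have st0 : 0 <= s + t by rewrite addr_ge0.
have bs := solution_ball su u0_ball s0; have bst := solution_ball su u0_ball st0.
have h1 := HC _ _ (m_u st0) (m_u s0) bst bs.
have h2 := HC _ _ (m_u s0) (m_u st0) bs bst.
have h3 := ler_wpM2l C0 (solution_l1_lip s0 t0).
rewrite l1normBC in h2.
have h4 : C * (2 * rho * muO * t) = D * t by rewrite /D; ring.
have h5 : D * t <= t * (D + 1) by rewrite mulrDr mulr1 mulrC lerDl.
by split; lra.
Qed.

Let energy_decrease_pos (s t : R) : 0 < s -> s <= t -> energy (u t) <= energy (u s).
Proof.
move=> s0 st; have [r0 r1 r2] := inner_radius_bounds s0.
pose phi tau := energy (u (s + tau)).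
have E : s + (t - s) = t by rewrite addrC subrK.
suff : phi (t - s) <= phi 0 by rewrite /phi E addr0.
apply: (@dini_nonincreasing R phi (t - s)); rewrite /phi.
- by rewrite subr_ge0.
- move=> tau e tau0 _ e0.
  have s_tau : 0 <= s + tau by rewrite addr_ge0// ltW.
  have ss := l1_solution_shift s_tau su.
  have ms (a : R) : 0 <= a -> measurable_fun setT (u (s + tau + a)).
    by move=> a0; apply: m_u; rewrite addr_ge0.
  have us (a : R) : 0 <= a -> {ae mu, forall x, Omega x -> `|u (s + tau + a) x| <= inner_radius s}.
    by move=> a0; rewrite -addrA; apply: (solution_inner su u0_ball); rewrite ?addr_ge0// ltW.
  have [d d0 Hd] := energy_step_le ss ms r0 r1 r2 us e0.
  exists d => // a a0 ad _; have := Hd a a0 ad.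
  by rewrite addr0 addrA.
move=> tau e tau0 _ e0; have [d d0 Hd] := energy_left_semicontinuous e0.
exists d => // a a0 ad atau.
have h0 : 0 <= s + (tau - a) by rewrite addr_ge0 ?subr_ge0// ltW.
have [+ _] := Hd (s + (tau - a)) a h0 (ltW a0) ad.
by rewrite -addrA subrK.
Qed.

(** After a positive time the solution lies in a smaller ball and the step
    estimate feeds [dini_nonincreasing]; continuity in time extends the
    inequality to the initial time. *)
Lemma energy_nonincreasing (s t : R) : 0 <= s -> s <= t -> energy (u t) <= energy (u s).
Proof.
rewrite le_eqVlt => /predU1P[<-|s0]; last exact: energy_decrease_pos.
rewrite le_eqVlt => /predU1P[<-//|t0].
apply/ler_addgt0Pr => e e0; have [d d0 Hd] := energy_left_semicontinuous e0.
pose a := Num.min t (d / 2).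
have a0 : 0 < a by rewrite lt_min t0 divr_gt0.
have at_ : a <= t by rewrite ge_min lexx.
have ad : a < d by rewrite gt_min; apply/orP; right; lra.
have [+ _] := Hd 0 a (lexx _) (ltW a0) ad.
by rewrite add0r; apply: le_trans; exact: energy_decrease_pos.
Qed.

End energy_decrease.


(** * Gradient structure *)

Section lyapunov.
Variables (p : \bar R) (p1 : (1 <= p)%E).
Local Notation Lp := (LspaceType mu p1).
Local Notation DD := (phase_ball Omega p1 rho).

Lemma energy_continuous : {within DD, continuous (fun a : Lp => energy a)}.
Proof.
apply/subspace_continuousP => a Da; apply/cvgrPdist_le => e e0.
have [_ ba] := (phase_ballP a).1 Da.
have e20 : 0 < e / 2 by rewrite divr_gt0.
have [C C0 HC] := energy_almost_lipschitz e20.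
have [C' C'0 HC'] := @l1norm_le_mdist _ _ _ mu _ mO fO _ p1.
have CC0 : 0 <= C * C' by rewrite mulr_ge0.
apply/nbhs_mdistP; exists (e / 2 / (C * C' + 1)); first by rewrite divr_gt0// ltr_wpDl.
move=> b; rewrite ltr_pdivlMr ?ltr_wpDl// => ab Db; have [_ bb] := (phase_ballP b).1 Db.
have [_ h0] := HC' a b.
have h1 := HC a b (measurable_Lspace a) (measurable_Lspace b) ba bb.
have h2 := HC b a (measurable_Lspace b) (measurable_Lspace a) bb ba.
rewrite l1normBC in h2.
have h3 := ler_wpM2l C0 h0; rewrite mulrA in h3.
have h4 := mdist_ge0 a b.
by rewrite /from_subspace/= ler_norml; apply/andP; split; nra.
Qed.

Lemma rest_phase_solution (a : Lp) : DD a ->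
  {ae mu, forall x, Omega x -> reaction a x = a x} -> phase_solution (fun=> a).
Proof.
move=> /phase_ballP[a0 ba] eqa; have [ia _] := ba; split => //.
have ir := intg_reaction ia.
split => // t e _ e0; exists 1 => // s _ _.
apply: (@le_trans _ _ 0); last by rewrite mulr_ge0// ltW.
rewrite -[leRHS](mul0r muO) -(Rintegral_cst mu mO 0); apply: le_l1norm => //.
- by apply: intgB => //; [exact: intgB|apply: intgZ => //; exact: intgB].
- exact: (intg_cst mO fO 0).
by apply: filterS eqa => x hx Ox; rewrite hx// !subrr mulr0 subrr normr0.
Qed.

Variable T : R -> Lp -> Lp.
Hypothesis T_flow : generates_flow Omega J f g beta h T.

(** A point of a complete orbit is the image at time 1 of another point of the
    ball, so the whole forward orbit stays in a smaller ball and
    [energy_constant_equilibrium] applies. The constant function is then a solution, and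
    uniqueness identifies it with the orbit. *)
Lemma constant_energy_equilibrium (phi : R -> Lp) : complete_orbit DD T phi ->
  (forall t, energy (phi t) = energy (phi 0)) -> equilibrium T (phi 0).
Proof.
move=> [Dphi Tphi] cst_energy t t0.
have pu := flow_phase_solution T_flow (Dphi (-1)).
have [su u0b uph] := pu.
have [r0 r1 r2] := inner_radius_bounds ltr01.
have wE (s : R) : 0 <= s -> T (1 + s) (phi (-1)) = phi s.
  by move=> s0; rewrite Tphi ?addr_ge0// addrAC subrr add0r.
have w0E : T (1 + 0) (phi (-1)) = phi 0 by exact: wE.
have eq0 : {ae mu, forall x, Omega x -> reaction (phi 0) x = phi 0 x}.
  have := energy_constant_equilibrium (l1_solution_shift ler01 su)
    (fun s _ => measurable_Lspace _) r0 r1 r2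
    (fun s s0 => solution_inner su u0b ler01 s0).
  rewrite w0E; apply => s s0; rewrite wE//; exact: cst_energy.
rewrite -[RHS]/((fun=> phi 0) t).
apply: (phase_solution_unique (flow_phase_solution T_flow (Dphi 0))
  (rest_phase_solution (Dphi 0) eq0)) => //.
exact: (flow0 T_flow).
Qed.

Lemma energy_lyapunov : lyapunov_functional DD T (Lp_norm mu p1) (fun a : Lp => energy a).
Proof.
split.
- exact: energy_continuous.
- have [B HB] := energy_bounded; exists (- B) => a _.
  by have := HB a (measurable_Lspace a); rewrite ler_norml => /andP[].
- move=> A; have [C C0 HC] := Lnorm_le_bound mO fO p1; exists (C * rho + 1) => a.
  rewrite phase_ballE => ar; rewrite leNgt => /negP[].
  apply: (@le_lt_trans _ _ (C * rho)); last by rewrite ltrDl.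
  have := HC a rho (measurable_Lspace a) (ltW rho_gt0) ar => h1.
  rewrite -lee_fin /Lp_norm fineK// ge0_fin_numE ?Lnorm_ge0//.
  exact: le_lt_trans h1 (ltry _).
- move=> a s t Da s0 st; have [sa a0b _] := flow_phase_solution T_flow Da.
  by apply: (energy_nonincreasing sa) => // tau _; exact: measurable_Lspace.
- exact: constant_energy_equilibrium.
Qed.

Lemma flow_gradient : gradient_on DD T (Lp_norm mu p1).
Proof.
split.
- exact: flow_semigroup.
- by move=> a Da _; exact: (phase_orbit_precompact (flow_phase_solution T_flow Da)).
- by exists (fun a : Lp => energy a); exact: energy_lyapunov.
Qed.

End lyapunov.

End energy.

End neural_reaction.

(** * Monotonicity and bounds of one-variable functions *)

Section real_functions.
Context {R : realType}.

Lemma derive1_gt0_increasing (f : R -> R) : (forall x : R, derivable f x 1) ->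
  (forall x, 0 < derive1 f x) -> forall x y : R, x < y -> f x < f y.
Proof.
move=> df f'0 x y xy.
have cf : {within `[x, y], continuous f}.
  by apply: derivable_within_continuous => z _; exact: df.
apply: (gtr0_derive1_lt_cc _ _ cf) => //.
- by rewrite in_itv/= lexx ltW.
- by rewrite in_itv/= lexx ltW.
Qed.

Lemma derivable_continuous (f : R -> R) : (forall x : R, derivable f x 1) -> continuous f.
Proof. by move=> df x; apply/differentiable_continuous; rewrite -derivable1_diffP. Qed.

Lemma continuous_injective_monotone (f : R -> R) (a b : R) :
  {within `]a, b[, continuous f} -> {in `]a, b[ &, injective f} ->
  exists2 sg : R, `|sg| = 1 & forall x y : R, a < x -> x <= y -> y < b ->
    sg * f x <= sg * f y.
Proof.
move=> cf /(itv_continuous_inj_mono cf)[/le_mono_in mf|/le_nmono_in mf];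
  [exists 1; rewrite ?normr1//|exists (-1); rewrite ?normrN1//] => x y ax xy yb;
  rewrite ?mul1r ?mulN1r ?lerN2 mf// in_itv/=;
  by rewrite ?(lt_le_trans ax xy) ?(le_lt_trans xy yb) ?ax ?yb.
Qed.

Lemma norm_lt_on_compact (g : R -> R) (A rho : R) : continuous g -> 0 <= A ->
  (forall x, `|g x| < rho) -> exists r : R,
    [/\ 0 <= r, r < rho & forall x : R, - A <= x <= A -> `|g x| <= r].
Proof.
move=> cg A0 g_rho.
have cn : {within `[- A, A], continuous (fun x => `|g x|)}.
  by apply: continuous_subspaceT => x; apply: continuous_comp; [exact: cg|exact: norm_continuous].
have NA : - A <= A by rewrite ge0_cp.
have [c _ cmax] := EVT_max NA cn.
exists `|g c|; split => // x xA; apply: cmax; rewrite in_itv//.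
Qed.

End real_functions.

Unset Implicit Arguments.

Theorem proposition6p5 (R : realType) (N : nat) (N_gt0 : (0 < N)%N)
  (Omega : set 'rV[R]_N)
  (Omega_bounded : bounded_set Omega) (Omega_smooth : smooth_domain Omega)
  (h beta : R) (h_ge0 : 0 <= h) (beta_gt0 : 0 < beta)
  (J : 'rV[R]_N -> 'rV[R]_N -> R)
  (J_ge0 : forall x y, 0 <= J x y)
  (J_sym : forall x y, J x y = J y x)
  (J_C1 : class_C 1 (fun z : 'rV[R]_N * 'rV[R]_N => J z.1 z.2))
  (J_int1 : forall x, (\int[lebesgue_rV N]_y (J x y)%:E = 1)%E)
  (J_int2 : forall y, (\int[lebesgue_rV N]_x (J x y)%:E = 1)%E)
  (p : \bar R) (p1 : (1 <= p)%E)
  (f g : R -> R)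
  (f_lip : [locally [lipschitz f x | x in [set: R]]])
  (g_lip : [locally [lipschitz g x | x in [set: R]]])
  (k1 k2 k3 k4 c1 c2 : R)
  (k1_ge0 : 0 <= k1) (k2_ge0 : 0 <= k2) (k3_ge0 : 0 <= k3) (k4_ge0 : 0 <= k4)
  (c1_ge0 : 0 <= c1) (c2_ge0 : 0 <= c2)
  (g_growth : forall x, `|g x| <= k1 * `|x| + k2)
  (f_growth : forall x, `|f x| <= c1 * `|x| + c2)
  (kc_lt1 : k1 * beta * c1 < 1)
  (g_derivable : forall x : R, derivable g x 1)
  (g_C1 : continuous (derive1 g))
  (g'_growth : forall x, `|derive1 g x| <= k3 * `|x| + k4)
  (rho : R) (rho_gt0 : 0 < rho)
  (g_lt_rho : forall x, `|g x| < rho)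
  (finv ginv : R -> R)
  (fK : cancel f finv)
  (gK : cancel g ginv)
  (ginvK : {in `]- rho, rho[, cancel ginv g})
  (ginv_continuous : {in `]- rho, rho[, continuous ginv})
  (theta_wd : theta_well_defined f finv ginv rho)
  (theta_min : exists2 m0 : R, m0 \in `]- rho, rho[ &
     forall m : R, m \in `[- rho, rho] ->
       theta f finv ginv beta h m0 <= theta f finv ginv beta h m)
  (f_derivable : forall x : R, derivable f x 1)
  (f'_gt0 : forall x, 0 < derive1 f x)
  (T : R -> LspaceType (lebesgue_rV N) p1 -> LspaceType (lebesgue_rV N) p1)
  (T_flow : generates_flow Omega J f g beta h T) :
  gradient_on (phase_ball Omega p1 rho) T (Lp_norm (lebesgue_rV N) p1).
Proof.
have [_ oO _ _] := Omega_smooth.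
have mO : measurable Omega by exact: open_measurable_rV.
have cJ : continuous (fun z : 'rV[R]_N * 'rV[R]_N => J z.1 z.2).
  exact: class_C1_continuous.
have cf := derivable_continuous f_derivable.
have cg := derivable_continuous g_derivable.
have f_incr := derive1_gt0_increasing f_derivable f'_gt0.
have [Lf Lf_ge0 f_Lf] := locally_lipschitz_itv rho f_lip.
pose A := drive_bound f beta h rho Lf.
have A_ge0 : 0 <= A.
  by rewrite /A /drive_bound addr_ge0 ?mulr_ge0 ?addr_ge0 ?mulr_ge0// ltW.
have [Lg Lg_ge0 g_Lg] := locally_lipschitz_itv A g_lip.
have [CJ /ltW CJ_ge0 J_CJ] := kernel_bounded Omega_bounded cJ.
have [rho1 [rho1_ge0 rho1_lt g_rho1]] := norm_lt_on_compact cg A_ge0 g_lt_rho.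
have ginv_inj x y : - rho < x < rho -> - rho < y < rho -> ginv x = ginv y -> x = y.
  move=> xr yr xy; rewrite -[x]ginvK ?in_itv//= xy.
  by rewrite ginvK ?in_itv.
have ginv_cont x : - rho < x < rho -> {for x, continuous ginv}.
  by move=> xr; apply: ginv_continuous; rewrite in_itv.
have [sg sg1 sg_ginv] : exists2 sg : R, `|sg| = 1 & forall x y : R,
    - rho < x -> x <= y -> y < rho -> sg * ginv x <= sg * ginv y.
  apply: continuous_injective_monotone.
    apply: (continuous_in_subspaceT) => x; rewrite inE => xr; exact: ginv_continuous.
  by move=> x y; rewrite !in_itv/= => xr yr; exact: ginv_inj.
have PF_cont := potential_continuous rho_gt0 cf f_incr theta_wd.
have PF_convex := potential_convex rho_gt0 cf f_incr fK theta_wd sg_ginv.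
exact: (flow_gradient mO Omega_bounded cJ J_ge0 J_int1 beta_gt0 h_ge0 rho_gt0 cf cg f_growth
  g_lt_rho Lf_ge0 Lg_ge0 CJ_ge0 rho1_ge0 rho1_lt f_Lf g_Lg g_rho1 J_CJ J_sym sg1 f_incr
  f_derivable f'_gt0 gK ginv_cont sg_ginv ginv_inj PF_cont PF_convex T_flow).
Qed.
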